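(* Let $(\theta_n)_{n\in\mathbb{Z}}$ be independent random variables uniformly distributed on $[0,1]$, $X_n=e^{2\pi i\theta_n}$, and consider the random generalization of the Riemann function $$\phi_\Theta(t)=\sum_{n\in\mathbb{Z}}\frac{(e^{-4\pi^2in^2t}-1)X_n}{-4\pi^2n^2},\qquad t\in\mathbb{R},$$ where the $n=0$ term is interpreted as $itX_0$. Then for any Borel set $A\subset\mathbb{R}$, $$\dim_{\mathcal H}\phi_\Theta(A)=\frac43\dim_{\mathcal H}A\qquad\text{almost surely}.$$
   Context: $\dim_{\mathcal H}$ is Hausdorff dimension; $\phi_\Theta$ takes values in $\mathbb{C}\cong\mathbb{R}^2$. Equivalently, $$\phi_\Theta(t)=-\frac1{4\pi^2}R_{2,2,\Theta^+}(-2\pi t)-\frac1{4\pi^2}R_{2,2,\Theta^-}(-2\pi t)+itX_0+\sum_{n\ne0}\frac{X_n}{4\pi^2n^2},$$ where $R_{2,2,\Theta^{\pm}}(x)=\sum_{n\ge1}n^{-2}e^{2\pi i(n^2x+\theta_{\pm n})}$. The exceptional null event may depend on $A$. *)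

(* Defs.v *)
From HB Require Import structures.
From mathcomp Require Import all_boot all_order all_algebra.
From mathcomp Require Import complex.
From mathcomp Require Import all_classical all_reals all_analysis.

Set Implicit Arguments.
Unset Strict Implicit.
Unset Printing Implicit Defensive.

Import Order.TTheory GRing.Theory Num.Theory.
Import numFieldNormedType.Exports.

Local Open Scope classical_set_scope.
Local Open Scope ring_scope.

Section HausdorffDimension.
Context {R : realType} {V : normedZmodType R}.
Implicit Types (A U : set V) (s delta : R).

(* The maximum with 0 makes the diameter of the empty set 0 rather than -oo. *)
Definition diameter U : \bar R :=
  maxe 0%E (ereal_sup [set `|x - y|%:E | x in U & y in U]).

(* Empty pieces of a cover are left out of the sum: they would contribute
   0 `^ 0 = 1 when s = 0. *)
Definition hausdorff_content s delta A : \bar R :=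
  ereal_inf [set (\sum_(i <oo | U i != set0) diameter (U i) `^ s)%E |
    U in [set U : nat -> set V | A `<=` \bigcup_i U i /\
      forall i, (diameter (U i) <= delta%:E)%E]].

Definition hausdorff_measure s A : \bar R :=
  ereal_sup [set hausdorff_content s delta A | delta in [set delta | 0 < delta]].

Definition hausdorff_dim A : \bar R :=
  ereal_inf [set s%:E | s in [set s | 0 <= s /\ hausdorff_measure s A = 0%E]].

End HausdorffDimension.

Section Randomness.
Context {d : measure_display} {T : measurableType d} {R : realType}.
Context (P : probability T R).

(* The empty intersection is the whole space, so s = [::] is harmless. *)
Definition mutually_independent (I : choiceType) (X : I -> {RV P >-> R}) :=
  forall (s : seq I) (B : I -> set R), uniq s -> (forall i, measurable (B i)) ->
    P (\bigcap_(i in [set` s]) (X i @^-1` B i)) =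
    (\prod_(i <- s) P (X i @^-1` B i))%E.

Definition uniform01 (X : {RV P >-> R}) :=
  forall B : set R, measurable B ->
    distribution P X B = uniform_prob (@ltr01 R) B.

End Randomness.

Section RandomRiemann.
Context {R : realType}.
Local Open Scope complex_scope.

(* e^{ix} for real x *)
Definition expi (x : R) : R[i] := cos x +i* sin x.

Definition riemann_term (theta : int -> R) (t : R) (n : int) : R[i] :=
  let X := expi (2 * pi * theta n) in
  if n == 0 then (0 +i* t) * X
  else (expi (- (4 * pi ^+ 2 * n%:~R ^+ 2 * t)) - 1) * X /
       (- (4 * pi ^+ 2 * n%:~R ^+ 2))%:C.

(* The sum over all n : int is the limit of the sums over -N <= n <= N; the
   terms are bounded in modulus by 1 / (2 pi^2 n^2), so the order is immaterial.
   The limit is taken in R[i]^o, which carries the modulus topology, and the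
   result is given the type Rcomplex R, on which `|_| is the real-valued modulus. *)
Definition riemann_phi (theta : int -> R) (t : R) : Rcomplex R :=
  limn (fun N : nat =>
    \sum_(k < N.*2.+1) riemann_term theta t (k%:Z - N%:Z) : R[i]^o).

End RandomRiemann.

(* Main.v *)
(** An increment [phi x - phi y] with [|x - y| = h] is a sum of independent, uniformly rotated
    plane vectors whose squared lengths add up to at most a constant times
    [energy h = h * sqrt h].

    Upper bound.  Exponential moments make [|phi x - phi y| / h^(3/4)] exponentially
    integrable; chaining over dyadic points and Borel-Cantelli show that almost surely [phi]
    is locally Hoelder of every exponent below 3/4.

    Lower bound.  About [h^(-1/2)] of the vectors have length comparable to [h], which damps
    the characteristic function of the increment and gives
    [P (|phi x - phi y| <= 1 / Q) <= C / (Q^2 h^(3/2))].  A Borel set of dimension larger than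
    [s] contains, up to translation and scaling, a compact set [K] of positive dyadic content
    of exponent [s] (capacitability of Suslin sets), and a maximal flow in the dyadic tree
    gives discrete Frostman masses on [K].  For [gam < 4 s / 3] the expected discrete
    [gam]-energies of their images are bounded uniformly in the scale, so almost surely these
    energies are bounded along a subsequence of scales, and the mass distribution principle
    shows that [phi K] is not [gam]-null.

    Since the partial sums converge uniformly in the phases, it is enough to estimate
    probabilities for phases on a fine finite grid, where both estimates are statements
    about averages over a finite product. *)
Require Import Defs.
From HB Require Import structures.
From mathcomp Require Import all_boot all_order all_algebra.
From mathcomp Require Import complex.
From mathcomp Require Import all_classical all_reals all_analysis.
From mathcomp Require Import measurable_realfun.
From mathcomp Require Import ring lra.
From mathcomp Require Import zify.

Set Implicit Arguments.
Unset Strict Implicit.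
Unset Printing Implicit Defensive.

Import Order.TTheory GRing.Theory Num.Theory.
Import numFieldNormedType.Exports.

Local Open Scope classical_set_scope.
Local Open Scope ring_scope.

(** * Dyadic intervals and the continuity from below of dyadic content *)

Section DyadicContent.
Context {R : realType}.
Implicit Types (A : set R) (I J : nat * nat) (C D : set (nat * nat)).

(** The exponent [3/2] of [energy] comes from the two bounds [h^2] and [n^-4] for the squared length
    of the [n]-th vector: they cross at [n ~ h^(-1/2)], and both sides of the crossing contribute
    order [h^(3/2)]. An increment thus has typical size [h^(3/4)], whence the factor [4/3]. The
    obstacle is the small-ball bound at frequencies above [1/h], where vectors of length about [h]
    are too long for the quadratic estimate of the characteristic function. Vectors with [n] near
    the square root of the frequency take over, but their length contains [sin (2 pi^2 n^2 h)],
    which may vanish for individual [n]; a second-difference identity for squares shows that it is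
    not small throughout a window. Probability bounds [z] enter as [min 1 z <= z^th]. Summing over
    scales of [K] needs [th < 2 s / 3], over scales of the image [th > gam / 2]; there is room
    between them exactly when [gam < 4 s / 3]. The masses stay finite and depend on the scale, so no
    limit measure is formed, and probabilities are bounded through measurable supersets, so that
    events about [phi] need not be shown measurable. *)

Definition dyadic I : set R :=
  [set x | I.2%:R <= x * 2 ^+ I.1 < I.2.+1%:R].

Definition dyadic_sub I J :=
  (J.1 <= I.1)%N && (I.2 %/ 2 ^ (I.1 - J.1) == J.2)%N.

Lemma dyadic_coarsen n m j x : (m <= n)%N -> dyadic (n, j) x ->
  dyadic (m, (j %/ 2 ^ (n - m))%N) x.
Proof.
move=> mn; rewrite /dyadic /= => /andP[jx xj].
set p := (2 ^ (n - m))%N; have p0 : (0 < p)%N by rewrite expn_gt0.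
have e : x * 2 ^+ n = x * 2 ^+ m * p%:R.
  by rewrite /p natrX -mulrA -exprD subnKC.
have pR : 0 < p%:R :> R by rewrite ltr0n.
move: jx xj; rewrite e (divn_eq j p) => jx xj.
have jp := ltn_pmod j p0.
rewrite -(ler_pM2r pR) -[X in _ && X](ltr_pM2r pR) -!natrM.
apply/andP; split; first by apply: le_trans jx; rewrite ler_nat -divn_eq leq_trunc_div.
apply: lt_le_trans xj _; rewrite ler_nat mulSn.
by move: jp; rewrite -/p; lia.
Qed.

Lemma dyadic_inj n j k x : dyadic (n, j) x -> dyadic (n, k) x -> j = k.
Proof.
rewrite /dyadic /= => /andP[a b] /andP[c d]; apply/eqP; rewrite eqn_leq.
have := le_lt_trans a d; have := le_lt_trans c b.
by rewrite !ltr_nat !ltnS => -> ->.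
Qed.

Lemma dyadic_subP I J : dyadic_sub I J -> dyadic I `<=` dyadic J.
Proof.
case: I J => [n j] [m i] /andP[/= mn /eqP <-] x; exact: dyadic_coarsen.
Qed.

Lemma dyadic_nested I J x : dyadic I x -> dyadic J x ->
  dyadic_sub I J \/ dyadic_sub J I.
Proof.
case: I J => [n j] [m i] Ix Jx; rewrite /dyadic_sub /=.
case/orP: (leq_total m n) => mn; [left|right]; rewrite mn /=; apply/eqP.
  by apply: (dyadic_inj (dyadic_coarsen mn Ix) Jx).
by apply: (dyadic_inj (dyadic_coarsen mn Jx) Ix).
Qed.

Lemma dyadic_sub_trans : transitive dyadic_sub.
Proof.
move=> [m i] [n j] [p k] /andP[/= mn /eqP <-] /andP[/= pm /eqP <-].
rewrite /dyadic_sub /= (leq_trans pm mn) /=; apply/eqP.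
rewrite -divnMA -expnD; congr (_ %/ 2 ^ _)%N; lia.
Qed.

Lemma dyadic_floor n (x : R) : 0 <= x -> exists j, dyadic (n, j) x.
Proof.
move=> x0; exists (Num.truncn (x * 2 ^+ n)); rewrite /dyadic /=.
apply: truncn_itv; exact: mulr_ge0.
Qed.

Lemma esum_mono (T : choiceType) (A B : set T) (a : T -> \bar R) :
  A `<=` B -> (\esum_(i in A) a i <= \esum_(i in B) a i)%E.
Proof.
move=> AB; apply: ereal_sup_le => _ [F [fF FA] <-]; exists F => //.
by split => //; apply: subset_trans AB.
Qed.

Lemma esum_setU_le (T : choiceType) (A B : set T) (a : T -> \bar R) :
  (forall i, 0 <= a i)%E ->
  (\esum_(i in A `|` B) a i <= \esum_(i in A) a i + \esum_(i in B) a i)%E.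
Proof.
move=> a0; rewrite (esumID A) //; apply: leeD; apply: esum_mono; first exact: subIsetr.
by move=> x [[]].
Qed.

(** Bookkeeping for an exchange of two covers: [m <= d + b] and [a + d <= m + e] give [a <= b + e],
    so using the pieces [a] instead of [b] costs at most [e] more. The case analysis makes the terms
    finite, since [d] has to be cancelled. *)
Lemma exchange_bound (x a b c d : \bar R) (m n e e' : R) :
  (0 <= a -> 0 <= b -> 0 <= c -> 0 <= d ->
   x <= a + c -> m%:E <= d + b -> b + c <= n%:E + e'%:E ->
   a + d <= m%:E + e%:E ->
   x <= n%:E + (e + e')%:E)%E.
Proof.
case: a b c d => [a| |] [b| |] [c| |] [d| |] // _ _ _ _ h1 h2 h3 h4.
apply: le_trans h1 _; move: h2 h3 h4; rewrite -!EFinD !lee_fin; lra.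
Qed.

Variable q : R.
Hypothesis q0 : 0 < q.

(** With [q = 2^(-s)] the weight [q ^+ n] is the [s]-th power of the length of an interval of level
    [n], so [dcontent] is a net content of dimension [s], with no restriction on the lengths
    used. *)
Definition dcost C : \bar R := (\esum_(I in C) (q ^+ I.1)%:E)%E.
Definition dcover A C := A `<=` \bigcup_(I in C) dyadic I.
Definition dcontent A : \bar R := ereal_inf [set dcost C | C in dcover A].

Let wt0 I : (0 <= (q ^+ I.1)%:E)%E.
Proof. by rewrite lee_fin exprn_ge0 // ltW. Qed.

Lemma dcost_ge0 C : (0 <= dcost C)%E.
Proof. exact: esum_ge0. Qed.

Lemma dcontent_ge0 A : (0 <= dcontent A)%E.
Proof. by apply: le_ereal_inf_tmp => _ [C _ <-]; exact: dcost_ge0. Qed.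

Lemma dcontent_le_cost A C : dcover A C -> (dcontent A <= dcost C)%E.
Proof. by move=> AC; apply: ereal_inf_lbound; exists C. Qed.

Lemma le_dcontent A B : A `<=` B -> (dcontent A <= dcontent B)%E.
Proof.
move=> AB; apply: ereal_inf_le_tmp => _ [C BC <-]; exists C => //.
exact: subset_trans BC.
Qed.

Lemma dcontent_cover A (e : R) : dcontent A \is a fin_num -> 0 < e ->
  exists2 C, dcover A C & (dcost C <= dcontent A + e%:E)%E.
Proof.
move=> fA e0; have [_ [C AC <-] /ltW h] := lb_ereal_inf_adherent e0 fA.
by exists C.
Qed.

(* [dmerge D C] keeps the maximal intervals among those of [D] and [C]. *)
Definition dkeep D C := [set J | D J /\ forall I, C I -> ~~ dyadic_sub J I].
Definition dinside D C := [set I | exists2 J, dkeep D C J & dyadic_sub I J].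
Definition dmerge D C := dkeep D C `|` (C `\` dinside D C).

(** Merging only coarsens; this makes the interval around a fixed point stabilise when merges are
    iterated. *)
Lemma dmerge_up D C J : D J -> exists2 J', dmerge D C J' & dyadic_sub J J'.
Proof.
move=> DJ; have [h|] := pselect (forall I, C I -> ~~ dyadic_sub J I).
  exists J; first by left.
  by rewrite /dyadic_sub leqnn subnn expn0 divn1 /=.
move=> /existsNP[I /not_implyP[CI /negP/negPn JI]].
have [[J' DJ' IJ']|h] := pselect (dinside D C I).
  by exists J'; [left | exact: dyadic_sub_trans IJ'].
by exists I => //; right.
Qed.

Lemma dmerge_cover D C A : dcover A C -> dcover A (dmerge D C).
Proof.
move=> AC x /AC[I CI Ix].
have [[J DJ IJ]|h] := pselect (dinside D C I).
  by exists J; [left|exact: (dyadic_subP IJ)].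
by exists I => //; right.
Qed.

(** The intervals that a merge discards still cover the smaller set: a point in a kept interval of
    [D] lies in an interval of [C] inside it. Their cost is therefore at least the content of
    [A]. *)
Lemma dmerge_exchange D C A : dcover A D -> dcover A C ->
  dcover A ((D `\` dkeep D C) `|` (C `&` dinside D C)).
Proof.
move=> AD AC x Ax; have [J DJ Jx] := AD _ Ax; have [I CI Ix] := AC _ Ax.
have [JK|nJK] := pselect (dkeep D C J); last by exists J => //; left.
exists I => //; right; split => //; exists J => //.
have [//|JI] := dyadic_nested Ix Jx.
by have := JK.2 _ CI; rewrite JI.
Qed.

Lemma dmerge_cost D C A B (e e' : R) : A `<=` B ->
  dcontent A \is a fin_num -> dcontent B \is a fin_num ->
  dcover A D -> dcover B C ->
  (dcost D <= dcontent A + e%:E)%E -> (dcost C <= dcontent B + e'%:E)%E ->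
  (dcost (dmerge D C) <= dcontent B + (e + e')%:E)%E.
Proof.
move=> AB fA fB AD BC; rewrite /dcost.
rewrite (esumID (dkeep D C)) // (esumID (dinside D C) C) //.
have -> : D `&` dkeep D C = dkeep D C by apply/setIidPr => J [].
have := dcontent_le_cost (dmerge_exchange AD (subset_trans AB BC)).
have := esum_setU_le (D `\` dkeep D C) (C `&` dinside D C) wt0.
have := esum_setU_le (dkeep D C) (C `\` dinside D C) wt0.
rewrite -/(dmerge D C) -!/(dcost _) -!setDE.
move: (fA) (fB) => /fineK <- /fineK <-.
set a := dcost (dkeep _ _); set b := dcost (_ `&` dinside _ _).
set c := dcost (C `\` _); set d := dcost (D `\` _).
move=> h1 h2 h3 h4 h5.
by apply: (@exchange_bound _ a b c d _ _ _ _ _ _ _ _ h1 (le_trans h3 h2) h5 h4);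
  exact: dcost_ge0.
Qed.

(** Continuity from below, on which capacitability rests. Near-optimal covers of the [A_ n] are
    merged successively; by the exchange argument their errors merely add up. *)
Lemma dcontent_bigcup_le (A_ : nat -> set R) (c : R) :
  (forall n, A_ n `<=` A_ n.+1) -> (forall n, (dcontent (A_ n) <= c%:E)%E) ->
  (dcontent (\bigcup_n A_ n) <= c%:E)%E.
Proof.
move=> Amono Ac; apply/lee_addgt0Pr => e e0.
have fin n : dcontent (A_ n) \is a fin_num.
  by rewrite ge0_fin_numE ?dcontent_ge0 // (le_lt_trans (Ac n)) // ltry.
have en0 n : 0 < e / 2 ^+ n.+1 by rewrite divr_gt0 // exprn_gt0.
have /choice[C CP] n : exists C, dcover (A_ n) C /\
    (dcost C <= dcontent (A_ n) + (e / 2 ^+ n.+1)%:E)%E.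
  by have [C] := dcontent_cover (fin n) (en0 n); exists C.
(* The tolerances [e / 2 ^+ n.+1] accumulate to [e * (1 - (2 ^+ n.+1)^-1)] at stage [n]. *)
pose D := fix D n := if n is k.+1 then dmerge (D k) (C k.+1) else C 0%N.
have DP n : dcover (A_ n) (D n) /\
    (dcost (D n) <= dcontent (A_ n) + (e * (1 - (2 ^+ n.+1)^-1))%:E)%E.
  elim: n => [|n [IH1 IH2]].
    split; first exact: (CP 0%N).1.
    have -> : e * (1 - (2 ^+ 1)^-1) = e / 2 ^+ 1 by rewrite expr1; field.
    exact: (CP 0%N).2.
  split; first exact: dmerge_cover (CP n.+1).1.
  have -> : e * (1 - (2 ^+ n.+2)^-1) =
     e * (1 - (2 ^+ n.+1)^-1) + e / 2 ^+ n.+2.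
    by rewrite !exprS; field; rewrite expf_neq0.
  exact: (dmerge_cost (@Amono n) (fin n) (fin n.+1) IH1 (CP n.+1).1 IH2 (CP n.+1).2).
(* Intervals present from some stage on. Every finite part of [L] lies in a single [D N], so the
   cost of [L] is bounded by the costs of the [D N]. *)
pose L := [set I | exists n, forall m, (n <= m)%N -> D m I].
have Lcov : dcover (\bigcup_n A_ n) L.
  move=> x [n _ Ax].
  (* An interval of the coarsest level seen around [x] is never absorbed afterwards, as the
     absorbing interval would be coarser still. *)
  pose lev l := `[<exists m J, [/\ (n <= m)%N, D m J, dyadic J x & J.1 = l]>].
  have lev0 : exists l, lev l.
    have [J DJ Jx] := (DP n).1 _ Ax.
    by exists J.1; apply/asboolP; exists n, J.
  case: (ex_minnP lev0) => l /asboolP[m [J [nm DJ Jx Jl]]] lmin.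
  exists J => //; exists m => k; elim: k => [|k IH].
    by rewrite leqn0 => /eqP m0; rewrite m0 in DJ.
  rewrite leq_eqVlt => /predU1P[<- //|]; rewrite ltnS => mk.
  have [J' DJ' JJ'] := dmerge_up (C k.+1) (IH mk).
  suff -> : J = J' by [].
  have : lev J'.1.
    apply/asboolP; exists k.+1, J'; split => //; last exact: (dyadic_subP JJ').
    by rewrite (leq_trans nm) // (leq_trans mk).
  move=> /lmin; rewrite -Jl => JJ1; move: JJ' => /andP[JJ2 /eqP].
  have e1 : J.1 = J'.1 by apply/eqP; rewrite eqn_leq JJ1.
  rewrite e1 subnn expn0 divn1 => e2.
  by case: (J) (J') e1 e2 => [? ?] [? ?] /= -> ->.
apply: le_trans (dcontent_le_cost Lcov) _.
apply: ge_ereal_sup => _ [F [finF FL] <-].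
have [N FN] : exists N, F `<=` D N.
  have /choice[f fP] (I : nat * nat) : exists n, F I -> forall m, (n <= m)%N -> D m I.
    have [FI|nFI] := pselect (F I); last by exists 0%N.
    by have [n nP] := FL _ FI; exists n.
  have /finite_seqP[s Fs] := finF.
  exists (\max_(I <- s) f I)%N => I FI; apply: (fP _ FI).
  by apply: leq_bigmax_seq => //; move: FI; rewrite Fs.
have : (\sum_(x \in F) (q ^+ x.1)%:E <= dcost (D N))%E.
  by apply: ereal_sup_ubound; exists F.
move=> /le_trans; apply; apply: le_trans (DP N).2 _.
apply: leeD (Ac N) _; rewrite lee_fin ler_piMr ?ltW // lerBlDr lerDl.
Qed.

End DyadicContent.

(** * Sequences built one coordinate at a time *)

Section Diagonal.
Variable G : nat -> (nat -> nat) -> Prop.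
Hypothesis G_local : forall k s t, (forall i, (i < k)%N -> s i = t i) -> G k s -> G k t.

Definition fupd (s : nat -> nat) k v := fun i => if i == k then v else s i.

(** Dependent choice for conditions on initial segments. Coordinate [i] is settled at stage [i.+1]
    and never touched again, so the diagonal agrees with stage [k] below [k]. *)
Lemma stepwise_sequence s0 : G 0 s0 ->
  (forall k s, G k s -> exists v, G k.+1 (fupd s k v)) ->
  exists s, forall k, G k s.
Proof.
move=> G0 GS.
have /choice[V VP] (ks : nat * (nat -> nat)) :
    exists v, G ks.1 ks.2 -> G ks.1.+1 (fupd ks.2 ks.1 v).
  have [g|ng] := pselect (G ks.1 ks.2); last by exists 0%N.
  by have [v] := GS _ _ g; exists v.
pose t := fix t k := if k is k'.+1 then fupd (t k') k' (V (k', t k')) else s0.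
have Gt k : G k (t k).
  by elim: k => // k IH; exact: (VP (k, t k)).
have tS k i : (i < k)%N -> t k i = t i.+1 i.
  elim: k => // k IH; rewrite ltnS leq_eqVlt => /predU1P[-> //|ik].
  by rewrite /= {1}/fupd (ltn_eqF ik) IH.
exists (fun i => t i.+1 i) => k; apply: G_local (Gt k); exact: tS.
Qed.

End Diagonal.

(** * Suslin sets and their capacitability *)

Section Suslin.
Context {R : realType}.
Implicit Types A : set R.

(** [F n s] may depend on any finite number [N] of coordinates rather than on the first [n], which
    leaves room for coding several sequences into one. *)
Definition closed_scheme (F : nat -> (nat -> nat) -> set R) :=
  (forall n s, closed (F n s)) /\
  forall n, exists N, forall s t, (forall i, (i < N)%N -> s i = t i) -> F n s = F n t.

Definition scheme_set (F : nat -> (nat -> nat) -> set R) :=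
  [set x | exists s, forall n, F n s x].

Definition suslin A := exists2 F, closed_scheme F & A = scheme_set F.

Lemma suslin_closed A : closed A -> suslin A.
Proof.
move=> cA; exists (fun _ _ => A); first by split => // n; exists 0%N.
by apply/seteqP; split => [x Ax|x [s /(_ 0%N)]//]; exists (fun=> 0%N).
Qed.

Lemma suslin_bigcup (A_ : nat -> set R) :
  (forall i, suslin (A_ i)) -> suslin (\bigcup_i A_ i).
Proof.
move=> sA; have /choice[F FP] i : exists F, closed_scheme F /\ A_ i = scheme_set F.
  by have [F] := sA i; exists F.
(* The first coordinate of [s] names the index of the set. Constraints that code another index are
   void; numbers that code no pair repeat the constraint of [(0, 0)]. *)
pose G m s := let p := odflt (0, 0)%N (unpickle m) in
  if p.1 == s 0%N then F p.1 p.2 (fun i => s i.+1) else setT.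
exists G.
  split=> [n s|n]; rewrite /G; case: (odflt _ _) => i k /=.
    by case: ifP => _; [exact: (FP _).1.1|exact: closedT].
  have [N NP] := (FP i).1.2 k; exists N.+1 => s t st; rewrite st //.
  by case: ifP => // _; apply: NP => j jN; apply: st.
apply/seteqP; split => x.
  move=> [i _]; rewrite (FP i).2 => -[s sP].
  exists (fun k => if k is k'.+1 then s k' else i) => n.
  by rewrite /G; case: (odflt _ _) => i' k /=; case: eqP => // ->; apply: sP.
move=> [s sP]; exists (s 0%N) => //; rewrite (FP _).2; exists (fun i => s i.+1) => k.
by have := sP (pickle (s 0, k)%N); rewrite /G pickleK /= eqxx.
Qed.

Lemma suslin_bigcap (A_ : nat -> set R) :
  (forall i, suslin (A_ i)) -> suslin (\bigcap_i A_ i).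
Proof.
move=> sA; have /choice[F FP] i : exists F, closed_scheme F /\ A_ i = scheme_set F.
  by have [F] := sA i; exists F.
(* One sequence carries countably many: the [i]-th is read off at the codes of the pairs
   [(i, k)]. *)
pose G m s := let p := odflt (0, 0)%N (unpickle m) in
  F p.1 p.2 (fun k => s (pickle (p.1, k))).
exists G.
  split=> [n s|n]; rewrite /G; case: (odflt _ _) => i k /=; first exact: (FP _).1.1.
  have [N NP] := (FP i).1.2 k.
  exists (\max_(j < N) (pickle (i, val j)).+1)%N => s t st; apply: NP => j jN.
  by apply: st; apply: (@leq_bigmax_cond _ _ _ (Ordinal jN)).
apply/seteqP; split => x.
  move=> Ax; have /choice[s sP] i : exists s, forall n, F i n s x.
    by have := Ax i I; rewrite (FP i).2.
  exists (fun m => let p := odflt (0, 0)%N (unpickle m) in s p.1 p.2) => n.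
  rewrite /G; case: (odflt _ _) => i k /=.
  by under eq_fun do rewrite pickleK /=; exact: sP.
move=> [s sP] i _; rewrite (FP i).2; exists (fun k => s (pickle (i, k))) => n.
by have := sP (pickle (i, n)); rewrite /G pickleK.
Qed.

(** Complements of Suslin sets may fail to be Suslin, so the induction runs over sets that are
    Suslin together with their complement; these form a sigma-algebra containing the open rays. *)
Lemma measurable_suslin A : measurable A -> suslin A.
Proof.
move=> mA.
have {}mA : (measurable_realfun.RGenOInfty.G (R:=R)).-sigma.-measurable A.
  by rewrite -measurable_realfun.RGenOInfty.measurableE.
suff [] : [set A | suslin A /\ suslin (~` A)] A by [].
apply: mA; split.
  split => /=.
  - by split; [|rewrite setC0]; apply: suslin_closed; [exact: closed0|exact: closedT].
  - by move=> B [s1 s2]; rewrite setTD setCK.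
  - move=> B BP; split; first by apply: suslin_bigcup => i; exact: (BP i).1.
    by rewrite setC_bigcup; apply: suslin_bigcap => i; exact: (BP i).2.
move=> _ [x ->]; split; last first.
  by rewrite setCitvr; apply: suslin_closed; exact: interval_closed.
rewrite itvoyEbigcup; apply: suslin_bigcup => i; apply: suslin_closed.
exact: interval_closed.
Qed.


Variable q : R.
Hypothesis q0 : 0 < q.
Local Notation dcontent := (dcontent q).

(** An open enlargement by one neighbour on each side, so that compactness applies; it costs the
    factor 3 in [dcontent_bigcap]. *)
Let triple (I : nat * nat) : set R :=
  [set x | I.2%:R - 1 < x * 2 ^+ I.1 < I.2.+2%:R].

Let triple_open I : open (triple I).
Proof.
have -> : triple I = (fun x : R => x * 2 ^+ I.1) @^-1` `]I.2%:R - 1, I.2.+2%:R[%classic.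
  by apply/seteqP; split => x /=; rewrite in_itv.
apply: open_comp; last exact: interval_open.
by move=> x _; apply: cvgM; [exact: cvg_id|exact: cvg_cst].
Qed.

(** The truncated predecessor of 0 is harmless, as only points [0 <= x] are to be covered. *)
Let neighbours (C : set (nat * nat)) : set (nat * nat) :=
  (fun I => (I.1, I.2.+1)) @` C `|` (C `|` (fun I => (I.1, I.2.-1)) @` C).

Let triple_cover C x : 0 <= x -> (exists2 I, C I & triple I x) ->
  exists2 I, neighbours C I & dyadic I x.
Proof.
move=> x0 [[n j] Cj /= /andP[jx xj]]; have [k kx] := dyadic_floor n x0.
exists (n, k) => //; move: kx => /andP[/= kx xk].
have := lt_trans jx xk; have := le_lt_trans kx xj.
rewrite ltrBlDr natr1 !ltr_nat => k1 k2.
rewrite /= in k1 k2.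
have [kj|[kj|kj]] : k = j.+1 \/ k = j \/ j = k.+1 by lia.
- by left; exists (n, j); rewrite ?kj.
- by right; left; rewrite kj.
- by right; right; exists (n, j); rewrite //= kj.
Qed.

Let neighbours_cost C : (dcost q (neighbours C) <= 3%:E * dcost q C)%E.
Proof.
have w0 (I : nat * nat) : (0 <= (q ^+ I.1)%:E)%E.
  by rewrite lee_fin exprn_ge0 // ltW.
have img (g : nat * nat -> nat * nat) D : (forall I, (g I).1 = I.1) ->
    D `<=` g @` C -> (dcost q D <= dcost q C)%E.
  move=> g1 DC; apply: (le_trans (esum_mono _ DC)).
  apply: ge_ereal_sup => _ [A [finA AC] <-].
  have /choice[h hP] (I : nat * nat) : exists J, A I -> C J /\ g J = I.
    have [/AC[J CJ JI]|?] := pselect (A I); last by exists I.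
    by exists J.
  apply: ereal_sup_ubound => /=; exists (h @` A).
    by split; [exact: finite_image|move=> _ [I AI <-]; exact: (hP _ AI).1].
  rewrite fsbig_image //; last first.
    by move=> I J /set_mem AI /set_mem AJ hIJ; rewrite -(hP _ AI).2 hIJ (hP _ AJ).2.
  by apply: eq_fsbigr => I /set_mem AI; rewrite -{2}(hP _ AI).2 g1.
have C0 := dcost_ge0 q0 C.
apply: (@le_trans _ _ (dcost q C + (dcost q C + dcost q C))%E); last first.
  case: (dcost q C) C0 => [r _| |] //; last by rewrite gt0_muley.
  by rewrite -!EFinD -EFinM lee_fin; lra.
apply: le_trans (esum_setU_le _ _ w0) _; apply: leeD; first exact: (img (fun I => (I.1, I.2.+1))).
apply: le_trans (esum_setU_le _ _ w0) _; apply: leeD => //.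
exact: (img (fun I => (I.1, I.2.-1))).
Qed.

(** A cover of the intersection, enlarged to open intervals, covers [[0, 1/2]] together with the
    complements of the [K m]. A finite subcover uses complements up to some [M] only, so the
    enlarged intervals already cover [K M]. *)
Lemma dcontent_bigcap (K : nat -> set R) (c : R) :
  (forall m, K m.+1 `<=` K m) -> (forall m, closed (K m)) ->
  K 0%N `<=` `[0, 2^-1]%classic -> (forall m, (c%:E <= dcontent (K m))%E) ->
  (c%:E <= 3%:E * dcontent (\bigcap_m K m))%E.
Proof.
move=> Kdec Kcl K01 cK.
have Kmono m n : (m <= n)%N -> K n `<=` K m.
  elim: n => [|n IH]; first by rewrite leqn0 => /eqP->.
  by rewrite leq_eqVlt => /predU1P[-> //|/IH h] x /Kdec /h.
suff h C : dcover (\bigcap_m K m) C -> (c%:E <= 3%:E * dcost q C)%E.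
  rewrite -lee_pdivrMl //; apply: le_ereal_inf_tmp => _ [C /h hC <-].
  by rewrite lee_pdivrMl.
move=> KC.
have := @segment_compact R 0 2^-1; rewrite compact_cover => cpt.
pose f (i : (nat * nat) + nat) := match i with inl J => triple J | inr m => ~` K m end.
have [||D DS Dcov] := cpt _ [set i | if i is inl J then C J else True] f.
- by case=> [I|m] _; [exact: triple_open|exact: closed_openC].
- move=> x _; have [h|/existsNP[m nKm]] := pselect (forall m, K m x); last by exists (inr m).
  have [I CI /andP[Ix xI]] := KC x (fun m _ => h m).
  exists (inl I) => //=; rewrite /triple /=; apply/andP; split.
    by rewrite ltrBlDr (le_lt_trans Ix) // ltrDl.
  by rewrite (lt_trans xI) // ltr_nat.
pose M := (\max_(i <- finmap.enum_fset D) if i is inr m then m else 0)%N.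
apply: le_trans (cK M) _; apply: le_trans (neighbours_cost C).
apply: dcontent_le_cost => // x KMx.
have x01 := K01 _ (Kmono 0%N _ (leq0n _) _ KMx).
apply: triple_cover; first by move: x01 => /=; rewrite in_itv /= => /andP[].
have [[I|m] Di /= fi] := Dcov _ x01.
  by exists I => //; have := DS _ Di; rewrite inE.
exfalso; apply: fi; apply: Kmono KMx.
by apply: (@leq_bigmax_seq _ _ xpredT (fun i : nat * nat + nat => if i is inr m then m else 0%N) (inr m)).
Qed.

(** Choquet's argument: bounds [b] on the coordinates are chosen one at a time, continuity from
    below keeping the content above [c]. The sequences bounded by [b] form a finitely branching
    tree, which yields closed sets decreasing into [E]. *)
Lemma suslin_capacitable (E : set R) (c : R) : suslin E ->
  E `<=` `[0, 2^-1]%classic -> (c%:E < dcontent E)%E ->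
  exists K : set R, [/\ closed K, K `<=` E & (c%:E <= 3%:E * dcontent K)%E].
Proof.
move=> [F0 [F0cl F0loc] EF0] E01 cE.
pose F n s := F0 n s `&` `[0, 2^-1]%classic.
have Fcl n s : closed (F n s).
  by apply: closedI => //; exact: interval_closed.
have Floc n : exists N, forall s t, (forall i, (i < N)%N -> s i = t i) -> F n s = F n t.
  by have [N NP] := F0loc n; exists N => s t st; rewrite /F (NP s t).
have EF : E = scheme_set F.
  apply/seteqP; split => x.
    by move=> Ex; have := Ex; rewrite {1}EF0 => -[s sP]; exists s => n; split; [exact: sP|exact: E01].
  by move=> [s sP]; rewrite EF0; exists s => n; exact: (sP n).1.
pose P m b := [set x | exists s, (forall i, (i < m)%N -> (s i <= b i)%N) /\ forall n, F n s x].
have [b bP] : exists b, forall m, (c%:E < dcontent (P m b))%E.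
  apply: (@stepwise_sequence _ _ (fun=> 0%N)).
  - move=> k s t st; suff -> : P k s = P k t by [].
    apply/seteqP; split => x [u [us uF]]; exists u; split => // i ik.
      by rewrite -st // us.
    by rewrite st // us.
  - by apply: lt_le_trans cE _; apply: le_dcontent; rewrite EF => x [s sP]; exists s.
  - move=> k b cP; apply: contrapT => /forallNP h.
    have : (dcontent (\bigcup_v P k.+1 (fupd b k v)) <= c%:E)%E.
      apply: dcontent_bigcup_le => // v; last first.
        by rewrite leNgt; apply/negP; exact: h.
      move=> x [s [sb sF]]; exists s; split => // i /sb; rewrite /fupd.
      by case: eqP => // _ /leqW.
    apply/negP; rewrite -ltNge; apply: lt_le_trans cP _; apply: le_dcontent.
    move=> x [s [sb sF]]; exists (s k) => //; exists s; split => // i.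
    by rewrite ltnS /fupd leq_eqVlt; case: eqP => [-> //|_ /= /sb].
(* Only [m] constraints are imposed, but on sequences bounded everywhere; padding with zeros shows
   that [K m] contains [P (NN m) b]. *)
pose K m := [set x | exists s, (forall i, (s i <= b i)%N) /\ forall n, (n < m)%N -> F n s x].
have /choice[N NP] := Floc.
pose NN m := (\max_(n < m) N n)%N.
have NNP m n s t : (n < m)%N -> (forall i, (i < NN m)%N -> s i = t i) -> F n s = F n t.
  move=> nm st; apply: NP => i iN; apply: st; apply: leq_trans iN _.
  exact: (@leq_bigmax_cond _ xpredT (fun n : 'I_m => N n) (Ordinal nm)).
have KE : \bigcap_m K m `<=` E.
  move=> x Kx.
  (* Koenig's lemma: every initial segment of [t] extends, for each [m], to a bounded sequence
     meeting the first [m] constraints. If every next value failed at some [M v], the maximum of [M]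
     over the finitely many [v <= b k] would contradict this. *)
  have [t tP] : exists t, forall k m, exists s, [/\ forall i, (i < k)%N -> s i = t i,
      forall i, (s i <= b i)%N & forall n, (n < m)%N -> F n s x].
    apply: (@stepwise_sequence _ _ (fun=> 0%N)).
    - move=> k s t st h m; have [u [u1 u2 u3]] := h m; exists u; split => // i ik.
      by rewrite u1 // st.
    - by move=> m; have [s [s1 s2]] := Kx m I; exists s.
    - move=> k t h; apply: contrapT => /forallNP h'.
      have /choice[M MP] v : exists m, ~ exists s, [/\ forall i, (i < k.+1)%N -> s i = fupd t k v i,
          forall i, (s i <= b i)%N & forall n, (n < m)%N -> F n s x].
        exact/existsNP/h'.
      have [s [s1 s2 s3]] := h (\max_(v < (b k).+1) M v)%N.
      apply: (MP (s k)); exists s; split => //.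
        by move=> i; rewrite ltnS /fupd leq_eqVlt; case: eqP => [-> //|_ /= /s1].
      move=> n nM; apply: s3; apply: leq_trans nM _.
      have sk : (s k < (b k).+1)%N by rewrite ltnS.
      exact: (@leq_bigmax_cond _ xpredT (fun v : 'I_(b k).+1 => M v) (Ordinal sk)).
  rewrite EF; exists t => n.
  have [s [s1 _ s3]] := tP (N n) n.+1.
  by rewrite -(NP n s t) //; exact: s3.
have mK m : (c%:E <= dcontent (K m))%E.
  apply: ltW; apply: lt_le_trans (bP (NN m)) _; apply: le_dcontent.
  move=> x [s [sb sF]]; exists (fun i => if (i < NN m)%N then s i else 0%N).
  split; first by move=> i; case: ifP => // /sb.
  by move=> n nm; rewrite (NNP m n _ s) // => i ->.
have Kcl m : closed (K m).
  pose T := {ffun 'I_(NN m) -> 'I_(\max_(i < NN m) b i).+1}.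
  (* Cutting off at [b i] turns each of the finitely many tables [f] into a bounded sequence, so
     [K m] is a finite union of closed sets. *)
  pose sf (f : T) i := minn (b i) (if insub i is Some j then f j else 0%N).
  have -> : K m = \bigcup_(f in [set: T]) \bigcap_(n in [set n | (n < m)%N]) F n (sf f).
    apply/seteqP; split => x.
      move=> [s [sb sF]]; exists [ffun j => inord (s (val j))] => // n nm.
      rewrite /= (NNP m n _ s) //; first exact: sF.
      move=> i iN; rewrite /sf insubT /= ffunE /= inordK.
        by apply/minn_idPr; exact: sb.
      rewrite ltnS; apply: leq_trans (sb i) _.
      exact: (@leq_bigmax_cond _ xpredT (fun i : 'I_(NN m) => b i) (Ordinal iN)).
    move=> [f _ fP]; exists (sf f); split; first by move=> i; exact: geq_minl.
    by move=> n nm; exact: fP.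
  apply: closed_bigcup; first exact: finite_finset.
  by move=> f _; apply: closed_bigI => n _.
(* [K 0] imposes no constraint and is the whole line; the shift makes the sequence start inside
   [[0, 1/2]]. *)
have capS : \bigcap_m K m = \bigcap_m K m.+1.
  apply/seteqP; split => x Kx m _; first exact: Kx.
  have [s [s1 s2]] := Kx m I; exists s; split => // n nm.
  by apply: s2; exact: ltnW.
exists (\bigcap_m K m); split => //; first exact: closed_bigI.
rewrite capS; apply: dcontent_bigcap => //.
- move=> m x [s [s1 s2]]; exists s; split => // n nm.
  by apply: s2; exact: ltnW.
- by move=> x [s [_ /(_ 0%N isT)[]]].
Qed.

End Suslin.

(** * Discrete Frostman masses from a maximal flow in the dyadic tree *)

Section Frostman.
Context {R : realType}.
Implicit Types (A B K : set R) (w : nat -> R).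

Lemma ler_sum_predU (I : Type) (r : seq I) (P P1 P2 : pred I) (F : I -> R) :
  (forall i, 0 <= F i) -> (forall i, P i -> P1 i || P2 i) ->
  \sum_(i <- r | P i) F i <= \sum_(i <- r | P1 i) F i + \sum_(i <- r | P2 i) F i.
Proof.
move=> F0 PP; rewrite 3!(big_mkcond _ F) -big_split /=; apply: ler_sum => i _.
have := F0 i; have := PP i.
by case: (P i) (P1 i) (P2 i) => [] [] [] // h ?; rewrite ?addr0 ?add0r ?lerDl ?addr_ge0 //; have := h isT.
Qed.

Fixpoint node_mass w e m : R :=
  if e is e'.+1 then node_mass w e' m.*2 + node_mass w e' m.*2.+1 else w m.

Lemma node_massD w w' e m :
  node_mass (fun i => w i + w' i) e m = node_mass w e m + node_mass w' e m.
Proof. by elim: e m => //= e IH m; rewrite !IH addrACA. Qed.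

Lemma node_mass_eq0 w d e j m : (forall i, w i != 0 -> (i %/ 2 ^ d)%N = j) ->
  (e <= d)%N -> (m %/ 2 ^ (d - e))%N != j -> node_mass w e m = 0.
Proof.
move=> wj; elim: e m => [|e IH] m ed mj /=.
  by apply: contra_neqP mj => ?; rewrite subn0 wj //; apply/eqP.
rewrite !IH ?addr0 //; try exact: ltnW.
- have -> : (d - e = (d - e.+1).+1)%N by lia.
  by rewrite expnS divnMA divn2 /= uphalf_double.
- have -> : (d - e = (d - e.+1).+1)%N by lia.
  by rewrite expnS divnMA divn2 doubleK.
Qed.

Lemma sum_children (F : nat -> R) e m N :
  \sum_(i < N | (i %/ 2 ^ e.+1)%N == m) F i =
  \sum_(i < N | (i %/ 2 ^ e)%N == m.*2) F i +
  \sum_(i < N | (i %/ 2 ^ e)%N == m.*2.+1) F i.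
Proof.
rewrite big_mkcond [X in _ = X + _]big_mkcond [X in _ = _ + X]big_mkcond /=.
rewrite -big_split /=; apply: eq_bigr => i _.
rewrite expnSr divnMA divn2; set y := (i %/ 2 ^ e)%N.
have := odd_double_half y; case: (odd y) => /= [yE|yE].
  have -> : (y == m.*2.+1) = (y./2 == m) by apply/eqP/eqP; lia.
  have -> : (y == m.*2) = false by apply/eqP; lia.
  by rewrite add0r.
have -> : (y == m.*2) = (y./2 == m) by apply/eqP/eqP; lia.
have -> : (y == m.*2.+1) = false by apply/eqP; lia.
by rewrite addr0.
Qed.

Lemma sum_le_node_mass w e m N : (forall i, 0 <= w i) ->
  \sum_(i < N | (i %/ 2 ^ e)%N == m) w i <= node_mass w e m.
Proof.
move=> w0; elim: e m => [|e IH] m /=; last by rewrite sum_children lerD.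
under eq_bigl do rewrite expn0 divn1.
case: (ltnP m N) => mN; first by rewrite (big_pred1 (Ordinal mN)).
by rewrite big_pred0 // => i; apply: contraTF mN => /eqP <-; rewrite -ltnNge.
Qed.

Lemma node_mass_sum w e m N : (m.+1 * 2 ^ e <= N)%N ->
  node_mass w e m = \sum_(i < N | (i %/ 2 ^ e)%N == m) w i.
Proof.
elim: e m => [|e IH] m /= mN.
  under eq_bigl do rewrite expn0 divn1.
  rewrite expn0 muln1 in mN.
  by rewrite (big_pred1 (Ordinal mN)).
rewrite sum_children !IH //; apply: leq_trans mN; rewrite expnS.
- by rewrite mulnA leq_mul2r; apply/orP; right; lia.
- by rewrite mulnA leq_mul2r; apply/orP; right; lia.
Qed.

Variables (q : R) (q0 : 0 < q).

Lemma dcontentU A B : (dcontent q (A `|` B) <= dcontent q A + dcontent q B)%E.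
Proof.
have [fA|] := boolP (dcontent q A \is a fin_num); last first.
  rewrite ge0_fin_numE ?dcontent_ge0 // -leNgt leye_eq => /eqP ->.
  by rewrite addye ?leey // gt_eqF // (lt_le_trans _ (dcontent_ge0 q0 B)) // ltNy0.
have [fB|] := boolP (dcontent q B \is a fin_num); last first.
  rewrite ge0_fin_numE ?dcontent_ge0 // -leNgt leye_eq => /eqP ->.
  by rewrite addey ?leey // gt_eqF // (lt_le_trans _ (dcontent_ge0 q0 A)) // ltNy0.
apply/lee_addgt0Pr => e e0; have e2 : 0 < e / 2 by rewrite divr_gt0.
have [C AC hC] := dcontent_cover fA e2; have [D BD hD] := dcontent_cover fB e2.
have : dcover (A `|` B) (C `|` D).
  by move=> x [/AC|/BD] [I CI Ix]; exists I => //; [left|right].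
move=> /(dcontent_le_cost q) /le_trans; apply.
apply: le_trans (esum_setU_le _ _ _) _.
  by move=> I; rewrite lee_fin exprn_ge0 // ltW.
apply: le_trans (leeD hC hD) _.
by rewrite [e in leRHS](splitr e) EFinD addeACA.
Qed.

Lemma dyadic_split n j (x : R) : dyadic (n, j) x ->
  dyadic (n.+1, j.*2) x \/ dyadic (n.+1, j.*2.+1) x.
Proof.
rewrite /dyadic /= => /andP[jx xj]; rewrite exprSr mulrA.
have [h|h] := ltP (x * 2 ^+ n * 2) (j.*2.+1)%:R; [left|right]; rewrite ?andbT /=.
  by rewrite -muln2 natrM ler_pM2r.
by rewrite -doubleS -muln2 natrM ltr_pM2r.
Qed.

Variable K : set R.

Fixpoint mincut d n j : R :=
  if d is d'.+1 then
    Num.min (q ^+ n) (mincut d' n.+1 j.*2 + mincut d' n.+1 j.*2.+1)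
  else if `[< K `&` dyadic (n, j) !=set0 >] then q ^+ n else 0.

Lemma mincut_ge0 d n j : 0 <= mincut d n j.
Proof.
elim: d n j => [|d IH] n j /=.
  by case: ifP => // _; rewrite exprn_ge0 // ltW.
by rewrite le_min addr_ge0 // exprn_ge0 // ltW.
Qed.

(** A cut of the tree is a dyadic cover of this part of [K], so its cost cannot be below the
    content. *)
Lemma dcontent_le_mincut d n j :
  (dcontent q (K `&` dyadic (n, j)) <= (mincut d n j)%:E)%E.
Proof.
have one m i : (dcontent q (K `&` dyadic (m, i)) <= (q ^+ m)%:E)%E.
  have : dcover (K `&` dyadic (m, i)) [set (m, i)] by move=> x [_ ?]; exists (m, i).
  move=> /(dcontent_le_cost q) /le_trans; apply.
  by rewrite /dcost esum_set1 // lee_fin exprn_ge0 // ltW.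
elim: d n j => [|d IH] n j /=.
  case: asboolP => [_|/set0P/negP/negPn/eqP ->]; first exact: one.
  have : @dcover R set0 set0 by [].
  by move=> /(dcontent_le_cost q) /le_trans; apply; rewrite /dcost esum_set0.
rewrite /Num.min; case: ifP => _; first exact: one.
apply: le_trans (leeD (IH n.+1 j.*2) (IH n.+1 j.*2.+1)).
apply: le_trans (dcontentU _ _); apply: le_dcontent.
by move=> x [Kx /dyadic_split[]]; [left|right].
Qed.

(** Max-flow min-cut on a tree, greedily: the left child receives [Num.min t a] and the right one
    the rest, which is at most [b] because [t] is below the cut. The last clause says that all
    capacities are respected. *)
Lemma tree_flow d n j t : 0 <= t <= mincut d n j -> exists w,
  [/\ forall i, 0 <= w i,
      forall i, w i != 0 -> (i %/ 2 ^ d)%N = j /\ K `&` dyadic (n + d, i)%N !=set0,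
      node_mass w d j = t &
      forall k m, (k <= d)%N -> node_mass w (d - k) m <= q ^+ (n + k)].
Proof.
elim: d n j t => [|d IH] n j t /= /andP[t0].
  case: asboolP => Kn tq.
    exists (fun i => if i == j then t else 0); split => //.
    - by move=> i; case: ifP.
    - by move=> i; rewrite expn0 divn1 addn0; case: (i =P j) => [-> //|_]; rewrite eqxx.
    - by rewrite eqxx.
    - move=> k m; rewrite leqn0 => /eqP ->; rewrite addn0 /=.
      by case: ifP => // _; rewrite exprn_ge0 // ltW.
  have {t0 tq}-> : t = 0 by apply/eqP; rewrite eq_le tq t0.
  exists (fun=> 0); split => // [i|k m]; first by rewrite eqxx.
  by rewrite leqn0 => /eqP -> /=; rewrite exprn_ge0 // ltW.
rewrite le_min => /andP[tq tm].
set a := mincut d n.+1 j.*2 in tm; set b := mincut d n.+1 j.*2.+1 in tm.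
have ta : 0 <= Num.min t a <= a.
  by rewrite ge_min lexx orbT le_min t0 mincut_ge0.
have tb : 0 <= t - Num.min t a <= b.
  rewrite subr_ge0 ge_min lexx /= lerBlDr /Num.min; case: ifP => // _; last by rewrite addrC.
  by rewrite lerDr mincut_ge0.
have [w1 [w1p w1s w1t w1q]] := IH _ _ _ ta.
have [w2 [w2p w2s w2t w2q]] := IH _ _ _ tb.
exists (fun i => w1 i + w2 i).
have w1z e m : (e <= d)%N -> (m %/ 2 ^ (d - e))%N != j.*2 -> node_mass w1 e m = 0.
  by apply: node_mass_eq0 => i /w1s[].
have w2z e m : (e <= d)%N -> (m %/ 2 ^ (d - e))%N != j.*2.+1 -> node_mass w2 e m = 0.
  by apply: node_mass_eq0 => i /w2s[].
have tot : node_mass (fun i => w1 i + w2 i) d j.*2 +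
    node_mass (fun i => w1 i + w2 i) d j.*2.+1 = t.
  rewrite !node_massD w1t w2t (w1z d j.*2.+1) // ?(w2z d j.*2) // ?subnn ?expn0 ?divn1.
  - by rewrite addr0 add0r addrC subrK.
  - by rewrite neq_ltn ltnSn.
  - by rewrite neq_ltn ltnSn orbT.
split.
- by move=> i; rewrite addr_ge0.
- move=> i; have [->|/w1s[e1 e2] _] := eqVneq (w1 i) 0; last first.
    rewrite expnSr divnMA e1 divn2 doubleK; split => //.
    by move: e2; rewrite addSnnS.
  rewrite add0r => /w2s[e1 e2]; rewrite expnSr divnMA e1 divn2 /= uphalf_double; split => //.
  by move: e2; rewrite addSnnS.
- exact: tot.
- move=> [|k] m kd.
    rewrite subn0 addn0 /=; have [->|mj] := eqVneq m j; first by rewrite tot.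
    rewrite !node_massD !w1z ?w2z ?addr0 ?exprn_ge0 ?ltW // subnn expn0 divn1.
    - by apply: contra mj => /eqP ?; apply/eqP; lia.
    - by apply: contra mj => /eqP ?; apply/eqP; lia.
    - by apply: contra mj => /eqP ?; apply/eqP; lia.
    - by apply: contra mj => /eqP ?; apply/eqP; lia.
  rewrite subSS addnS -addSn node_massD.
  have kd' : (k <= d)%N by [].
  have [mj|mj] := eqVneq (m %/ 2 ^ (d - (d - k)))%N j.*2.
    rewrite (w2z _ _ (leq_subr _ _)) ?addr0; first exact: w1q.
    by rewrite mj neq_ltn ltnSn.
  by rewrite (w1z _ _ (leq_subr _ _)) // add0r; exact: w2q.
Qed.

Lemma discrete_frostman (c : R) n : 0 <= c -> K `<=` [set x | 0 <= x < 1] ->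
  (c%:E <= dcontent q K)%E ->
  exists (w : 'I_(2 ^ n) -> R) (x : 'I_(2 ^ n) -> R),
  [/\ forall i, 0 <= w i,
      forall i, 0 <= x i <= 1 /\ (w i != 0 -> K (x i)),
      \sum_i w i = c &
      forall k i, (k <= n)%N ->
        \sum_(i' | `|x i - x i'| * 2 ^+ k <= 1) w i' <= 3 * q ^+ k].
Proof.
move=> c0 K01 cK.
have cm : 0 <= c <= mincut n 0 0.
  rewrite c0 -lee_fin; apply: le_trans cK _; apply: le_trans (dcontent_le_mincut n 0 0).
  apply: le_dcontent => x Kx; split => //; rewrite /dyadic /= expr0 mulr1; exact: K01.
have [w [w0 ws wt wq]] := tree_flow cm.
(* A leaf carrying mass meets [K]; elsewhere the left endpoint merely keeps [x i] in the unit
   interval. *)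
have /choice[x xP] (i : 'I_(2 ^ n)) : exists x, dyadic (n, val i) x /\ (w i != 0 -> K x).
  have [_|/ws] := eqVneq (w i) 0.
    exists (i%:R / 2 ^+ n); split => //.
    by rewrite /dyadic /= divfK ?expf_neq0 // lexx ltr_nat leqnn.
  by rewrite add0n => -[_ [x [Kx dx]]]; exists x.
have x01 i : 0 <= x i <= 1.
  have [/andP[/= h1 h2] _] := xP i.
  have p0 : 0 < 2 ^+ n :> R by rewrite exprn_gt0.
  rewrite -(pmulr_lge0 _ p0) (le_trans _ h1) ?ler0n //=.
  rewrite -(ler_pM2r p0) mul1r (le_trans (ltW h2)) //.
  by rewrite -natrX ler_nat.
exists (fun i => w i), x; split => //.
- by move=> i; split => //; exact: (xP i).2.
- rewrite -wt (@node_mass_sum _ n 0 (2 ^ n)%N) ?mul1n //.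
  by apply: eq_bigl => i; rewrite divn_small // ltn_ord.
- move=> k i kn.
  pose p := (i %/ 2 ^ (n - k))%N.
  (* Within distance [2^(-k)] there are only the interval of level [k] around [x i] and its two
     neighbours: the origin of the factor 3. *)
  have near i' : `|x i - x i'| * 2 ^+ k <= 1 ->
     ((i' %/ 2 ^ (n - k))%N == p) || (((i' %/ 2 ^ (n - k))%N == p.-1) || ((i' %/ 2 ^ (n - k))%N == p.+1)).
    move=> h.
    have /andP[/= a1 a2] := dyadic_coarsen kn (xP i).1.
    have /andP[/= b1 b2] := dyadic_coarsen kn (xP i').1.
    rewrite -/p in a1 a2; set p' := (i' %/ _)%N in b1 b2 *.
    have pk : 0 < 2 ^+ k :> R by rewrite exprn_gt0.
    move: h; rewrite -[X in _ * X](gtr0_norm pk) -normrM mulrBl ler_norml => /andP[h1 h2].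
    have : p'%:R < p.+2%:R :> R.
      by move: a2; rewrite -[p.+2%:R]natr1; lra.
    have : p%:R < p'.+2%:R :> R.
      by move: b2; rewrite -[p'.+2%:R]natr1; lra.
    rewrite !ltr_nat => l1 l2.
    have [?|[?|?]] : p' = p \/ p' = p.-1 \/ p' = p.+1.
      by move: l1 l2; clear; move: p p' => a b; lia.
    + by apply/orP; left; apply/eqP.
    + by apply/orP; right; apply/orP; left; apply/eqP.
    + by apply/orP; right; apply/orP; right; apply/eqP.
  apply: le_trans (ler_sum_predU _ _ near) _; first by move=> ?; exact: w0.
  have S m : \sum_(i' < 2 ^ n | (i' %/ 2 ^ (n - k))%N == m) w i' <= q ^+ k.
    by apply: le_trans (sum_le_node_mass _ _ _ w0) _; exact: wq.
  apply: (@le_trans _ _ (q ^+ k + (q ^+ k + q ^+ k))); last by lra.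
  apply: lerD; first exact: S.
  apply: le_trans (ler_sum_predU _ _ (fun i h => h)) _; first by move=> ?; exact: w0.
  by apply: lerD; exact: S.
Qed.

End Frostman.

(** * Elementary bounds for sine, cosine and the exponential *)

Section Trig.
Context {R : realType}.
Implicit Types x y u v : R.

Lemma ler_norm_sin x : `|sin x| <= `|x|.
Proof.
wlog x0 : x / 0 <= x.
  by move=> h; case/orP: (le_total 0 x) => [/h //|]; rewrite -oppr_ge0 => /h; rewrite sinN !normrN.
have cs : {within `[0, x], continuous (@sin R)}.
  by apply: continuous_subspaceT => z; exact: continuous_sin.
have [c _] := @MVT_segment R sin cos 0 x x0 (fun z _ => is_derive_sin z) cs.
rewrite sin0 !subr0 => ->; rewrite normrM ler_piMl //; exact: cos_max.
Qed.

Lemma cos_half_angle x : cos x = 1 - 2 * sin (x / 2) ^+ 2.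
Proof.
rewrite {1}(_ : x = (x / 2) *+ 2); last by rewrite mulr2n -splitr.
by rewrite cos_mulr2n cos2sin2; ring.
Qed.

Lemma sqr_ler_norm x y : `|x| <= y -> x ^+ 2 <= y ^+ 2.
Proof. by move=> h; rewrite -[leLHS]real_normK ?num_real // lerXn2r ?nnegrE // (le_trans _ h). Qed.

Lemma cos_ge x : 1 - x ^+ 2 / 2 <= cos x.
Proof.
rewrite cos_half_angle; have := sqr_ler_norm (ler_norm_sin (x / 2)).
by rewrite real_normK ?num_real // expr_div_n; lra.
Qed.

Lemma sin_ge_half x : 0 <= x <= 1 -> x / 2 <= sin x.
Proof.
move=> /andP[x0 x1].
have cs : {within `[0, x], continuous (@sin R)}.
  by apply: continuous_subspaceT => z; exact: continuous_sin.
have [c] := @MVT_segment R sin cos 0 x x0 (fun z _ => is_derive_sin z) cs.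
rewrite sin0 !subr0 in_itv /= => /andP[c0 cx] ->.
by rewrite mulrC ler_wpM2r //; have := cos_ge c; nra.
Qed.

Lemma cos_le_quad x : x ^+ 2 <= 1 -> cos x <= 1 - x ^+ 2 / 8.
Proof.
wlog x0 : x / 0 <= x.
  by move=> h; case/orP: (le_total 0 x) => [/h //|]; rewrite -oppr_ge0 => /h; rewrite cosN sqrrN.
move=> x1; have /sin_ge_half h : 0 <= x / 2 <= 1 by nra.
by rewrite cos_half_angle; nra.
Qed.

Lemma chord_sqr x y :
  (cos x - cos y) ^+ 2 + (sin x - sin y) ^+ 2 = 4 * sin ((x - y) / 2) ^+ 2.
Proof.
have := cos_half_angle (x - y); rewrite cosB.
have := cos2Dsin2 x; have := cos2Dsin2 y; lra.
Qed.

Lemma ler_dist_cos x y : `|cos x - cos y| <= `|x - y|.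
Proof.
rewrite -(@ler_pXn2r _ 2) ?nnegrE // !real_normK ?num_real //.
have := chord_sqr x y; have := sqr_ler_norm (ler_norm_sin ((x - y) / 2)).
rewrite real_normK ?num_real // => h1 h2.
by have := sqr_ge0 (sin x - sin y); nra.
Qed.

Lemma ler_dist_sin x y : `|sin x - sin y| <= `|x - y|.
Proof.
rewrite -(@ler_pXn2r _ 2) ?nnegrE // !real_normK ?num_real //.
have := chord_sqr x y; have := sqr_ler_norm (ler_norm_sin ((x - y) / 2)).
rewrite real_normK ?num_real // => h1 h2.
by have := sqr_ge0 (cos x - cos y); nra.
Qed.

Lemma expR_le_quad x : x ^+ 2 <= 1 -> expR x <= 1 + x + 2 * x ^+ 2.
Proof.
move=> x1; have h0 : 0 < 1 - x / 2 by nra.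
have h1 : 1 - x / 2 <= expR (- (x / 2)) by have := expR_ge1Dx (- (x / 2)).
have -> : expR x = (expR (- (x / 2)) ^+ 2)^-1.
  by rewrite -expRM_natl -expRN; congr expR; field.
rewrite -[leLHS]mul1r ler_pdivrMr ?exprn_gt0 ?expR_gt0 //.
have h2 : (1 - x / 2) ^+ 2 <= expR (- (x / 2)) ^+ 2.
  by apply: lerXn2r; rewrite ?nnegrE ?(ltW h0) ?expR_ge0.
apply: le_trans (_ : (1 + x + 2 * x ^+ 2) * (1 - x / 2) ^+ 2 <= _); last first.
  by rewrite ler_wpM2l //; nra.
have : 0 <= x ^+ 2 * ((1 - x) * (5 - 2 * x)).
  by rewrite mulr_ge0 ?sqr_ge0 // mulr_ge0 //; nra.
by nra.
Qed.


Lemma expiD x y : expi (x + y) = expi x * expi y.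
Proof. by rewrite /expi cosD sinD; simpc; congr (_ +i* _)%C; rewrite addrC mulrC. Qed.

Lemma expi0 : expi 0 = 1 :> R[i].
Proof. by rewrite /expi cos0 sin0. Qed.

Lemma expi_sum (I : Type) (r : seq I) (F : I -> R) :
  expi (\sum_(i <- r) F i) = \prod_(i <- r) expi (F i).
Proof. by elim/big_rec2: _ => [|i y z _ <-]; [rewrite expi0|rewrite expiD]. Qed.

End Trig.

(** * Averages over independent phases on a finite grid *)

Section PhaseAverages.
Context {R : realType}.
Variable L : nat.
Hypothesis L0 : (0 < L)%N.
Local Notation M := (4 * L)%N.

(** The number of phases is a multiple of 4, so that the grid is invariant under quarter turns and
    the cancellations of the uniform phase hold exactly. *)
Definition grid_phase (j : nat) : R := 2 * pi * (j%:R / M%:R).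

(** Real part of [(c1 + i c2) e^(ix)]; the imaginary part is [wave c2 (- c1) x]. *)
Definition wave (c1 c2 x : R) : R := c1 * cos x - c2 * sin x.

(** A quarter turn sends the value [u] to [v], and two of them send it to [- u]. As [u^2 + v^2] is
    constant, quadratic bounds on [G] add up without knowledge of the individual values. *)
Lemma phase_sum (V : nmodType) (G : R -> V) (c1 c2 : R) :
  exists u v : nat -> R, (forall i, u i ^+ 2 + v i ^+ 2 = c1 ^+ 2 + c2 ^+ 2) /\
  \sum_(j < M) G (wave c1 c2 (grid_phase j)) =
  \sum_(i < L) (G (u i) + G (v i) + G (- u i) + G (- v i)).
Proof.
exists (fun i => wave c1 c2 (grid_phase i)),
  (fun i => wave c1 c2 (grid_phase i + pi / 2)); split=> [i|].
  rewrite /wave cosDpihalf sinDpihalf.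
  by have := cos2Dsin2 (grid_phase i); set a := cos _; set b := sin _ => e;
    rewrite -[RHS]mulr1 -e; ring.
have L1 : L%:R != 0 :> R by rewrite pnatr_eq0 -lt0n.
have shift i : grid_phase (L + i) = grid_phase i + pi / 2.
  by rewrite /grid_phase natrD natrM; field.
have quarter x : wave c1 c2 (x + pi / 2 + pi / 2) = - wave c1 c2 x.
  by rewrite /wave cosDpihalf sinDpihalf sinDpihalf cosDpihalf; ring.
have -> : (4 * L = L + (L + (L + L)))%N by lia.
rewrite !big_split_ord /= -!big_split /=; apply: eq_bigr => i _.
by rewrite !shift !quarter !addrA.
Qed.

(** Opposite phases cancel the imaginary parts and leave [2 (cos u + cos v)]; then
    [cos u <= 1 - u^2 / 8] produces the factor [1 - (c1^2 + c2^2) / 16]. *)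
Lemma phase_sum_expi (c1 c2 : R) : exists2 A : R,
  \sum_(j < M) expi (wave c1 c2 (grid_phase j)) = (A%:C)%C &
  `|A| <= M%:R /\
  (c1 ^+ 2 + c2 ^+ 2 <= 1 -> `|A| <= M%:R * expR (- ((c1 ^+ 2 + c2 ^+ 2) / 16))).
Proof.
have [u [v [uv ->]]] := phase_sum (@expi R) c1 c2.
exists (\sum_(i < L) 2 * (cos (u i) + cos (v i))).
  rewrite (raddf_sum (real_complex R)) /=; apply: eq_bigr => i _.
  by rewrite /expi !cosN !sinN; simpc; congr (_ +i* _)%C; ring.
have ML : M%:R = \sum_(i < L) (4 : R).
  by rewrite sumr_const card_ord natrM mulr_natr.
split=> [|c].
  rewrite ML (le_trans (ler_norm_sum _ _ _)) //; apply: ler_sum => i _.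
  have := cos_max (u i); have := cos_max (v i); rewrite !ler_norml => /andP[? ?] /andP[? ?].
  by apply/andP; split; lra.
apply: (@le_trans _ _ (M%:R * (1 - (c1 ^+ 2 + c2 ^+ 2) / 16))); last first.
  by rewrite ler_wpM2l //; have := expR_ge1Dx (- ((c1 ^+ 2 + c2 ^+ 2) / 16)).
rewrite ML mulr_suml (le_trans (ler_norm_sum _ _ _)) //; apply: ler_sum => i _.
have e := uv i.
have u1 : u i ^+ 2 <= 1 by have := sqr_ge0 (v i); lra.
have v1 : v i ^+ 2 <= 1 by have := sqr_ge0 (u i); lra.
have := cos_le_quad u1; have := cos_le_quad v1; have := cos_ge (u i); have := cos_ge (v i).
rewrite -e => h1 h2 h3 h4; rewrite ger0_norm; last by lra.
by lra.
Qed.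

Lemma phase_sum_expR (c1 c2 : R) : c1 ^+ 2 + c2 ^+ 2 <= 1 ->
  \sum_(j < M) expR (wave c1 c2 (grid_phase j)) <= M%:R * expR (c1 ^+ 2 + c2 ^+ 2).
Proof.
move=> c; have [u [v [uv ->]]] := phase_sum (@expR R) c1 c2.
have ML : M%:R = \sum_(i < L) (4 : R).
  by rewrite sumr_const card_ord natrM mulr_natr.
apply: (@le_trans _ _ (M%:R * (1 + (c1 ^+ 2 + c2 ^+ 2)))); last first.
  by rewrite ler_wpM2l //; exact: expR_ge1Dx.
rewrite ML mulr_suml; apply: ler_sum => i _.
have e := uv i.
have u1 : u i ^+ 2 <= 1 by have := sqr_ge0 (v i); lra.
have v1 : v i ^+ 2 <= 1 by have := sqr_ge0 (u i); lra.
have u1' : (- u i) ^+ 2 <= 1 by rewrite sqrrN.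
have v1' : (- v i) ^+ 2 <= 1 by rewrite sqrrN.
have := expR_le_quad u1; have := expR_le_quad v1.
have := expR_le_quad u1'; have := expR_le_quad v1'; rewrite !sqrrN -e; lra.
Qed.

Variable I : finType.
Local Notation grid := {ffun I -> 'I_M}.

Definition linear_wave (c1 c2 : I -> R) (f : grid) : R :=
  \sum_k wave (c1 k) (c2 k) (grid_phase (f k)).

Lemma card_gridE : #|{: grid}|%:R = \prod_(k : I) (M%:R : R).
Proof. by rewrite card_ffun card_ord natrX prodr_const. Qed.

Lemma linear_wave_cos (c1 c2 : I -> R) (S : {set I}) :
  (forall k, k \in S -> c1 k ^+ 2 + c2 k ^+ 2 <= 1) ->
  `|\sum_(f : grid) cos (linear_wave c1 c2 f)| <=
  #|{: grid}|%:R * expR (- ((\sum_(k in S) (c1 k ^+ 2 + c2 k ^+ 2)) / 16)).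
Proof.
move=> cS.
have /choice[A AP] k : exists A : R,
    \sum_(j < M) expi (wave (c1 k) (c2 k) (grid_phase j)) = (A%:C)%C /\ 
    `|A| <= M%:R * expR (- (if k \in S then (c1 k ^+ 2 + c2 k ^+ 2) / 16 else 0)).
  have [A AE [A1 A2]] := phase_sum_expi (c1 k) (c2 k); exists A; split => //.
  by case: ifP => [/cS|_]; [exact: A2|rewrite oppr0 expR0 mulr1].
have -> : \sum_(f : grid) cos (linear_wave c1 c2 f) = \prod_k A k.
  have : \sum_(f : grid) expi (linear_wave c1 c2 f) = ((\prod_k A k)%:C)%C.
    rewrite (rmorph_prod (real_complex R)) /=.
    under [RHS]eq_bigr do rewrite -(AP _).1.
    rewrite bigA_distr_bigA; apply: eq_bigr => f _.
    by rewrite /linear_wave expi_sum.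
  by move=> /(congr1 (@complex.Re R)); rewrite raddf_sum.
have -> : #|{: grid}|%:R * expR (- ((\sum_(k in S) (c1 k ^+ 2 + c2 k ^+ 2)) / 16)) =
    \prod_k (M%:R * expR (- (if k \in S then (c1 k ^+ 2 + c2 k ^+ 2) / 16 else 0))).
  by rewrite card_gridE [RHS]big_split /= -expR_sum sumrN -big_mkcond /= mulr_suml.
rewrite normr_prod.
apply: ler_prod => k _; rewrite normr_ge0 /=; exact: (AP k).2.
Qed.

Lemma linear_wave_expR (c1 c2 : I -> R) :
  (forall k, c1 k ^+ 2 + c2 k ^+ 2 <= 1) ->
  \sum_(f : grid) expR (linear_wave c1 c2 f) <=
  #|{: grid}|%:R * expR (\sum_k (c1 k ^+ 2 + c2 k ^+ 2)).
Proof.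
move=> c; have -> : #|{: grid}|%:R * expR (\sum_k (c1 k ^+ 2 + c2 k ^+ 2)) =
    \prod_k (M%:R * expR (c1 k ^+ 2 + c2 k ^+ 2)).
  by rewrite card_gridE [RHS]big_split /= expR_sum.
rewrite (eq_bigr (fun f : grid => \prod_k expR (wave (c1 k) (c2 k) (grid_phase (f k)))));
  last by move=> f _; rewrite /linear_wave expR_sum.
rewrite -(bigA_distr_bigA (fun (k : I) (j : 'I_M) => expR (wave (c1 k) (c2 k) (grid_phase j)))).
apply: ler_prod => k _; rewrite phase_sum_expR // andbT.
by apply: sumr_ge0 => j _; exact: expR_ge0.
Qed.

(** Chernoff bound; the hypothesis on [lambda] keeps every scaled amplitude in the range of the
    quadratic estimate. *)
Lemma linear_wave_tail (c1 c2 : I -> R) (lambda u : R) : 0 <= lambda ->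
  (forall k, lambda ^+ 2 * (c1 k ^+ 2 + c2 k ^+ 2) <= 1) ->
  #|[pred f : grid | u < linear_wave c1 c2 f]|%:R <=
  #|{: grid}|%:R *
    expR (lambda ^+ 2 * (\sum_k (c1 k ^+ 2 + c2 k ^+ 2)) - lambda * u).
Proof.
move=> l0 lc.
have h k : (lambda * c1 k) ^+ 2 + (lambda * c2 k) ^+ 2 <= 1.
  by rewrite !exprMn -mulrDr.
have := linear_wave_expR h.
have -> : \sum_k ((lambda * c1 k) ^+ 2 + (lambda * c2 k) ^+ 2) =
    lambda ^+ 2 * \sum_k (c1 k ^+ 2 + c2 k ^+ 2).
  by rewrite mulr_sumr; apply: eq_bigr => k _; rewrite !exprMn mulrDr.
move=> h1; rewrite expRD expRN mulrA ler_pdivlMr ?expR_gt0 //.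
apply: le_trans h1; rewrite -sum1_card natr_sum mulr_suml big_mkcond /=.
apply: ler_sum => f _; case: ifP => [|_]; last exact: expR_ge0.
rewrite inE mul1r ler_expR => /ltW uf.
have -> : linear_wave (fun k => lambda * c1 k) (fun k => lambda * c2 k) f =
    lambda * linear_wave c1 c2 f.
  rewrite /linear_wave mulr_sumr; apply: eq_bigr => k _.
  by rewrite /wave mulrBr !mulrA.
by rewrite ler_wpM2l.
Qed.

End PhaseAverages.

(** * From decay of the characteristic function to small-ball counts *)

Section SmallBallCount.
Context {R : realType}.
Implicit Types (b x e : R).

(** Majorant of the characteristic function in one coordinate of the frequency: rational, so that
    its sum over integers can be bounded by telescoping. *)
Definition lorentz b x : R := (1 + b ^+ 2 * x ^+ 2)^-1.

Lemma lorentz_den_gt0 b x : 0 < 1 + b ^+ 2 * x ^+ 2.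
Proof. by rewrite ltr_pwDl // mulr_ge0 // sqr_ge0. Qed.

Lemma lorentz_gt0 b x : 0 < lorentz b x.
Proof. by rewrite invr_gt0 lorentz_den_gt0. Qed.

(* Telescoping potential: x / (1 + b|x|) increases by at least [lorentz b x / 4]
   over each integer step ending at [x]. *)
Let potential b x : R := x / (1 + b * `|x|).

Let potential_step b x : 0 < b <= 1 -> 1 <= x \/ x <= 0 ->
  lorentz b x <= 4 * (potential b x - potential b (x - 1)).
Proof.
move=> /andP[b0 b1] [x1|x0]; rewrite /potential /lorentz.
  rewrite !ger0_norm; try lra.
  have p1 : 0 < 1 + b * x by nra.
  have p2 : 0 < 1 + b * (x - 1) by nra.
  have -> : x / (1 + b * x) - (x - 1) / (1 + b * (x - 1)) =
      ((1 + b * x) * (1 + b * (x - 1)))^-1.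
    by field; rewrite !gt_eqF.
  rewrite -ler_pdivrMl // -invfM lef_pV2 ?posrE ?mulr_gt0 ?lorentz_den_gt0 //.
  have := sqr_ge0 (1 - b * x); nra.
rewrite !ler0_norm; try lra.
have p1 : 0 < 1 + b * - x by nra.
have p2 : 0 < 1 + b * - (x - 1) by nra.
have -> : x / (1 + b * - x) - (x - 1) / (1 + b * - (x - 1)) =
    ((1 + b * - x) * (1 + b * - (x - 1)))^-1.
  by field; rewrite !gt_eqF.
rewrite -ler_pdivrMl // -invfM lef_pV2 ?posrE ?mulr_gt0 ?lorentz_den_gt0 //.
have := sqr_ge0 (1 - b * - x); nra.
Qed.

Let potential_bound b x : 0 < b -> `|potential b x| <= b^-1.
Proof.
move=> b0; rewrite /potential normrM normfV (@ger0_norm _ (1 + _)); last first.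
  by rewrite addr_ge0 // mulr_ge0 // ltW.
rewrite ler_pdivrMr; last by rewrite ltr_pwDl // mulr_ge0 // ltW.
by rewrite mulrDr mulr1 mulKf ?gt_eqF // lerDr invr_ge0 ltW.
Qed.

Lemma sum_lorentz b Q (j' : nat) : 0 < b <= 1 ->
  \sum_(j < Q) lorentz b (j%:R - j'%:R) <= 8 / b.
Proof.
move=> b01; have b0 : 0 < b by case/andP: b01.
apply: (@le_trans _ _
  (4 * (potential b (Q%:R - 1 - j'%:R) - potential b (- 1 - j'%:R)))); last first.
  have := potential_bound (Q%:R - 1 - j'%:R) b0.
  have := potential_bound (- 1 - j'%:R) b0.
  rewrite !ler_norml => /andP[? ?] /andP[? ?]; lra.
elim: Q => [|Q IH]; first by rewrite big_ord0 sub0r subrr mulr0.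
rewrite big_ord_recr /=; apply: le_trans (lerD IH (potential_step b01 _)) _.
  case: (leqP Q j') => h; [right|left]; first by rewrite subr_le0 ler_nat.
  by rewrite lerBrDr nat1r ler_nat.
have -> : Q.+1%:R - 1 - j'%:R = Q%:R - j'%:R :> R by rewrite -natr1; ring.
have -> : Q%:R - j'%:R - 1 = Q%:R - 1 - j'%:R :> R by ring.
by lra.
Qed.

Lemma fejer_ge (Q : nat) x : `|x| * Q%:R <= 1 ->
  Q%:R ^+ 2 / 4 <= \sum_(j < Q) \sum_(j' < Q) cos ((j%:R - j'%:R) * x).
Proof.
move=> xQ.
have -> : \sum_(j < Q) \sum_(j' < Q) cos ((j%:R - j'%:R) * x) =
   (\sum_(j < Q) cos (j%:R * x)) ^+ 2 + (\sum_(j < Q) sin (j%:R * x)) ^+ 2.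
  rewrite !expr2 !mulr_suml -big_split /=; apply: eq_bigr => j _.
  rewrite !mulr_sumr -big_split /=; apply: eq_bigr => j' _.
  by rewrite mulrBl cosB.
apply: (@le_trans _ _ ((\sum_(j < Q) cos (j%:R * x)) ^+ 2)); last by rewrite lerDl sqr_ge0.
have : Q%:R / 2 <= \sum_(j < Q) cos (j%:R * x).
  have -> : Q%:R / 2 = \sum_(j < Q) (2^-1 : R).
    by rewrite sumr_const card_ord mulr_natl.
  apply: ler_sum => j _; apply: le_trans (cos_ge _).
  have : `|j%:R * x| <= 1.
    rewrite normrM mulrC (le_trans _ xQ) // ler_wpM2l // ger0_norm // ler_nat.
    exact: ltnW.
  rewrite ler_norml => /andP[? ?]; nra.
have : 0 <= Q%:R / 2 :> R by rewrite divr_ge0.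
by nra.
Qed.

(** A discrete Esseen inequality. The product of two Fejer kernels is nonnegative, and at least
    [(Q^2 / 4)^2] where both coordinates are below [1 / Q], while its sum expands into the averages
    of the hypothesis. The constant is [2^10 = 4^2 * 8^2]. *)
Lemma fejer_count (T : finType) (X Y : T -> R) (Q : nat) b (C : R) :
  (0 < Q)%N -> 0 < b <= 1 -> 0 <= C ->
  (forall j j' l l' : 'I_Q,
    `|\sum_f cos ((j%:R - j'%:R) * X f + (l%:R - l'%:R) * Y f)| <=
    #|T|%:R * (C * (lorentz b (j%:R - j'%:R) * lorentz b (l%:R - l'%:R)))) ->
  #|[pred f | (`|X f| * Q%:R <= 1) && (`|Y f| * Q%:R <= 1)]|%:R <=
  #|T|%:R * (2 ^+ 10 * C / (Q%:R ^+ 2 * b ^+ 2)).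
Proof.
move=> Q0 b01 C0 H; have b0 : 0 < b by case/andP: b01.
have QR : 0 < Q%:R :> R by rewrite ltr0n.
pose F x := \sum_(j < Q) \sum_(j' < Q) cos ((j%:R - j'%:R) * x) : R.
have FF x : F x = (\sum_(j < Q) cos (j%:R * x)) ^+ 2 + (\sum_(j < Q) sin (j%:R * x)) ^+ 2.
  rewrite !expr2 !mulr_suml -big_split /=; apply: eq_bigr => j _.
  rewrite !mulr_sumr -big_split /=; apply: eq_bigr => j' _.
  by rewrite mulrBl cosB.
have F0 x : 0 <= F x by rewrite FF addr_ge0 // sqr_ge0.
have step1 : #|[pred f | (`|X f| * Q%:R <= 1) && (`|Y f| * Q%:R <= 1)]|%:R * (Q%:R ^+ 2 / 4) ^+ 2
    <= \sum_f F (X f) * F (Y f).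
  rewrite -sum1_card natr_sum mulr_suml big_mkcond /=; apply: ler_sum => f _.
  rewrite inE; case: andP => [[hx hy]|_]; last by rewrite mulr_ge0.
  rewrite mul1r expr2; apply: ler_pM; rewrite ?divr_ge0 ?sqr_ge0 //; exact: fejer_ge.
have step2 : \sum_f F (X f) * F (Y f) <=
    #|T|%:R * (C * ((\sum_(j < Q) \sum_(j' < Q) lorentz b (j%:R - j'%:R)) ^+ 2)).
  have -> : \sum_f F (X f) * F (Y f) =
     \sum_(j < Q) \sum_(j' < Q) \sum_(l < Q) \sum_(l' < Q)
       \sum_f cos ((j%:R - j'%:R) * X f) * cos ((l%:R - l'%:R) * Y f).
    rewrite /F; under eq_bigr do rewrite mulr_suml.
    rewrite exchange_big; apply: eq_bigr => j _.
    under eq_bigr do rewrite mulr_suml.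
    rewrite exchange_big; apply: eq_bigr => j' _.
    under eq_bigr do rewrite mulr_sumr.
    rewrite exchange_big; apply: eq_bigr => l _.
    under eq_bigr do rewrite mulr_sumr.
    by rewrite exchange_big; apply: eq_bigr => l' _.
  rewrite expr2 mulr_suml !mulr_sumr; apply: ler_sum => j _.
  rewrite mulr_suml !mulr_sumr; apply: ler_sum => j' _.
  rewrite !mulr_sumr; apply: ler_sum => l _.
  rewrite !mulr_sumr; apply: ler_sum => l' _.
  have := H j j' l l'; have := H j j' l' l.
  have -> : lorentz b (l'%:R - l%:R) = lorentz b (l%:R - l'%:R).
    by rewrite /lorentz -(sqrrN (l%:R - _)) opprB.
  rewrite !ler_norml => /andP[_ h1] /andP[_ h2].
  have -> : \sum_f cos ((j%:R - j'%:R) * X f) * cos ((l%:R - l'%:R) * Y f) =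
    (\sum_f cos ((j%:R - j'%:R) * X f + (l%:R - l'%:R) * Y f) +
     \sum_f cos ((j%:R - j'%:R) * X f + (l'%:R - l%:R) * Y f)) / 2.
    rewrite -big_split /= mulr_suml; apply: eq_bigr => f _.
    by rewrite -(opprB l%:R) mulNr cosB cosD; field.
  lra.
have step3 : \sum_(j < Q) \sum_(j' < Q) lorentz b (j%:R - j'%:R) <= Q%:R * (8 / b).
  rewrite exchange_big /=.
  have -> : Q%:R * (8 / b) = \sum_(j < Q) (8 / b) by rewrite sumr_const card_ord mulr_natl.
  by apply: ler_sum => j _; exact: sum_lorentz.
have step4 : (\sum_(j < Q) \sum_(j' < Q) lorentz b (j%:R - j'%:R)) ^+ 2 <= (Q%:R * (8 / b)) ^+ 2.
  apply: lerXn2r step3; rewrite nnegrE.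
    by apply: sumr_ge0 => j _; apply: sumr_ge0 => j' _; exact: ltW (lorentz_gt0 _ _).
  by rewrite mulr_ge0 ?ltW // divr_gt0.
have p : 0 < (Q%:R ^+ 2 / 4) ^+ 2 :> R by rewrite exprn_gt0 // divr_gt0 // exprn_gt0.
rewrite -(ler_pM2r p); apply: le_trans step1 _; apply: le_trans step2 _.
rewrite -[leRHS]mulrA ler_wpM2l //.
have -> : 2 ^+ 10 * C / (Q%:R ^+ 2 * b ^+ 2) * (Q%:R ^+ 2 / 4) ^+ 2 = C * (Q%:R * (8 / b)) ^+ 2.
  by field; rewrite !gt_eqF.
by rewrite ler_wpM2l.
Qed.

Lemma exp_decay_quad e x : 0 < e <= 1 -> 0 <= x ->
  expR (- (e * x)) <= (8 / e) ^+ 8 / (1 + x) ^+ 2.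
Proof.
move=> /andP[e0 e1] x0.
have h : (1 + e * x / 2) ^+ 2 <= expR (e * x).
  have -> : e * x = 2%:R * (e * x / 2) by field.
  rewrite expRM_natl; apply: lerXn2r; rewrite ?nnegrE ?expR_ge0 //; first nra.
  by apply: le_trans (expR_ge1Dx _); rewrite mulrAC divff // mul1r.
have x1 : 0 < (1 + x) ^+ 2 by rewrite exprn_gt0 //; lra.
have e8 : (8 / e) ^+ 8 >= (2 / e) ^+ 2.
  apply: (@le_trans _ _ ((8 / e) ^+ 2)).
    apply: lerXn2r; rewrite ?nnegrE ?divr_ge0 ?(ltW e0) //.
    by rewrite ler_pM2r ?invr_gt0 //; lra.
  rewrite ler_weXn2l // ler_pdivlMr //; lra.
rewrite expRN ler_pdivlMr // mulrC ler_pdivrMr ?expR_gt0 //.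
apply: le_trans (ler_wpM2r (expR_ge0 _) e8).
apply: le_trans (ler_wpM2l (sqr_ge0 _) h).
rewrite -exprMn; apply: lerXn2r; rewrite ?nnegrE //; first lra.
  by rewrite mulr_ge0 ?divr_ge0 ?(ltW e0) //; nra.
have -> : 2 / e * (1 + e * x / 2) = 2 / e + x by field; rewrite gt_eqF.
have : 1 <= 2 / e by rewrite ler_pdivlMr //; lra.
lra.
Qed.

(** For frequencies at which only [M], of order [m^(1/4)], enters the exponent: an eighth power
    still yields the decay [(1 + m)^-2]. The constant [(8 / e) ^+ 8] is shared with [exp_decay_quad]
    so that both regimes merge. *)
Lemma exp_decay_octic e (M : R) : 0 < e <= 1 -> 0 <= M ->
  expR (- (e * M)) <= (8 / e) ^+ 8 / (1 + M ^+ 4) ^+ 2.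
Proof.
move=> /andP[e0 e1] M0.
have h : (1 + e * M / 8) ^+ 8 <= expR (e * M).
  have -> : e * M = 8%:R * (e * M / 8) by field.
  rewrite expRM_natl; apply: lerXn2r; rewrite ?nnegrE ?expR_ge0 //; first nra.
  by apply: le_trans (expR_ge1Dx _); rewrite mulrAC divff // mul1r.
have x1 : 0 < (1 + M ^+ 4) ^+ 2.
  by rewrite exprn_gt0 // ltr_pwDl // exprn_ge0.
rewrite expRN ler_pdivlMr // mulrC ler_pdivrMr ?expR_gt0 //.
apply: le_trans (ler_wpM2l _ h); last by rewrite exprn_ge0 // divr_ge0 // ltW.
have -> : (8 / e) ^+ 8 * (1 + e * M / 8) ^+ 8 = ((8 / e + M) ^+ 4) ^+ 2.
  by rewrite -exprMn -exprM; congr (_ ^+ _); field; rewrite gt_eqF.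
have e8 : 1 <= 8 / e by rewrite ler_pdivlMr //; lra.
apply: lerXn2r; rewrite ?nnegrE ?exprn_ge0 ?addr_ge0 ?exprn_ge0 //; first lra.
apply: (@le_trans _ _ ((1 + M) ^+ 4)); last by apply: lerXn2r; rewrite ?nnegrE; lra.
have := exprn_ge0 3 M0; have := exprn_ge0 2 M0; rewrite !exprS !expr0 !mulr1; nra.
Qed.

Variable L : nat.
Hypothesis L0 : (0 < L)%N.
Variable I : finType.
Local Notation grid := {ffun I -> 'I_(4 * L)}.

(* A frequency [m = alpha ^+ 2 + beta ^+ 2] is damped if the phases it resolves carry
   enough energy, either linearly in [m] or like its fourth root. *)
Lemma small_ball_count (c1 c2 : I -> R) (Q : nat) b e : (0 < Q)%N ->
  0 < b <= 1 -> 0 < e <= 1 ->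
  (forall m : nat, (0 < m <= 2 * Q ^ 2)%N -> exists S : {set I},
     (forall k, k \in S -> m%:R * (c1 k ^+ 2 + c2 k ^+ 2) <= 1) /\
     (e * (b ^+ 2 * m%:R) <= m%:R * (\sum_(k in S) (c1 k ^+ 2 + c2 k ^+ 2)) / 16 \/
      exists2 M : nat, (m <= M ^ 4)%N &
        e * M%:R <= m%:R * (\sum_(k in S) (c1 k ^+ 2 + c2 k ^+ 2)) / 16)) ->
  #|[pred f : grid | (`|linear_wave c1 c2 f| * Q%:R <= 1) &&
                    (`|linear_wave c2 (fun k => - c1 k) f| * Q%:R <= 1)]|%:R <=
  #|{: grid}|%:R * (2 ^+ 10 * (8 / e) ^+ 8 / (Q%:R ^+ 2 * b ^+ 2)).
Proof.
move=> Q0 b01 e01 H; have [b0 b1] := andP b01; have [e0 e1] := andP e01.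
have K0 : 1 <= (8 / e) ^+ 8 by rewrite exprn_ege1 // ler_pdivlMr //; lra.
apply: fejer_count => //; first by apply: le_trans K0.
move=> j j' l l'.
set al := j%:R - j'%:R; set be := l%:R - l'%:R : R.
pose m := (`|j%:Z - j'%:Z|%N ^ 2 + `|l%:Z - l'%:Z|%N ^ 2)%N.
have mE : m%:R = al ^+ 2 + be ^+ 2.
  by rewrite /m natrD !natrX !natr_absz !intr_norm !rmorphB /= -!pmulrn !real_normK ?num_real.
have lin f : al * linear_wave c1 c2 f + be * linear_wave c2 (fun k => - c1 k) f =
   linear_wave (fun k => al * c1 k + be * c2 k) (fun k => al * c2 k - be * c1 k) f.
  rewrite /linear_wave !mulr_sumr -big_split /=; apply: eq_bigr => k _.
  by rewrite /wave; ring.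
under eq_bigr do rewrite lin.
(* Pairing with the frequency [(al, be)] rotates every coefficient vector and multiplies its squared
   length by [m], so only the modulus of the frequency matters. *)
have cE k : (al * c1 k + be * c2 k) ^+ 2 + (al * c2 k - be * c1 k) ^+ 2 =
   m%:R * (c1 k ^+ 2 + c2 k ^+ 2) by rewrite mE; ring.
have lor x : 0 <= x -> b ^+ 2 * m%:R <= x ->
    ((1 + x) ^+ 2)^-1 <= lorentz b al * lorentz b be.
  move=> x0 mx; have x1 : 0 < 1 + x by lra.
  rewrite /lorentz -invfM lef_pV2 ?posrE ?exprn_gt0 ?mulr_gt0 ?lorentz_den_gt0 //.
  move: mx; rewrite mE mulrDr.
  have := mulr_ge0 (sqr_ge0 b) (sqr_ge0 al); have := mulr_ge0 (sqr_ge0 b) (sqr_ge0 be).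
  set u := b ^+ 2 * al ^+ 2; set v := b ^+ 2 * be ^+ 2; move=> u0 v0 uv.
  by rewrite expr2; apply: ler_pM; lra.
have [m0|m0] := posnP m.
  have -> : lorentz b al * lorentz b be = 1.
    have : al ^+ 2 + be ^+ 2 = 0 by rewrite -mE m0.
    move=> /eqP; rewrite paddr_eq0 ?sqr_ge0 // => /andP[/eqP h1 /eqP h2].
    by rewrite /lorentz h1 h2 mulr0 addr0 invr1 mulr1.
  rewrite mulr1; have := @linear_wave_cos R L L0 I (fun k => al * c1 k + be * c2 k)
    (fun k => al * c2 k - be * c1 k) finset.set0 _.
  rewrite big_set0 mul0r oppr0 expR0 => h; apply: le_trans (h _) _.
    by move=> k; rewrite finset.inE.
  by rewrite ler_wpM2l.
have mQ : (0 < m <= 2 * Q ^ 2)%N.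
  rewrite m0 /=; have -> : (2 * Q ^ 2 = Q ^ 2 + Q ^ 2)%N by lia.
  have d (a c : 'I_Q) : (`|a%:Z - c%:Z|%N ^ 2 <= Q ^ 2)%N.
    rewrite leq_exp2r //; have := ltn_ord a; have := ltn_ord c; lia.
  exact: leq_add.
have [S [S1 S2]] := H m mQ.
apply: (le_trans (linear_wave_cos L0 (S := S) _)).
  by move=> k /S1; rewrite cE.
under eq_bigr do rewrite cE.
rewrite -mulr_sumr ler_wpM2l //.
case: S2 => [S2|[M mM S2]].
  apply: (@le_trans _ _ (expR (- (e * (b ^+ 2 * m%:R))))); first by rewrite ler_expR lerN2.
  have bm : 0 <= b ^+ 2 * m%:R by rewrite mulr_ge0 // sqr_ge0.
  apply: le_trans (exp_decay_quad e01 bm) _; rewrite ler_wpM2l ?(le_trans _ K0) //.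
  exact: lor.
apply: (@le_trans _ _ (expR (- (e * M%:R)))); first by rewrite ler_expR lerN2.
apply: le_trans (exp_decay_octic e01 _) _ => //; rewrite ler_wpM2l ?(le_trans _ K0) //.
apply: lor; first by rewrite exprn_ge0.
apply: (@le_trans _ _ m%:R); last by rewrite -natrX ler_nat.
by rewrite ler_piMl // expr_le1 // ltW.
Qed.

End SmallBallCount.

Ltac nat_lia :=
  repeat match goal with
  | H : is_true (@Order.le _ _ _ _) |- _ => clear H
  | H : is_true (@Order.lt _ _ _ _) |- _ => clear H
  | H : is_true (andb (@Order.lt _ _ _ _) _) |- _ => clear H
  | H : is_true (andb (@Order.le _ _ _ _) _) |- _ => clear H
  end; lia.

(** * Energy and damping of the increments of the series *)

Section RiemannIncrements.
Context {R : realType}.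
Implicit Types (x y h : R) (theta : int -> R).

Definition increment_re x y n : R :=
  if n == 0 then 0 else
  - (cos (4 * pi ^+ 2 * n%:~R ^+ 2 * x) - cos (4 * pi ^+ 2 * n%:~R ^+ 2 * y)) /
    (4 * pi ^+ 2 * n%:~R ^+ 2).

Definition increment_im x y n : R :=
  if n == 0 then x - y else
  (sin (4 * pi ^+ 2 * n%:~R ^+ 2 * x) - sin (4 * pi ^+ 2 * n%:~R ^+ 2 * y)) /
    (4 * pi ^+ 2 * n%:~R ^+ 2).

Definition increment_sqr x y n := increment_re x y n ^+ 2 + increment_im x y n ^+ 2.

Lemma riemann_term_diff theta x y n :
  riemann_term theta x n - riemann_term theta y n =
  (wave (increment_re x y n) (increment_im x y n) (2 * pi * theta n) +i*
   wave (increment_im x y n) (- increment_re x y n) (2 * pi * theta n))%C.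
Proof.
rewrite /riemann_term /increment_re /increment_im /wave /expi; case: eqP => [_|/eqP n0].
  by simpc; congr (_ +i* _)%C; ring.
have w0 : 4 * pi ^+ 2 * n%:~R ^+ 2 != 0 :> R.
  have pi0 : pi != 0 :> R by rewrite gt_eqF ?pi_gt0.
  have nR : n%:~R != 0 :> R by rewrite intr_eq0.
  by rewrite !mulf_neq0 ?expf_neq0.
set w := 4 * pi ^+ 2 * n%:~R ^+ 2 in w0 *.
have -> : ((- w)%:C)^-1%C = ((- w^-1)%:C)%C.
  by rewrite -(fmorphV (real_complex R)) invrN.
rewrite !cosN !sinN; simpc.
by congr (_ +i* _)%C; field.
Qed.

(** A chord of the unit circle; as only [x - y] enters, the estimates are uniform in the
    position. *)
Lemma increment_sqrE x y n : n != 0 -> increment_sqr x y n =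
  sin (2 * pi ^+ 2 * n%:~R ^+ 2 * (x - y)) ^+ 2 / (4 * pi ^+ 4 * n%:~R ^+ 4).
Proof.
move=> n0; rewrite /increment_sqr /increment_re /increment_im (negbTE n0).
rewrite mulNr sqrrN !expr_div_n -mulrDl chord_sqr.
have -> : (4 * pi ^+ 2 * n%:~R ^+ 2 * x - 4 * pi ^+ 2 * n%:~R ^+ 2 * y) / 2 =
   2 * pi ^+ 2 * n%:~R ^+ 2 * (x - y) by field.
have pi0 : pi != 0 :> R by rewrite gt_eqF ?pi_gt0.
have nR : n%:~R != 0 :> R by rewrite intr_eq0.
by move: pi0; move: (@pi R) => p p0; field; rewrite nR p0.
Qed.

Lemma increment_sqr0 x y : increment_sqr x y 0 = (x - y) ^+ 2.
Proof. by rewrite /increment_sqr /increment_re /increment_im eqxx expr0n add0r. Qed.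

Lemma increment_sqrN x y n : increment_sqr x y (- n) = increment_sqr x y n.
Proof.
have [->|n0] := eqVneq n 0; first by rewrite oppr0.
rewrite !increment_sqrE ?oppr_eq0 // rmorphN /= sqrrN.
by rewrite (_ : (- n%:~R) ^+ 4 = n%:~R ^+ 4 :> R) //; ring.
Qed.

Lemma increment_sqr_lip x y n : increment_sqr x y n <= (x - y) ^+ 2.
Proof.
have [->|n0] := eqVneq n 0; first by rewrite increment_sqr0.
have nR : 0 < n%:~R ^+ 4 :> R by rewrite exprn_even_gt0 //= intr_eq0.
have p0 := @pi_gt0 R.
rewrite increment_sqrE // ler_pdivrMr; last first.
  by apply: mulr_gt0 nR; rewrite mulr_gt0 // exprn_gt0.
have := sqr_ler_norm (ler_norm_sin (2 * pi ^+ 2 * n%:~R ^+ 2 * (x - y))).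
rewrite real_normK ?num_real // => /le_trans; apply.
by rewrite le_eqVlt; apply/orP; left; apply/eqP; ring.
Qed.

Lemma increment_sqr_quartic x y n : n != 0 -> increment_sqr x y n <= (n%:~R ^+ 4)^-1.
Proof.
move=> n0; have nR : 0 < n%:~R ^+ 4 :> R by rewrite exprn_even_gt0 //= intr_eq0.
rewrite increment_sqrE // ler_pdivrMr; last first.
  by apply: mulr_gt0 nR; rewrite mulr_gt0 // exprn_gt0 // pi_gt0.
rewrite [leRHS]mulrCA mulVf ?gt_eqF // mulr1.
apply: (@le_trans _ _ 1); first by rewrite -[leRHS](expr1n _ 2); apply: sqr_ler_norm; exact: sin_max.
have := @pi_ge2 R; rewrite -[pi ^+ 4]/(pi ^+ (2 * 2)) exprM => p.
have : 4 <= (pi : R) ^+ 2 by nra.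
by nra.
Qed.

(** [N] is the integer part of [1 / sqrt a]; as [a <= 1], truncation loses less than a factor 2,
    hence 4 after squaring. *)
Lemma exists_sqrt_scale (a : R) : 0 < a <= 1 ->
  exists N : nat, [/\ (0 < N)%N, a * N%:R ^+ 2 <= 1 & 1 < 4 * a * N%:R ^+ 2].
Proof.
move=> /andP[a0 a1]; pose s := Num.sqrt a.
have s0 : 0 < s by rewrite sqrtr_gt0.
have sa : s ^+ 2 = a by rewrite sqr_sqrtr // ltW.
have s1 : s <= 1 by rewrite -sqrtr1 ler_wsqrtr.
have si0 : 0 <= s^-1 by rewrite invr_ge0 ltW.
have /andP[N1 N2] := truncn_itv si0.
set N := Num.truncn _ in N1 N2.
have N0 : (0 < N)%N.
  by rewrite -ltnS -(ltr_nat R) (le_lt_trans _ N2) // invf_ge1.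
have NR : 1 <= N%:R :> R by rewrite ler1n.
move: N1 N2; rewrite -natr1 -[s^-1]mul1r ler_pdivlMr // ltr_pdivrMr // => N1 N2.
exists N; rewrite -sa; have -> : s ^+ 2 * N%:R ^+ 2 = (N%:R * s) ^+ 2 by ring.
have -> : 4 * s ^+ 2 * N%:R ^+ 2 = (2 * (N%:R * s)) ^+ 2 by ring.
have p2 : 1 < 2 * (N%:R * s) by nra.
by split => //; [rewrite expr_le1 // mulr_ge0 // ltW|rewrite exprn_egt1].
Qed.

Lemma ler_norm_sinD x y : `|sin (x + y)| <= `|sin x| + `|sin y|.
Proof.
rewrite sinD (le_trans (ler_normD _ _)) // !normrM lerD //.
  by rewrite ler_piMr // cos_max.
by rewrite mulrC ler_piMr // cos_max.
Qed.

Definition weyl_sqr h (j : nat) : R := sin (2 * pi ^+ 2 * j%:R ^+ 2 * h) ^+ 2.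

(** The second difference [(n - k)^2 + (n + k)^2 - 2 n^2 = 2 k^2] does not depend on [n]. Its sine
    is at least [1 / 8], and subadditivity of the modulus of the sine distributes this over the
    three angles. Finally [(u + v + 2 z)^2 <= 6 (u^2 + v^2 + z^2)], and [6 * 64 <= 512]. *)
Lemma weyl_triple h (k n : nat) : 4^-1 <= 4 * pi ^+ 2 * k%:R ^+ 2 * h <= 1 -> (k <= n)%N ->
  512^-1 <= weyl_sqr h (n - k) + weyl_sqr h n + weyl_sqr h (n + k).
Proof.
move=> /andP[k1 k2] kn.
pose a (j : nat) : R := sin (2 * pi ^+ 2 * j%:R ^+ 2 * h).
have e : 4 * pi ^+ 2 * k%:R ^+ 2 * h =
    2 * pi ^+ 2 * (n - k)%N%:R ^+ 2 * h + 2 * pi ^+ 2 * (n + k)%N%:R ^+ 2 * h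
    - (2 * pi ^+ 2 * n%:R ^+ 2 * h) *+ 2.
  by rewrite natrB // natrD; ring.
have h1 : 8^-1 <= sin (4 * pi ^+ 2 * k%:R ^+ 2 * h).
  by apply: le_trans (sin_ge_half _); lra.
have h2 : sin (4 * pi ^+ 2 * k%:R ^+ 2 * h) <= `|a (n - k)%N| + `|a (n + k)%N| + 2 * `|a n|.
  apply: le_trans (ler_norm _) _; rewrite e mulr2n.
  apply: le_trans (ler_norm_sinD _ _) _; rewrite sinN normrN.
  by apply: lerD; [exact: ler_norm_sinD|rewrite (_ : 2 * `|a n| = `|a n| + `|a n|); [exact: ler_norm_sinD|ring]].
have := sqr_ge0 (`|a (n - k)%N| - `|a (n + k)%N|).
have := sqr_ge0 (2 * `|a (n - k)%N| - `|a n|).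
have := sqr_ge0 (2 * `|a (n + k)%N| - `|a n|).
rewrite /weyl_sqr -!/(a _) -!(real_normK (num_real (a _))).
set u := `|a (n - k)%N| in h2 *; set v := `|a (n + k)%N| in h2 *; set z := `|a n| in h2 *.
have : 64^-1 <= (u + v + 2 * z) ^+ 2 by nra.
nra.
Qed.

Lemma fourth_root_scale (m : nat) : (0 < m)%N ->
  exists M : nat, [/\ (0 < M)%N, (m <= M ^ 4)%N & (M ^ 4 <= 16 * m)%N].
Proof.
move=> m0; have ex : exists M, (m <= M ^ 4)%N by exists m; rewrite -[X in (X <= _)%N]expn1 leq_pexp2l.
case: (ex_minnP ex) => M mM Mmin.
have M0 : (0 < M)%N by case: M mM {Mmin} => //; rewrite exp0n // leqNgt m0.
exists M; split => //.
case: M M0 mM Mmin => [//|[|M]] _ mM Mmin; first by rewrite exp1n; lia.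
have : (M.+1 ^ 4 < m)%N by rewrite ltnNge; apply/negP => /Mmin; rewrite ltnn.
have : (M.+2 ^ 4 <= (2 * M.+1) ^ 4)%N by rewrite leq_exp2r //; lia.
rewrite expnMn; lia.
Qed.


Lemma sum_window (F : int -> R) (K a b : nat) : (b <= K.+1)%N ->
  \sum_(k in [set k : 'I_K.*2.+1 | (a + K <= k < b + K)%N]%SET) F (k%:Z - K%:Z) =
  \sum_(a <= n < b) F n%:Z.
Proof.
move=> bK; under eq_bigl do rewrite finset.inE.
have bK2 : (b + K <= K.*2.+1)%N by lia.
have [ab|ba] := leqP a b; last first.
  rewrite big_geq ?(ltnW ba) // big_pred0 // => k; lia.
transitivity (\sum_(0 + K <= k < b + K | (a + K <= k)%N) F (k%:Z - K%:Z)).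
  rewrite add0n (big_nat_widen _ _ _ _ _ bK2).
  rewrite (big_nat_widenl _ 0%N) // big_mkord.
  by apply: eq_bigl => k; apply/idP/idP; lia.
rewrite big_addn addnK big_nat_cond [RHS](big_nat_widenl _ 0%N) // [RHS]big_nat_cond.
apply: eq_big => [n|n _]; first lia.
by congr F; lia.
Qed.

Lemma sum_symmetric (V : zmodType) (F : int -> V) (K : nat) :
  \sum_(k < K.*2.+1) F (k%:Z - K%:Z) =
  F 0 + \sum_(n < K) (F n.+1%:Z + F (- n.+1%:Z)).
Proof.
elim: K => [|K IH]; first by rewrite big_ord_recl !big_ord0 subrr.
have toN (n m : nat) : \sum_(k < n) F (k%:Z - m%:Z) = \sum_(0 <= k < n) F (k%:Z - m%:Z).
  by rewrite big_mkord.
rewrite toN doubleS big_nat_recl // big_nat_recr //=.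
rewrite (eq_bigr (fun k => F (k%:Z - K%:Z))); last by move=> k _; congr F; lia.
rewrite -toN IH big_ord_recr /= sub0r addrCA -!addrA; congr (_ + (_ + _)).
by rewrite addrC; congr (F _ + _); lia.
Qed.

Definition energy h : R := h * Num.sqrt h.

Lemma energy_gt0 h : 0 < h -> 0 < energy h.
Proof. by move=> h0; rewrite mulr_gt0 // sqrtr_gt0. Qed.

(** Split at [N ~ h^(-1/2)]: the head costs at most [N h^2 <= energy h], the telescoping tail at
    most [N^-3 <= 8 * energy h]. Both signs of [n] and the term [n = 0] make [2 * 9 + 1 = 19]. *)
Lemma total_energy x y h K : 0 < h <= 1 -> (x - y) ^+ 2 = h ^+ 2 ->
  \sum_(k < K.*2.+1) increment_sqr x y (k%:Z - K%:Z) <= 19 * energy h.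
Proof.
move=> h01 xyh; have [h0 h1] := andP h01.
pose s := Num.sqrt h; have s0 : 0 < s by rewrite sqrtr_gt0.
have ss : s ^+ 2 = h by rewrite sqr_sqrtr // ltW.
have s1 : s <= 1 by rewrite -sqrtr1 ler_wsqrtr.
have [N [N0 N1 N2]] := exists_sqrt_scale h01.
have NR : 0 < N%:R :> R by rewrite ltr0n.
have sN1 : N%:R * s <= 1.
  by rewrite -(@expr_le1 _ 2) ?mulr_ge0 ?(ltW s0) ?(ltW NR) // exprMn ss mulrC.
have sN2 : 1 < 2 * (N%:R * s).
  rewrite -(@expr_gt1 _ 2) ?mulr_ge0 ?(ltW s0) ?(ltW NR) // !exprMn ss.
  by move: N2; rewrite -natrX; lra.
pose G (n : nat) := increment_sqr x y n.+1%:Z.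
have G0 n : 0 <= G n by rewrite /G /increment_sqr addr_ge0 // sqr_ge0.
have Gh n : G n <= h ^+ 2 by rewrite -xyh; exact: increment_sqr_lip.
have Gq n : G n <= (n.+1%:R ^+ 4)^-1 by exact: increment_sqr_quartic.
have tail d : \sum_(n < N + d) G n <=
    N%:R * h ^+ 2 + (N%:R ^+ 2)^-1 * (N%:R^-1 - (N + d)%:R^-1).
  elim: d => [|d IH].
    rewrite addn0 subrr mulr0 addr0.
    have -> : N%:R * h ^+ 2 = \sum_(n < N) h ^+ 2 by rewrite sumr_const card_ord mulr_natl.
    exact: ler_sum.
  rewrite addnS big_ord_recr /=; apply: le_trans (lerD IH (Gq _)) _.
  rewrite -addrA lerD2l -lerBrDl -mulrBr.
  have -> : N%:R^-1 - (N + d).+1%:R^-1 - (N%:R^-1 - (N + d)%:R^-1) =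
     (N + d)%:R^-1 - (N + d).+1%:R^-1 :> R by ring.
  set j := (N + d)%N; have jR : 0 < j%:R :> R by rewrite ltr0n; lia.
  have jN : N%:R <= j%:R :> R by rewrite ler_nat leq_addr.
  rewrite -natr1; have -> : j%:R^-1 - (j%:R + 1)^-1 = (j%:R * (j%:R + 1))^-1 :> R.
    by field; rewrite !gt_eqF //; lra.
  have j1 : 0 < j%:R + 1 :> R by lra.
  rewrite -invfM lef_pV2 ?posrE ?mulr_gt0 ?exprn_gt0 //.
  rewrite (exprD _ 2 2); apply: ler_pM.
  - by rewrite exprn_ge0 // ltW.
  - by rewrite mulr_ge0 // ltW.
  - by apply: lerXn2r; rewrite ?nnegrE ?ltW //; lra.
  - by rewrite expr2 ler_pM2r //; lra.
have half : \sum_(n < K) G n <= 9 * energy h.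
  have : \sum_(n < K) G n <= \sum_(n < N + K) G n.
    rewrite addnC big_split_ord /= lerDl; exact: sumr_ge0.
  move=> /le_trans; apply; apply: le_trans (tail K) _.
  have : (N%:R ^+ 2)^-1 * (N%:R^-1 - (N + K)%:R^-1) <= (N%:R ^+ 3)^-1 :> R.
    rewrite [in leRHS]exprSr [in leRHS]invfM ler_wpM2l ?invr_ge0 ?exprn_ge0 ?(ltW NR) //.
    by rewrite lerBlDr lerDl invr_ge0.
  have : (N%:R ^+ 3)^-1 <= 8 * energy h.
    rewrite -div1r ler_pdivrMr ?exprn_gt0 // /energy -/s -ss.
    have -> : 8 * (s ^+ 2 * s) * N%:R ^+ 3 = (2 * (N%:R * s)) ^+ 3 by ring.
    by rewrite exprn_ege1 // ltW.
  have : N%:R * h ^+ 2 <= energy h.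
    rewrite /energy -/s -ss.
    have -> : N%:R * (s ^+ 2) ^+ 2 = (s ^+ 2 * s) * (N%:R * s) by ring.
    by rewrite ler_piMr // mulr_ge0 // ?exprn_ge0 // ltW.
  by lra.
rewrite sum_symmetric increment_sqr0 xyh.
under eq_bigr do rewrite increment_sqrN -mulr2n.
rewrite sumrMnl.
have : h ^+ 2 <= energy h.
  rewrite /energy -/s expr2 ler_wpM2l ?(ltW h0) // -[leLHS]ss expr2.
  by rewrite ler_piMr // ltW.
have := half; rewrite /G mulr2n; lra.
Qed.

Lemma ler_sum_window (F : nat -> R) (a b c d : nat) : (forall n, 0 <= F n) ->
  (c <= a)%N -> (b <= d)%N ->
  \sum_(a <= n < b) F n <= \sum_(c <= n < d) F n.
Proof.
move=> F0 ca bd; have [ba|ab] := leqP b a.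
  by rewrite big_geq //; exact: sumr_ge0.
rewrite (big_cat_nat ca) /=; last by rewrite (leq_trans _ bd) // ltnW.
rewrite (big_cat_nat (ltnW ab) bd) /= addrCA lerDl.
by rewrite addr_ge0 // sumr_ge0.
Qed.

(** For [k ~ h^(-1/2)], which is at most [M], the window from [2 M] to [3 M] and its two shifts by
    [k] stay between [M] and [4 M]. Hence [3 W >= M / 512], and [3 * 512 <= 2^11]. *)
Lemma sine_energy h (M : nat) : 0 < h <= 64^-1 -> (0 < M)%N -> 1 <= M%:R ^+ 2 * h ->
  M%:R / 2 ^+ 11 <= \sum_(M <= n < 4 * M) weyl_sqr h n.
Proof.
move=> /andP[h0 h1] M0 Mh.
have p2 := @pi_ge2 R; have p4 : pi <= 4 :> R.
  by have := @pihalf_lt2 R; lra.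
have pp1 : 4 <= pi ^+ 2 :> R by nra.
have pp2 : pi ^+ 2 <= 16 :> R by nra.
(* The upper bound is where [h <= 1 / 64] is used, together with [pi <= 4]. *)
have a01 : 0 < 4 * pi ^+ 2 * h <= 1 by apply/andP; split; nra.
have [k [k0 k1 k2]] := exists_sqrt_scale a01.
have kM : (k <= M)%N.
  rewrite -(ler_nat R) -(@ler_pXn2r _ 2) ?nnegrE // -(ler_pM2r h0).
  apply: le_trans Mh; apply: le_trans k1.
  have -> : 4 * pi ^+ 2 * h * k%:R ^+ 2 = (4 * pi ^+ 2) * (k%:R ^+ 2 * h) by ring.
  rewrite ler_peMl //; last by lra.
  by rewrite mulr_ge0 ?exprn_ge0 // ltW.
have kk : 4^-1 <= 4 * pi ^+ 2 * k%:R ^+ 2 * h <= 1.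
  have e : 4 * pi ^+ 2 * k%:R ^+ 2 * h = 4 * pi ^+ 2 * h * k%:R ^+ 2 by rewrite mulrAC.
  by rewrite e k1 andbT; lra.
have s0 n : 0 <= weyl_sqr h n by exact: sqr_ge0.
set W := \sum_(M <= n < 4 * M) _.
have : M%:R / 512 <= \sum_(2 * M <= n < 3 * M)
    (weyl_sqr h (n - k) + weyl_sqr h n + weyl_sqr h (n + k)).
  have -> : M%:R / 512 = \sum_(2 * M <= n < 3 * M) (512^-1 : R).
    by rewrite sumr_const_nat -mulnBl mul1n mulr_natl.
  by apply: ler_sum_nat => n nM; apply: (weyl_triple kk); nat_lia.
rewrite !big_split /=.
have i1 : \sum_(2 * M <= n < 3 * M) weyl_sqr h n <= W.
  by apply: ler_sum_window => //; nat_lia.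
have i2 : \sum_(2 * M <= n < 3 * M) weyl_sqr h (n + k) <= W.
  have := big_addn (2 * M) (3 * M + k) k xpredT (weyl_sqr h).
  rewrite addnK => <-; by apply: ler_sum_window => //; nat_lia.
have i3 : \sum_(2 * M <= n < 3 * M) weyl_sqr h (n - k) <= W.
  have := big_addn (2 * M - k) (3 * M) k xpredT (fun n => weyl_sqr h (n - k)).
  rewrite subnK; last by nat_lia.
  move=> ->; under eq_bigr do rewrite addnK.
  by apply: ler_sum_window => //; nat_lia.
rewrite (_ : 2 ^+ 11 = 2048 :> R); last by ring.
have := ler0n R M; lra.
Qed.

(** [2^37 = 2^11 * 2^18 * 16 * 16]: from [sine_energy], from [4 pi^4 n^4 <= 2^18 M^4] for [n < 4 M],
    from the 16 of the characteristic function, and from [M^4 <= 16 m]. *)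
Definition damping_constant : R := (2 ^+ 37)^-1.

Lemma damping_constant_bounds : 0 < damping_constant <= 1.
Proof.
by rewrite invr_gt0 exprn_gt0 //= invf_le1 ?exprn_gt0 // exprn_ege1 // ler1n.
Qed.

(** Damping needs vectors that are short at the frequency [sqrt m] but carry enough energy together.
    If [m h^2 <= 1], all [n] up to order [h^(-1/2)] qualify, with energy of order [m h^(3/2)].
    Otherwise [n] of order [m^(1/4)] qualify, since [m n^-4 <= 1], with energy of order [M]. *)
Lemma increments_damped h (Q : nat) : 0 < h <= 64^-1 -> exists K0 : nat,
  forall (K : nat) x y, (K0 <= K)%N -> x - y = h ->
  forall m : nat, (0 < m <= 2 * Q ^ 2)%N -> exists S : {set 'I_K.*2.+1},
     (forall k, k \in S -> m%:R * increment_sqr x y (k%:Z - K%:Z) <= 1) /\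
     (damping_constant * (energy h * m%:R) <=
        m%:R * (\sum_(k in S) increment_sqr x y (k%:Z - K%:Z)) / 16 \/
      exists2 M : nat, (m <= M ^ 4)%N &
        damping_constant * M%:R <=
        m%:R * (\sum_(k in S) increment_sqr x y (k%:Z - K%:Z)) / 16).
Proof.
move=> h01; have [h0 h1] := andP h01.
(* 32 bounds [2 pi^2], so that the angles [2 pi^2 n^2 h] are at most 1 for [n <= N]. *)
have h2 : 0 < 32 * h <= 1 by apply/andP; split; lra.
have p2 := @pi_ge2 R; have p0 := @pi_gt0 R; have p4 : pi <= 4 :> R.
  by have := @pihalf_lt2 R; lra.
have [N [N0 N1 N2]] := exists_sqrt_scale h2.
(* Room for the window below [4 M]: [4 M <= 4 M^4 <= 64 m <= 128 Q^2]. *)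
exists (N + 128 * Q ^ 2)%N => K x y K0 xyh m /andP[m0 mQ].
have mR : 0 < m%:R :> R by rewrite ltr0n.
have [mh|mh] := leP (m%:R * h ^+ 2) 1.
  exists [set k : 'I_K.*2.+1 | (1 + K <= k < N.+1 + K)%N]%SET; split=> [k|].
    rewrite finset.inE => _; apply: le_trans mh; rewrite ler_pM2l //.
    by rewrite -xyh increment_sqr_lip.
  left; rewrite (sum_window (increment_sqr x y)); last by nat_lia.
  have : \sum_(1 <= n < N.+1) (h ^+ 2 / 4) <= \sum_(1 <= n < N.+1) increment_sqr x y n%:Z.
    apply: ler_sum_nat => n /andP[n0 nN]; rewrite increment_sqrE ?xyh; last by nat_lia.
    have nR : 0 < n%:R :> R by rewrite ltr0n.
    have nN' : n%:R <= N%:R :> R by rewrite ler_nat.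
    set z := 2 * pi ^+ 2 * n%:~R ^+ 2 * h.
    have z0 : 0 <= z <= 1.
      have zE : z = 2 * pi ^+ 2 * (h * n%:R ^+ 2) by rewrite /z -pmulrn; ring.
      have a1 : 0 <= h * n%:R ^+ 2 by rewrite mulr_ge0 ?exprn_ge0 // ltW.
      have a2 : h * n%:R ^+ 2 <= h * N%:R ^+ 2.
        by rewrite ler_pM2l // lerXn2r ?nnegrE // ltW.
      have a3 : pi ^+ 2 <= 16 :> R by nra.
      have a4 : 0 <= pi ^+ 2 :> R by exact: sqr_ge0.
      rewrite zE; apply/andP; split; first by apply: mulr_ge0 a1; apply: mulr_ge0 a4.
      by apply: le_trans N1; nra.
    have sz : (z / 2) ^+ 2 <= sin z ^+ 2.
      apply: lerXn2r; rewrite ?nnegrE; last exact: sin_ge_half.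
        by case/andP: z0 => ? _; lra.
      by apply: le_trans (sin_ge_half z0); case/andP: z0 => ? _; lra.
    have d0 : 0 < 4 * pi ^+ 4 * n%:~R ^+ 4 :> R.
      by rewrite -pmulrn !mulr_gt0 // exprn_gt0.
    rewrite ler_pdivlMr //; apply: le_trans sz.
    rewrite /z -pmulrn le_eqVlt; apply/orP; left; apply/eqP.
    by move: (@pi R) => p; field.
  rewrite sumr_const_nat subSS subn0 => hS.
  apply: (@le_trans _ _ (m%:R * (h ^+ 2 / 4 *+ N) / 16)); last first.
    by rewrite ler_pM2r ?invr_gt0 // ler_pM2l.
  pose s := Num.sqrt h; have s0 : 0 < s by rewrite sqrtr_gt0.
  have ss : s ^+ 2 = h by rewrite sqr_sqrtr // ltW.
  have sN : 16^-1 <= s * N%:R.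
    rewrite -(@ler_pXn2r _ 2) ?nnegrE ?mulr_ge0 ?(ltW s0) // exprMn ss.
    have e : 4 * (32 * h) * N%:R ^+ 2 = 128 * (h * N%:R ^+ 2) by ring.
    by move: N2; rewrite e expr2; lra.
  have -> : m%:R * (h ^+ 2 / 4 *+ N) / 16 = (m%:R * (h * s)) * (s * N%:R) / 64.
    by rewrite -mulr_natr -ss; field.
  rewrite /energy -/s.
  have w0 : 0 <= m%:R * (h * s) by rewrite !mulr_ge0 // ltW.
  have e1 : damping_constant <= 16^-1 * 64^-1.
    have -> : 16^-1 * 64^-1 = (2 ^+ 10)^-1 :> R by field.
    by rewrite lef_pV2 ?posrE ?exprn_gt0 // ler_weXn2l // ler1n.
  move: damping_constant e1 => e e1.
  have -> : e * (h * s * m%:R) = m%:R * (h * s) * e by ring.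
  rewrite -[leRHS]mulrA; apply: ler_wpM2l => //; apply: le_trans e1 _.
  by rewrite ler_pM2r // invr_gt0.
have [M [M0 M1 M2]] := fourth_root_scale m0.
have MR : 0 < M%:R :> R by rewrite ltr0n.
have M1R : m%:R <= M%:R ^+ 4 :> R by rewrite -natrX ler_nat.
have M2R : M%:R ^+ 4 <= 16 * m%:R :> R by rewrite -natrX -natrM ler_nat.
have MK : (4 * M <= 128 * Q ^ 2)%N.
  have : (M <= M ^ 4)%N by rewrite -[X in (X <= _)%N]expn1 leq_pexp2l.
  by nat_lia.
have Mh : 1 <= M%:R ^+ 2 * h.
  rewrite -(@expr_ge1 _ 2) ?mulr_ge0 ?exprn_ge0 ?(ltW h0) // exprMn -exprM.
  apply: ltW; apply: lt_le_trans mh _; rewrite ler_pM2r // exprn_gt0 //.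
exists [set k : 'I_K.*2.+1 | (M + K <= k < 4 * M + K)%N]%SET; split=> [k|].
  rewrite finset.inE => /andP[k1 k2].
  set n := k%:Z - K%:Z; have [n' nE Mn] : exists2 n' : nat, n = n'%:Z & (M <= n')%N.
    by exists (k - K)%N; rewrite /n; nat_lia.
  have n0 : n != 0 by rewrite nE; nat_lia.
  apply: (@le_trans _ _ (m%:R * (n%:~R ^+ 4)^-1)).
    by rewrite ler_pM2l // increment_sqr_quartic.
  have nM : M%:R <= n'%:R :> R by rewrite ler_nat.
  rewrite nE -pmulrn ler_pdivrMr ?mul1r; last by rewrite exprn_gt0 // (lt_le_trans MR).
  by apply: le_trans M1R _; apply: lerXn2r; rewrite ?nnegrE.
right; exists M => //; rewrite (sum_window (increment_sqr x y)); last by nat_lia.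
have hS : \sum_(M <= n < 4 * M) (weyl_sqr h n / (2 ^+ 18 * M%:R ^+ 4)) <=
   \sum_(M <= n < 4 * M) increment_sqr x y n%:Z.
  apply: ler_sum_nat => n /andP[n1 n2]; rewrite increment_sqrE ?xyh; last by nat_lia.
  rewrite /weyl_sqr -pmulrn ler_wpM2l ?sqr_ge0 //.
  have nR : 0 < n%:R :> R by rewrite ltr0n; nat_lia.
  rewrite lef_pV2 ?posrE ?mulr_gt0 ?exprn_gt0 //.
  have -> : 2 ^+ 18 * M%:R ^+ 4 = 4 * 4 ^+ 4 * (4 * M%:R) ^+ 4 :> R by ring.
  apply: ler_pM; rewrite ?mulr_ge0 ?exprn_ge0 ?(ltW p0) ?(ltW nR) //.
    by rewrite ler_pM2l //; apply: lerXn2r; rewrite ?nnegrE // ltW.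
  apply: lerXn2r; rewrite ?nnegrE ?(ltW nR) //.
  by rewrite -natrM ler_nat ltnW.
apply: (@le_trans _ _ (m%:R * (M%:R / 2 ^+ 11 / (2 ^+ 18 * M%:R ^+ 4)) / 16)); last first.
  rewrite ler_pM2r ?invr_gt0 // ler_pM2l //; apply: le_trans hS.
  rewrite -mulr_suml ler_pM2r ?invr_gt0 ?mulr_gt0 ?exprn_gt0 //.
  exact: sine_energy.
have -> : m%:R * (M%:R / 2 ^+ 11 / (2 ^+ 18 * M%:R ^+ 4)) / 16 =
    damping_constant * M%:R * (16 * m%:R / M%:R ^+ 4).
  by rewrite /damping_constant; field; rewrite gt_eqF.
rewrite ler_peMr //; last by rewrite ler_pdivlMr ?mul1r // exprn_gt0.
by rewrite mulr_ge0 ?invr_ge0 ?exprn_ge0 // ltW.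
Qed.

End RiemannIncrements.

(** * Uniform convergence of the partial sums and continuity of the limit *)

Section RiemannLimit.
Context {R : realType}.
Implicit Types (x y t : R) (theta : int -> R).

(** [u N - C / N] increases and [u N + C / N] decreases, so the supremum of the former is the limit,
    with an explicit rate. *)
Lemma telescoping_limit (u : nat -> R) (C : R) : 0 <= C ->
  (forall N, (0 < N)%N -> `|u N.+1 - u N| <= C / (N%:R * N.+1%:R)) ->
  exists l, forall N, (0 < N)%N -> `|u N - l| <= C / N%:R.
Proof.
move=> C0 uC.
have step N : (0 < N)%N -> C / (N%:R * N.+1%:R) = C / N%:R - C / N.+1%:R.
  move=> N0; have NR : N%:R != 0 :> R by rewrite pnatr_eq0 -lt0n.
  by rewrite -natr1; field; rewrite NR natr1 pnatr_eq0.
pose v N := u N.+1 - C / N.+1%:R; pose w N := u N.+1 + C / N.+1%:R.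
have vinc N d : v N <= v (N + d)%N.
  elim: d => [|d IH]; first by rewrite addn0.
  apply: le_trans IH _; rewrite addnS.
  have := uC (N + d).+1 isT; rewrite step // ler_norml.
  by set a := C / _; set b := C / _ => /andP[? _]; rewrite /v -/a -/b; lra.
have wdec N d : w (N + d)%N <= w N.
  elim: d => [|d IH]; first by rewrite addn0.
  apply: le_trans IH; rewrite addnS.
  have := uC (N + d).+1 isT; rewrite step // ler_norml.
  by set a := C / _; set b := C / _ => /andP[_ ?]; rewrite /w -/a -/b; lra.
have vw N M : v N <= w M.
  apply: (le_trans (vinc N M)); apply: (@le_trans _ _ (w (N + M)%N)); last first.
    by rewrite addnC; exact: wdec.
  have : 0 <= C / (N + M).+1%:R by rewrite divr_ge0.
  by rewrite /v /w; set a := C / _; lra.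
exists (sup (range v)) => -[//|N] _.
have hs : has_sup (range v).
  by split; [exists (v 0%N); exists 0%N|exists (w 0%N) => _ [n _ <-]].
have h1 : v N <= sup (range v) by apply: sup_upper_bound => //; exists N.
have h2 : sup (range v) <= w N.
  by apply: ge_sup => //; [exact: hs.1|move=> _ [n _ <-]].
move: h1 h2; rewrite /v /w ler_norml; set a := C / _ => h1 h2.
by apply/andP; split; lra.
Qed.

Lemma wave_bound (c1 c2 z e : R) : 0 <= e -> c1 ^+ 2 + c2 ^+ 2 <= e ^+ 2 ->
  `|wave c1 c2 z| <= 2 * e.
Proof.
move=> e0 ce.
have b c : c ^+ 2 <= e ^+ 2 -> `|c| <= e.
  by move=> h; rewrite -(@ler_pXn2r _ 2) ?nnegrE // real_normK ?num_real.
have h1 : `|c1| <= e by apply: b; have := sqr_ge0 c2; lra.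
have h2 : `|c2| <= e by apply: b; have := sqr_ge0 c1; lra.
have := ler_normB (c1 * cos z) (c2 * sin z); rewrite /wave !normrM.
have := cos_max z; have := sin_max z.
have := normr_ge0 c1; have := normr_ge0 c2.
have := normr_ge0 (cos z); have := normr_ge0 (sin z); nra.
Qed.

Lemma riemann_term_at0 theta n : riemann_term theta 0 n = 0.
Proof.
rewrite /riemann_term; case: ifP => _; first by rewrite mul0r.
by rewrite mulr0 oppr0 expi0 subrr !mul0r.
Qed.

Lemma riemann_termE theta t n : riemann_term theta t n =
  (wave (increment_re t 0 n) (increment_im t 0 n) (2 * pi * theta n) +i*
   wave (increment_im t 0 n) (- increment_re t 0 n) (2 * pi * theta n))%C.
Proof. by rewrite -riemann_term_diff riemann_term_at0 subr0. Qed.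

Lemma riemann_term_bound theta t n : n != 0 ->
  `|complex.Re (riemann_term theta t n)| <= 2 / n%:~R ^+ 2 /\
  `|complex.Im (riemann_term theta t n)| <= 2 / n%:~R ^+ 2.
Proof.
move=> n0; have h := increment_sqr_quartic t 0 n0.
have e : (n%:~R ^+ 4)^-1 = ((n%:~R ^+ 2)^-1) ^+ 2 :> R by rewrite exprVn -exprM.
rewrite e in h; rewrite riemann_termE /=; split; apply: wave_bound => //.
- by rewrite invr_ge0 sqr_ge0.
- by rewrite invr_ge0 sqr_ge0.
- by rewrite sqrrN addrC.
Qed.

Definition riemann_partial theta t (N : nat) : R[i] :=
  \sum_(k < N.*2.+1) riemann_term theta t (k%:Z - N%:Z).

Lemma riemann_partialS theta t N :
  riemann_partial theta t N.+1 - riemann_partial theta t N =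
  riemann_term theta t N.+1%:Z + riemann_term theta t (- N.+1%:Z).
Proof.
by rewrite /riemann_partial !sum_symmetric big_ord_recr /= opprD addrACA subrr add0r addrAC subrr add0r.
Qed.

Lemma riemann_partial_limit theta t : exists l : R[i], forall N, (0 < N)%N ->
  `|complex.Re (riemann_partial theta t N) - complex.Re l| <= 4 / N%:R /\
  `|complex.Im (riemann_partial theta t N) - complex.Im l| <= 4 / N%:R.
Proof.
have key (f : {additive R[i] -> R}) :
   (forall n, n != 0 -> `|f (riemann_term theta t n)| <= 2 / n%:~R ^+ 2) ->
   exists l, forall N, (0 < N)%N -> `|f (riemann_partial theta t N) - l| <= 4 / N%:R.
  move=> fb; apply: (@telescoping_limit (fun N => f (riemann_partial theta t N)) 4) => // N N0.
  rewrite -raddfB riemann_partialS raddfD.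
  apply: (le_trans (ler_normD _ _)).
  have NR : 0 < N%:R :> R by rewrite ltr0n.
  apply: (@le_trans _ _ (2 / N.+1%:R ^+ 2 + 2 / N.+1%:R ^+ 2)).
    apply: lerD; first exact: fb.
    have := fb (- N.+1%:Z) isT; rewrite rmorphN /= sqrrN; exact.
  rewrite -mulrDl (_ : 2 + 2 = 4 :> R); last by ring.
  rewrite ler_pM2l // lef_pV2 ?posrE ?exprn_gt0 ?mulr_gt0 // expr2 ler_pM2r //.
  by rewrite ler_nat.
have [lr lrP] := key (@complex.Re R) (fun n n0 => (riemann_term_bound theta t n0).1).
have [li liP] := key (@complex.Im R) (fun n n0 => (riemann_term_bound theta t n0).2).
by exists (lr +i* li)%C => N N0; split; [exact: lrP|exact: liP].
Qed.

(** The rate is uniform in [theta] and [t]; this permits truncating the series before the phases are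
    discretised. *)
Lemma riemann_phi_partial theta t (N0 : nat) : (0 < N0)%N ->
  `|complex.Re (riemann_partial theta t N0) - complex.Re (riemann_phi theta t)| <= 4 / N0%:R /\
  `|complex.Im (riemann_partial theta t N0) - complex.Im (riemann_phi theta t)| <= 4 / N0%:R.
Proof.
have [l lP] := riemann_partial_limit theta t.
suff -> : riemann_phi theta t = l by exact: lP.
suff h : ((fun N => riemann_partial theta t N : (R[i] : numFieldType)^o) @ \oo --> (l : R[i]^o)).
  exact: (cvg_lim (@norm_hausdorff _ (R[i]^o)) h).
apply/cvgrPdist_le => /= e e0.
have [e' e'0 ee] : exists2 e' : R, 0 < e' & e = (e'%:C)%C.
  by case: e e0 => a b; rewrite ltcE /= => /andP[/eqP -> a0]; exists a.
have [M MP] : exists M : nat, 8 / e' < M%:R.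
  by exists (Num.bound (8 / e')); apply: archi_boundP; rewrite divr_ge0 // ltW.
near=> N.
have Npos : (0 < N)%N by near: N; exists 1%N.
have MN : (M <= N)%N by near: N; exists M.
have [h1 h2] := lP N Npos.
rewrite ee -/(riemann_partial theta t N) distrC normc_def lecR.
have b : 4 / N%:R <= e' / 2.
  rewrite ler_pdivrMr ?ltr0n // -ler_pdivrMl ?divr_gt0 // invf_div.
  apply: (@le_trans _ _ M%:R); last by rewrite ler_nat.
  by apply: ltW; apply: le_lt_trans MP; rewrite le_eqVlt; apply/orP; left; apply/eqP; field; rewrite gt_eqF.
rewrite -(@ler_pXn2r _ 2) ?nnegrE ?sqrtr_ge0 ?(ltW e'0) // sqr_sqrtr ?addr_ge0 ?sqr_ge0 //.
rewrite !raddfB /=.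
have := sqr_ler_norm (le_trans h1 b); have := sqr_ler_norm (le_trans h2 b); nra.
Unshelve. all: by end_near.
Qed.

Lemma riemann_increment theta x y N : (0 < N)%N ->
  `|complex.Re (riemann_phi theta x - riemann_phi theta y) -
     \sum_(k < N.*2.+1) wave (increment_re x y (k%:Z - N%:Z))
        (increment_im x y (k%:Z - N%:Z)) (2 * pi * theta (k%:Z - N%:Z))| <= 8 / N%:R /\
  `|complex.Im (riemann_phi theta x - riemann_phi theta y) -
     \sum_(k < N.*2.+1) wave (increment_im x y (k%:Z - N%:Z))
        (- increment_re x y (k%:Z - N%:Z)) (2 * pi * theta (k%:Z - N%:Z))| <= 8 / N%:R.
Proof.
move=> N0; have [x1 x2] := riemann_phi_partial theta x N0.
have [y1 y2] := riemann_phi_partial theta y N0.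
have d : riemann_partial theta x N - riemann_partial theta y N =
  \sum_(k < N.*2.+1)
    (wave (increment_re x y (k%:Z - N%:Z)) (increment_im x y (k%:Z - N%:Z)) (2 * pi * theta (k%:Z - N%:Z)) +i*
   wave (increment_im x y (k%:Z - N%:Z)) (- increment_re x y (k%:Z - N%:Z)) (2 * pi * theta (k%:Z - N%:Z)))%C.
  by rewrite -sumrB; apply: eq_bigr => k _; rewrite riemann_term_diff.
have e : 8 / N%:R = 4 / N%:R + 4 / N%:R :> R by rewrite -mulrDl; congr (_ / _); ring.
split.
  have := congr1 (@complex.Re R) d; rewrite [in RHS]raddf_sum [in LHS]raddfB /= => <-.
  rewrite raddfB e; move: x1 y1; rewrite !ler_norml.
  by set a := 4 / _ => /andP[? ?] /andP[? ?]; apply/andP; split; lra.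
have := congr1 (@complex.Im R) d; rewrite [in RHS]raddf_sum [in LHS]raddfB /= => <-.
rewrite raddfB e; move: x2 y2; rewrite !ler_norml.
by set a := 4 / _ => /andP[? ?] /andP[? ?]; apply/andP; split; lra.
Qed.

Lemma Rcomplex_normE (z : Rcomplex R) :
  `|z| = Num.sqrt (complex.Re z ^+ 2 + complex.Im z ^+ 2).
Proof. by case: z. Qed.

Lemma Rcomplex_Re_le (z : Rcomplex R) : `|complex.Re z| <= `|z|.
Proof.
rewrite Rcomplex_normE -(@ler_pXn2r _ 2) ?nnegrE ?sqrtr_ge0 //.
by rewrite sqr_sqrtr ?addr_ge0 ?sqr_ge0 // real_normK ?num_real // lerDl sqr_ge0.
Qed.

Lemma Rcomplex_Im_le (z : Rcomplex R) : `|complex.Im z| <= `|z|.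
Proof.
rewrite Rcomplex_normE -(@ler_pXn2r _ 2) ?nnegrE ?sqrtr_ge0 //.
by rewrite sqr_sqrtr ?addr_ge0 ?sqr_ge0 // real_normK ?num_real // lerDr sqr_ge0.
Qed.

Lemma Rcomplex_norm_le (z : Rcomplex R) : `|z| <= `|complex.Re z| + `|complex.Im z|.
Proof.
rewrite Rcomplex_normE -(@ler_pXn2r _ 2) ?nnegrE ?sqrtr_ge0 ?addr_ge0 //.
rewrite sqr_sqrtr ?addr_ge0 ?sqr_ge0 // -(real_normK (num_real (complex.Re z))).
rewrite -(real_normK (num_real (complex.Im z))).
have := mulr_ge0 (normr_ge0 (complex.Re z)) (normr_ge0 (complex.Im z)); nra.
Qed.

Lemma riemann_phi_continuous theta x (e : R) : 0 < e -> exists2 d, 0 < d &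
  forall y, `|x - y| <= d -> `|riemann_phi theta x - riemann_phi theta y| <= e.
Proof.
move=> e0; have [M MP] : exists M : nat, 32 / e < M%:R.
  by exists (Num.bound (32 / e)); apply: archi_boundP; rewrite divr_ge0 // ltW.
have M0 : (0 < M)%N by rewrite -(ltr_nat R) (le_lt_trans _ MP) // divr_ge0 // ltW.
have MR : 0 < M%:R :> R by rewrite ltr0n.
have Me : 8 / M%:R <= e / 4.
  rewrite ler_pdivrMr // -ler_pdivrMl ?divr_gt0 // invf_div.
  by apply: ltW; apply: le_lt_trans MP; rewrite le_eqVlt; apply/orP; left; apply/eqP; field; rewrite gt_eqF.
exists (e / (8 * M.*2.+1%:R)); first by rewrite divr_gt0 // mulr_gt0.
move=> y xy; apply: le_trans (Rcomplex_norm_le _) _.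
have W (F : int -> R) : (forall n, `|F n| <= 2 * `|x - y|) ->
    `|\sum_(k < M.*2.+1) F (k%:Z - M%:Z)| <= e / 4.
  move=> Fb; apply: (le_trans (ler_norm_sum _ _ _)).
  apply: (@le_trans _ _ (\sum_(k < M.*2.+1) (2 * `|x - y|))); first exact: ler_sum.
  have -> : \sum_(k < M.*2.+1) (2 * `|x - y|) = 2 * `|x - y| * M.*2.+1%:R.
    by rewrite sumr_const card_ord mulr_natr.
  apply: (@le_trans _ _ (2 * (e / (8 * M.*2.+1%:R)) * M.*2.+1%:R)).
    by apply: ler_wpM2r => //; apply: ler_wpM2l.
  rewrite le_eqVlt; apply/orP; left; apply/eqP.
  have : M.*2.+1%:R != 0 :> R by rewrite pnatr_eq0.
  by move: (M.*2.+1%:R) => z z0; field.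
have [h1 h2] := riemann_increment theta x y M0.
have w1 := W (fun n => wave (increment_re x y n) (increment_im x y n) (2 * pi * theta n)).
have w2 := W (fun n => wave (increment_im x y n) (- increment_re x y n) (2 * pi * theta n)).
have sq n : increment_sqr x y n <= `|x - y| ^+ 2.
  by rewrite real_normK ?num_real //; exact: increment_sqr_lip.
have {}w1 : `|\sum_(k < M.*2.+1) wave (increment_re x y (k%:Z - M%:Z)) (increment_im x y (k%:Z - M%:Z))
   (2 * pi * theta (k%:Z - M%:Z))| <= e / 4.
  by apply: w1 => n; apply: wave_bound => //; exact: sq.
have {}w2 : `|\sum_(k < M.*2.+1) wave (increment_im x y (k%:Z - M%:Z)) (- increment_re x y (k%:Z - M%:Z))
   (2 * pi * theta (k%:Z - M%:Z))| <= e / 4.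
  by apply: w2 => n; apply: wave_bound => //; rewrite sqrrN addrC; exact: sq.
move: h1 h2 w1 w2 => /=; set a := \sum_(k < _) _; set b := \sum_(k < _) _.
set u := complex.Re _; set v := complex.Im _ => h1 h2 w1 w2.
have := ler_normD (u - a) a; have := ler_normD (v - b) b; rewrite !subrK.
lra.
Qed.

End RiemannLimit.

(** * Outer probability bounds *)

Section OuterProbability.
Context {d : measure_display} {T : measurableType d} {R : realType}.
Variable P : probability T R.

(** An outer probability: bounds through measurable supersets are enough for negligibility and leave
    the measurability of the events themselves open. *)
Definition prob_le (E : set T) (p : R) :=
  exists G, [/\ measurable G, E `<=` G & (P G <= p%:E)%E].

Lemma prob_leS E F p q : E `<=` F -> p <= q -> prob_le F p -> prob_le E q.
Proof.
move=> EF pq [G [mG FG Gp]]; exists G; split => //.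
  exact: subset_trans FG.
by apply: le_trans Gp _; rewrite lee_fin.
Qed.

Lemma prob_leU E F p q : prob_le E p -> prob_le F q -> prob_le (E `|` F) (p + q).
Proof.
move=> [G [mG EG Gp]] [H [mH FH Hq]]; exists (G `|` H); split.
- exact: measurableU.
- exact: setUSS.
- by apply: le_trans (measureU2 _ mG mH) _; rewrite EFinD leeD.
Qed.

Lemma prob_le0 E : P.-negligible E -> prob_le E 0.
Proof. by move=> [G [mG G0 EG]]; exists G; split => //; rewrite G0. Qed.

Lemma prob_le_bigcup (I : finType) (D : pred I) (E : I -> set T) (p : I -> R) :
  (forall i, D i -> prob_le (E i) (p i)) ->
  prob_le [set w | exists2 i, D i & E i w] (\sum_(i | D i) p i).
Proof.
move=> H; have : forall s : seq I,
    prob_le [set w | exists2 i, (i \in s) && D i & E i w] (\sum_(i <- s | D i) p i).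
  elim=> [|i s IH].
    rewrite big_nil; exists set0; split => //; last by rewrite measure0.
    by move=> w [].
  rewrite big_cons; case: ifP => Di.
    apply: prob_leS (prob_leU (H i Di) IH) => //.
    move=> w [j /andP[+ Dj] Ew]; rewrite in_cons => /predU1P[jE|js]; first by left; rewrite -jE.
    by right; exists j => //; rewrite js.
  apply: prob_leS IH => // w [j /andP[]]; rewrite in_cons => /predU1P[->|js Dj Ew].
    by rewrite Di.
  by exists j => //; rewrite js.
move=> /(_ (index_enum I)); apply: prob_leS => // w [i Di Ew].
by exists i; rewrite ?mem_index_enum.
Qed.

End OuterProbability.

(** * Independent uniform phases and grid boxes *)

Section GridProbability.
Context {R : realType} {d : measure_display} {T : measurableType d}.
Variables (P : probability T R) (theta : int -> {RV P >-> R}).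
Hypothesis theta_indep : mutually_independent theta.
Hypothesis theta_unif : forall n : int, uniform01 (theta n).

Definition cell (M j : nat) : set R := `[j%:R / M%:R, j.+1%:R / M%:R[%classic.

Lemma uniform_itv (a b : R) : 0 <= a -> a <= b -> b <= 1 ->
  uniform_prob (@ltr01 R) `[a, b[%classic = (b - a)%:E.
Proof.
move=> a0 ab b1; rewrite /uniform_prob integral_uniform_pdf.
have sub : (`[a, b[%classic : set R) `<=` `[0, 1]%classic.
  by move=> x /=; rewrite !in_itv /= => /andP[? ?]; apply/andP; split; lra.
have -> : `[a, b[%classic `&` `[0, 1]%classic = `[a, b[%classic :> set R by exact/setIidPl.
rewrite (eq_integral (fun=> 1%:E)); last first.
  by move=> x; rewrite inE => /sub /=; rewrite in_itv /= /uniform_pdf => ->; rewrite subr0 invr1.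
rewrite integral_cst //= mul1e lebesgue_measure_itv /= lte_fin.
by move: ab; rewrite le_eqVlt => /predU1P[->|->]; rewrite ?ltxx ?subrr // -EFinD.
Qed.

Lemma prob_cell (M j : nat) n : (j < M)%N ->
  P (theta n @^-1` cell M j) = (M%:R^-1)%:E.
Proof.
move=> jM; have MR : 0 < M%:R :> R by rewrite ltr0n; apply: leq_ltn_trans jM.
rewrite -[LHS]/(distribution P (theta n) (cell M j)) theta_unif; last exact: measurable_itv.
rewrite uniform_itv.
- by rewrite -mulrBl -natr1 addrAC subrr add0r mul1r.
- by rewrite divr_ge0.
- by rewrite ler_pM2r ?invr_gt0 // ler_nat.
- by rewrite ler_pdivrMr // mul1r ler_nat.
Qed.

Lemma unit_interval_ae n : P.-negligible (theta n @^-1` ~` `[0, 1[%classic).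
Proof.
have m1 : measurable (~` `[0, 1[%classic : set R) by apply: measurableC; exact: measurable_itv.
have m2 : measurable (theta n @^-1` ~` `[0, 1[%classic).
  by rewrite -[X in measurable X]setTI; exact: measurable_funP.
apply/negligibleP => //.
have m3 : measurable (theta n @^-1` `[0, 1[%classic).
  by rewrite -[X in measurable X]setTI; apply: measurable_funP => //; exact: measurable_itv.
have e : P (theta n @^-1` `[0, 1[%classic) = 1%E.
  rewrite -[LHS]/(distribution P (theta n) `[0, 1[%classic) theta_unif; last exact: measurable_itv.
  by rewrite uniform_itv // subr0.
by have := probability_setC P m3; rewrite e subee //; exact.
Qed.

Variables (K L : nat).
Hypothesis L0 : (0 < L)%N.
Local Notation I := 'I_K.*2.+1.
Local Notation M := (4 * L)%N.
Local Notation grid := {ffun I -> 'I_M}.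

Definition in_cells (f : grid) (w : T) :=
  forall k : I, cell M (f k) (theta (k%:Z - K%:Z) w).

Lemma prob_in_cells (f : grid) :
  measurable (in_cells f) /\ P (in_cells f) = (#|{: grid}|%:R^-1)%:E.
Proof.
(* Independence asks for a family over all integers; [s] picks out the indices [k - K], where [B] is
   the intended cell. *)
pose B (n : int) : set R := if insub `|(n + K%:Z)%R|%N is Some k then cell M (f k) else setT.
pose s := [seq k%:Z - K%:Z | k : I <- enum I].
have us : uniq s.
  by rewrite map_inj_uniq ?enum_uniq // => i j /= ij; apply: val_inj => /=; lia.
have mB n : measurable (B n) by rewrite /B; case: insubP => // k _ _; exact: measurable_itv.
have BE (k : I) : B (k%:Z - K%:Z) = cell M (f k).
  rewrite /B subrK absz_nat insubT //= => kK; congr (cell M (f _)).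
  exact: val_inj.
have -> : in_cells f = \bigcap_(n in [set` s]) (theta n @^-1` B n).
  apply/seteqP; split => w.
    by move=> wf n /= /mapP[k _ ->]; rewrite /= BE; exact: wf.
  by move=> wB k; rewrite -BE; apply: wB => /=; apply/mapP; exists k; rewrite ?mem_enum.
split.
  apply: fin_bigcap_measurable; first exact: finite_seq.
  move=> n _.
  by rewrite -[X in measurable X]setTI; exact: measurable_funP.
rewrite theta_indep // big_map big_enum /=.
under eq_bigr do rewrite BE prob_cell //.
rewrite prodEFin; congr EFin.
by rewrite prodr_const card_ffun !card_ord natrX exprVn.
Qed.

(** All boxes are equally likely, so counting boxes bounds the probability. Phases outside the
    half-open interval [[0, 1[] belong to no box and form a null event. *)
Lemma grid_prob (E : set T) (D : pred grid) :
  (forall w f, E w -> in_cells f w -> D f) ->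
  prob_le P E (#|D|%:R / #|{: grid}|%:R).
Proof.
move=> ED.
have H1 : prob_le P [set w | exists2 f, D f & in_cells f w] (#|D|%:R / #|{: grid}|%:R).
  have b (f : grid) : D f -> prob_le P (in_cells f) (#|{: grid}|%:R^-1).
    by move=> _; have [mf Pf] := prob_in_cells f; exists (in_cells f); split => //; move: Pf => ->.
  apply: prob_leS (prob_le_bigcup b) => //.
  by rewrite (eq_bigl (fun f => f \in D)) // sumr_const mulr_natl.
have H2 : prob_le P [set w | exists2 k : I, true & (theta (k%:Z - K%:Z) @^-1` ~` `[0, 1[%classic) w] 0.
  have b (k : I) : true -> prob_le P (theta (k%:Z - K%:Z) @^-1` ~` `[0, 1[%classic) 0.
    by move=> _; apply: prob_le0; exact: unit_interval_ae.
  by have := @prob_le_bigcup _ _ _ P _ xpredT _ _ b; rewrite sumr_const mul0rn.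
have := prob_leU H1 H2; rewrite addr0; apply: prob_leS => // w Ew.
have [H|/existsNP[k nk]] := pselect (forall k : I, `[0, 1[%classic (theta (k%:Z - K%:Z) w)).
  left; have MR : 0 < M%:R :> R by rewrite ltr0n; lia.
  have /choice[f fP] (k : I) : exists j : 'I_M, cell M j (theta (k%:Z - K%:Z) w).
    have := H k; rewrite /= in_itv /= => /andP[t0 t1].
    have /truncn_itv /andP[j1 j2] : 0 <= theta (k%:Z - K%:Z) w * M%:R by rewrite mulr_ge0 // ltW.
    set j := Num.truncn _ in j1 j2.
    have jM : (j < M)%N.
      by rewrite -(ltr_nat R); apply: le_lt_trans j1 _; rewrite -[ltRHS]mul1r ltr_pM2r.
    by exists (Ordinal jM); rewrite /cell /= in_itv /= ler_pdivrMr // ltr_pdivlMr // j1.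
  exists [ffun k => f k]; last by move=> k; rewrite ffunE; exact: fP.
  by apply: ED Ew _ => k; rewrite ffunE; exact: fP.
by right; exists k.
Qed.



End GridProbability.

(** * Tail and small-ball probabilities of an increment *)

Lemma card_predU_le (T : finType) (p q : pred T) :
  (#|[pred x | p x || q x]| <= #|[pred x | p x]| + #|[pred x | q x]|)%N.
Proof.
rewrite -cardUI; apply: leq_trans (leq_addr _ _); apply: subset_leq_card.
by apply/fintype.subsetP => x; rewrite !inE.
Qed.

Section IncrementProbability.
Context {R : realType} {d : measure_display} {T : measurableType d}.
Variables (P : probability T R) (theta : int -> {RV P >-> R}).
Hypothesis theta_indep : mutually_independent theta.
Hypothesis theta_unif : forall n : int, uniform01 (theta n).

Let phi w t := riemann_phi (fun n => theta n w) t.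

Lemma wave_lip (c1 c2 x y e : R) : 0 <= e -> c1 ^+ 2 + c2 ^+ 2 <= e ^+ 2 ->
  `|wave c1 c2 x - wave c1 c2 y| <= 2 * e * `|x - y|.
Proof.
move=> e0 ce.
have b c : c ^+ 2 <= e ^+ 2 -> `|c| <= e.
  by move=> h; rewrite -(@ler_pXn2r _ 2) ?nnegrE // real_normK ?num_real.
have h1 : `|c1| <= e by apply: b; have := sqr_ge0 c2; lra.
have h2 : `|c2| <= e by apply: b; have := sqr_ge0 c1; lra.
have -> : wave c1 c2 x - wave c1 c2 y = c1 * (cos x - cos y) - c2 * (sin x - sin y).
  by rewrite /wave; ring.
have := ler_normB (c1 * (cos x - cos y)) (c2 * (sin x - sin y)); rewrite !normrM.
have g1 : `|c1| * `|cos x - cos y| <= e * `|x - y| by apply: ler_pM => //; exact: ler_dist_cos.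
have g2 : `|c2| * `|sin x - sin y| <= e * `|x - y| by apply: ler_pM => //; exact: ler_dist_sin.
lra.
Qed.

(** [K] brings the tail of the series below [e / 2]; then [L] makes the cells so small that moving
    [2 K + 1] phases changes the truncated sum by at most [e / 2]. The bound [K0] leaves room for
    the windows of [increments_damped]. *)
Lemma grid_increment (x y e : R) (K0 : nat) : 0 < e -> exists K L : nat,
  [/\ (K0 <= K)%N, (0 < L)%N &
  forall w (f : {ffun 'I_K.*2.+1 -> 'I_(4 * L)}), in_cells theta f w ->
    let c1 := fun k : 'I_K.*2.+1 => increment_re x y (k%:Z - K%:Z) in
    let c2 := fun k : 'I_K.*2.+1 => increment_im x y (k%:Z - K%:Z) in
    `|complex.Re (phi w x - phi w y) - linear_wave c1 c2 f| <= e /\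
    `|complex.Im (phi w x - phi w y) - linear_wave c2 (fun k => - c1 k) f| <= e].
Proof.
move=> e0.
have [K1 K1P] : exists M : nat, 16 / e < M%:R.
  by exists (Num.bound (16 / e)); apply: archi_boundP; rewrite divr_ge0 // ltW.
have pi0 := @pi_gt0 R.
pose K := (K0 + K1)%N.
have K10 : (0 < K1)%N by rewrite -(ltr_nat R) (le_lt_trans _ K1P) // divr_ge0 // ltW.
have Kpos : (0 < K)%N by rewrite /K; lia.
have KR : 0 < K%:R :> R by rewrite ltr0n.
have Ke : 8 / K%:R <= e / 2.
  rewrite ler_pdivrMr // -ler_pdivrMl ?divr_gt0 // invf_div.
  apply: (@le_trans _ _ K1%:R); last by rewrite ler_nat /K leq_addl.
  by apply: ltW; apply: le_lt_trans K1P; rewrite le_eqVlt; apply/orP; left; apply/eqP; field; rewrite gt_eqF.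
pose B : R := 2 * `|x - y| * (2 * pi) * K.*2.+1%:R.
have B0 : 0 <= B by rewrite !mulr_ge0 // ltW.
have [L LP] : exists M : nat, B * 2 / e < M%:R.
  by exists (Num.bound (B * 2 / e)); apply: archi_boundP; rewrite divr_ge0 ?mulr_ge0 // ltW.
have Lpos : (0 < L)%N by rewrite -(ltr_nat R) (le_lt_trans _ LP) // divr_ge0 ?mulr_ge0 // ltW.
have LR : 0 < L%:R :> R by rewrite ltr0n.
have Le : B / (4 * L)%N%:R <= e / 2.
  apply: (@le_trans _ _ (B / L%:R)).
    by rewrite ler_wpM2l // lef_pV2 ?posrE ?ltr0n ?muln_gt0 // ler_nat; lia.
  rewrite ler_pdivrMr //; move: LP; rewrite ltr_pdivrMr //; lra.
exists K, L; split => //; first by rewrite /K leq_addr.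
move=> w f wf /=.
have close (k : 'I_K.*2.+1) :
    `|2 * pi * theta (k%:Z - K%:Z) w - grid_phase L (f k)| <= 2 * pi / (4 * L)%N%:R.
  have := wf k; rewrite /cell /= in_itv /= => /andP[w1 w2].
  rewrite /grid_phase -mulrBr normrM ger0_norm ?mulr_ge0 ?(ltW pi0) //.
  rewrite ler_wpM2l ?mulr_ge0 ?(ltW pi0) //.
  move: w2; rewrite -natr1 mulrDl mul1r; set a := _ / _ in w1 *; set b := _^-1.
  by rewrite ler_norml => w2; apply/andP; split; have : 0 <= b; rewrite ?invr_ge0 //; lra.
have err (F1 F2 : int -> R) : (forall n, F1 n ^+ 2 + F2 n ^+ 2 <= `|x - y| ^+ 2) ->
    `|\sum_(k < K.*2.+1) wave (F1 (k%:Z - K%:Z)) (F2 (k%:Z - K%:Z)) (2 * pi * theta (k%:Z - K%:Z) w)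
    - linear_wave (fun k : 'I_K.*2.+1 => F1 (k%:Z - K%:Z)) (fun k => F2 (k%:Z - K%:Z)) f| <= e / 2.
  move=> F12; apply: le_trans Le; rewrite /linear_wave -sumrB.
  apply: (le_trans (ler_norm_sum _ _ _)).
  have -> : B / (4 * L)%N%:R = \sum_(k < K.*2.+1) (2 * `|x - y| * (2 * pi / (4 * L)%N%:R)).
    by rewrite sumr_const card_ord -mulr_natr /B; ring.
  apply: ler_sum => k _; apply: le_trans (wave_lip _ _ (normr_ge0 _) (F12 _)) _.
  by rewrite ler_wpM2l ?mulr_ge0 //; exact: close.
have sq n : increment_sqr x y n <= `|x - y| ^+ 2.
  by rewrite real_normK ?num_real //; exact: increment_sqr_lip.
have [h1 h2] := riemann_increment (fun n => theta n w) x y Kpos.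
have e1 := err _ _ sq.
have e2 : `|\sum_(k < K.*2.+1) wave (increment_im x y (k%:Z - K%:Z)) (- increment_re x y (k%:Z - K%:Z))
      (2 * pi * theta (k%:Z - K%:Z) w)
    - linear_wave (fun k : 'I_K.*2.+1 => increment_im x y (k%:Z - K%:Z))
        (fun k => - increment_re x y (k%:Z - K%:Z)) f| <= e / 2.
  by apply: (err (increment_im x y) (fun n => - increment_re x y n)) => n; rewrite sqrrN addrC; exact: sq.
move: h1 h2 e1 e2; rewrite -/(phi w x) -/(phi w y) !ler_norml.
set a := 8 / _ in Ke *.
by move=> /andP[? ?] /andP[? ?] /andP[? ?] /andP[? ?]; split; apply/andP; split; lra.
Qed.

(** Chernoff with [lambda = energy^(-1/2)], which makes the quadratic term at most 19. A modulus
    above [u], with two discretisation errors [u / 4], forces one of four signed coordinates above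
    [u / 4]. *)
Lemma increment_tail (x y h u : R) : 0 < h <= 1 -> `|x - y| = h -> 0 < u ->
  prob_le P [set w | u < `|phi w x - phi w y|]
    (4 * expR (19 - u / (4 * Num.sqrt (energy h)))).
Proof.
move=> h01 xyh u0; have [h0 h1] := andP h01.
have xy2 : (x - y) ^+ 2 = h ^+ 2 by rewrite -xyh real_normK ?num_real.
have E0 := energy_gt0 h0.
have sE0 : 0 < Num.sqrt (energy h) by rewrite sqrtr_gt0.
have u4 : 0 < u / 4 by rewrite divr_gt0.
have [K [L [_ L0 HK]]] := grid_increment x y 0 u4.
set c1 := fun k : 'I_K.*2.+1 => increment_re x y (k%:Z - K%:Z).
set c2 := fun k : 'I_K.*2.+1 => increment_im x y (k%:Z - K%:Z).
have one (a1 a2 : 'I_K.*2.+1 -> R) :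
    (forall k, a1 k ^+ 2 + a2 k ^+ 2 = increment_sqr x y (k%:Z - K%:Z)) ->
    #|[pred f : {ffun 'I_K.*2.+1 -> 'I_(4 * L)} | u / 4 < linear_wave a1 a2 f]|%:R <=
    #|{: {ffun 'I_K.*2.+1 -> 'I_(4 * L)}}|%:R * expR (19 - u / (4 * Num.sqrt (energy h))).
  move=> a12; pose la := (Num.sqrt (energy h))^-1.
  have la0 : 0 <= la by rewrite invr_ge0 ltW.
  have la2 : la ^+ 2 = (energy h)^-1 by rewrite exprVn sqr_sqrtr // ltW.
  have s1 : Num.sqrt h <= 1 by rewrite -sqrtr1 ler_wsqrtr.
  have lc k : la ^+ 2 * (a1 k ^+ 2 + a2 k ^+ 2) <= 1.
    rewrite a12 la2 mulrC ler_pdivrMr // mul1r (le_trans (increment_sqr_lip _ _ _)) // xy2.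
    have sh : Num.sqrt h ^+ 2 = h by rewrite sqr_sqrtr // ltW.
    rewrite /energy expr2 ler_pM2l // -{1}sh expr2 ler_piMr //.
  apply: (le_trans (linear_wave_tail L0 (u / 4) la0 lc)).
  rewrite ler_wpM2l // ler_expR; apply: lerD.
    rewrite la2 mulrC ler_pdivrMr //; under eq_bigr do rewrite a12.
    exact: total_energy.
  rewrite lerN2 /la le_eqVlt; apply/orP; left; apply/eqP.
  by field; rewrite gt_eqF.
pose D := [pred f : {ffun 'I_K.*2.+1 -> 'I_(4 * L)} |
  [|| u / 4 < linear_wave c1 c2 f, u / 4 < linear_wave (fun k => - c1 k) (fun k => - c2 k) f,
      u / 4 < linear_wave c2 (fun k => - c1 k) f |
      u / 4 < linear_wave (fun k => - c2 k) c1 f]].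
have neg a1 a2 (f : {ffun 'I_K.*2.+1 -> 'I_(4 * L)}) :
    linear_wave (fun k => - a1 k) (fun k => - a2 k) f = - linear_wave a1 a2 f.
  by rewrite /linear_wave -sumrN; apply: eq_bigr => k _; rewrite /wave; ring.
have card0 : 0 < #|{: {ffun 'I_K.*2.+1 -> 'I_(4 * L)}}|%:R :> R.
  by rewrite ltr0n card_ffun !card_ord expn_gt0; apply/orP; left; lia.
apply: (@prob_leS _ _ _ P _ [set w | u < `|phi w x - phi w y|] (#|D|%:R / #|{: {ffun 'I_K.*2.+1 -> 'I_(4 * L)}}|%:R)) => //; last first.
  apply: (grid_prob theta_indep theta_unif L0) => w f uw wf; rewrite /= in uw.
  have [h2 h3] := HK w f wf.
  have h4 := lt_le_trans uw (Rcomplex_norm_le (phi w x - phi w y)).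
  rewrite /D /= neg.
  have -> : linear_wave (fun k => - c2 k) c1 f = - linear_wave c2 (fun k => - c1 k) f.
    by rewrite -neg; congr (linear_wave _ _ f); apply/funext => k; rewrite opprK.
  rewrite -/c1 -/c2 in h2 h3; move: h2 h3 h4 {uw}; rewrite !ler_norml.
  set p := linear_wave _ _ _; set q := linear_wave _ _ _.
  set re := complex.Re _; set im := complex.Im _.
  move=> /andP[h2 h2'] /andP[h3 h3'].
  case: (ler0P re) => hr; case: (ler0P im) => hi h5; apply/or4P.
  - by have [?|?] := ltP (u / 4) (- p); [apply: Or42|apply: Or44; lra].
  - by have [?|?] := ltP (u / 4) (- p); [apply: Or42|apply: Or43; lra].
  - by have [?|?] := ltP (u / 4) p; [apply: Or41|apply: Or44; lra].
  - by have [?|?] := ltP (u / 4) p; [apply: Or41|apply: Or43; lra].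
rewrite ler_pdivrMr //.
have o1 := one c1 c2 (fun k => erefl).
have o2 := one (fun k => - c1 k) (fun k => - c2 k).
have o3 := one c2 (fun k => - c1 k).
have o4 := one (fun k => - c2 k) c1.
apply: (@le_trans _ _ (#|[pred f | (u / 4 < linear_wave c1 c2 f)%R]| +
  (#|[pred f | (u / 4 < linear_wave (fun k => - c1 k) (fun k => - c2 k) f)%R]| +
  (#|[pred f | (u / 4 < linear_wave c2 (fun k => - c1 k) f)%R]| +
   #|[pred f | (u / 4 < linear_wave (fun k => - c2 k) c1 f)%R]|)))%N%:R).
  rewrite ler_nat.
  pose p1 (f : {ffun 'I_K.*2.+1 -> 'I_(4 * L)}) := u / 4 < linear_wave c1 c2 f.
  pose p2 (f : {ffun 'I_K.*2.+1 -> 'I_(4 * L)}) :=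
    u / 4 < linear_wave (fun k => - c1 k) (fun k => - c2 k) f.
  pose p3 (f : {ffun 'I_K.*2.+1 -> 'I_(4 * L)}) := u / 4 < linear_wave c2 (fun k => - c1 k) f.
  pose p4 (f : {ffun 'I_K.*2.+1 -> 'I_(4 * L)}) := u / 4 < linear_wave (fun k => - c2 k) c1 f.
  have le1 := card_predU_le p1 (fun f => p2 f || (p3 f || p4 f)).
  have le2 := card_predU_le p2 (fun f => p3 f || p4 f).
  have le3 := card_predU_le p3 p4.
  exact: (leq_trans le1 (leq_add (leqnn _) (leq_trans le2 (leq_add (leqnn _) le3)))).
have {}o2 := o2 (fun k => etrans (f_equal2 +%R (sqrrN _) (sqrrN _)) erefl).
have {}o3 := o3 (fun k => etrans (f_equal2 +%R erefl (sqrrN _)) (addrC _ _)).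
have {}o4 := o4 (fun k => etrans (f_equal2 +%R (sqrrN _) erefl) (addrC _ _)).
rewrite !natrD; apply: le_trans (lerD o1 (lerD o2 (lerD o3 o4))) _.
set e := expR _; set g := #|{: _}|%:R; lra.
Qed.

Definition small_ball_constant : R := 2 ^+ 10 * (8 / damping_constant) ^+ 8.

Lemma small_ball_constant_gt0 : 0 < small_ball_constant.
Proof.
have /andP[h _] := @damping_constant_bounds R.
by rewrite mulr_gt0 // exprn_gt0 // divr_gt0.
Qed.

(** The radius [1 / (2 Q)] and an equal discretisation error add up to the [1 / Q] of the counting
    lemma, which is applied with [b^2 = energy h]. *)
Lemma small_ball (x y h : R) (Q : nat) : 0 < h <= 64^-1 -> `|x - y| = h -> (0 < Q)%N ->
  prob_le P [set w | `|phi w x - phi w y| * (2 * Q%:R) <= 1]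
    (small_ball_constant / (Q%:R ^+ 2 * energy h)).
Proof.
wlog xy : x y / x - y = h.
  move=> H h01 xyh Q0; have h0 : 0 < h by case/andP: h01.
  have [s|s] := ltP (x - y) 0.
    have yx : y - x = h by rewrite -xyh ltr0_norm // opprB.
    have := H y x yx h01 _ Q0; rewrite distrC => /(_ xyh).
    by apply: prob_leS => // w /=; rewrite distrC.
  by apply: H => //; rewrite -xyh ger0_norm.
move=> h01 _ Q0; have [h0 h1] := andP h01.
have QR : 0 < Q%:R :> R by rewrite ltr0n.
have E0 := energy_gt0 h0.
have b01 : 0 < Num.sqrt (energy h) <= 1.
  rewrite sqrtr_gt0 E0 /= -sqrtr1 ler_wsqrtr // /energy.
  have : Num.sqrt h <= 1 by rewrite -sqrtr1 ler_wsqrtr //; lra.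
  have := sqrtr_ge0 h; nra.
have [K0 K0P] := increments_damped Q h01.
have e0 : 0 < (2 * Q%:R)^-1 :> R by rewrite invr_gt0 mulr_gt0.
have [K [L [K0K L0 HK]]] := grid_increment x y K0 e0.
have bE : Num.sqrt (energy h) ^+ 2 = energy h by rewrite sqr_sqrtr // ltW.
have := @small_ball_count R L L0 _ (fun k : 'I_K.*2.+1 => increment_re x y (k%:Z - K%:Z))
  (fun k => increment_im x y (k%:Z - K%:Z)) Q (Num.sqrt (energy h)) damping_constant
  Q0 b01 damping_constant_bounds.
rewrite bE => /(_ (K0P K x y K0K xy)) count.
have card0 : 0 < #|{: {ffun 'I_K.*2.+1 -> 'I_(4 * L)}}|%:R :> R.
  by rewrite ltr0n card_ffun !card_ord expn_gt0; apply/orP; left; lia.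
set D := [pred f | _] in count.
apply: (@prob_leS _ _ _ P _ [set w | `|phi w x - phi w y| * (2 * Q%:R) <= 1]
  (#|D|%:R / #|{: {ffun 'I_K.*2.+1 -> 'I_(4 * L)}}|%:R)) => //; last first.
  apply: (grid_prob theta_indep theta_unif L0) => w f wQ wf; rewrite /= in wQ; have [h2 h3] := HK w f wf.
  have h4 := Rcomplex_Re_le (phi w x - phi w y); have h5 := Rcomplex_Im_le (phi w x - phi w y).
  have h6 : `|phi w x - phi w y| <= (2 * Q%:R)^-1.
    by rewrite -div1r ler_pdivlMr // mulr_gt0.
  have e2 : (2 * Q%:R)^-1 + (2 * Q%:R)^-1 = Q%:R^-1 :> R by field; rewrite gt_eqF.
  have fin (a b : R) : `|a| <= `|phi w x - phi w y| -> `|a - b| <= (2 * Q%:R)^-1 -> `|b| * Q%:R <= 1.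
    move=> a1 a2; rewrite -ler_pdivlMr // mul1r -e2.
    have := ler_normB a (a - b); rewrite subKr; lra.
  have r1 := fin _ _ h4 h2; have r2 := fin _ _ h5 h3.
  exact: (introT andP (conj r1 r2)).
rewrite ler_pdivrMr // mulrC; exact: count.
Qed.

End IncrementProbability.

(** * Sets of Hausdorff measure zero *)

Section HausdorffNull.
Context {R : realType} {V : normedZmodType R}.
Implicit Types (A U : set V) (s r delta eta : R).

Lemma diameter_ge0 U : (0 <= diameter U)%E.
Proof. by rewrite /diameter le_max lexx. Qed.

Lemma diameter_leP U r : (diameter U <= r%:E)%E <->
  0 <= r /\ forall x y, U x -> U y -> `|x - y| <= r.
Proof.
rewrite /diameter ge_max lee_fin; split=> [/andP[r0 h]|[r0 h]].
  split=> // x y Ux Uy; rewrite -lee_fin; apply: le_trans h.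
  by apply: ereal_sup_ubound; exists x => //; exists y.
rewrite r0 /=; apply: ge_ereal_sup => _ [x Ux [y Uy <-]].
by rewrite lee_fin; exact: h.
Qed.

Definition hausdorff_null s A := forall delta eta, 0 < delta -> 0 < eta ->
  exists U : nat -> set V, [/\ A `<=` \bigcup_i U i,
    forall i, (diameter (U i) <= delta%:E)%E &
    (\sum_(i <oo | U i != set0) diameter (U i) `^ s <= eta%:E)%E].

Lemma hausdorff_content_ge0 s delta A : (0 <= hausdorff_content s delta A)%E.
Proof.
apply: le_ereal_inf_tmp => _ [U _ <-]; apply: nneseries_ge0 => i _ _.
exact: poweR_ge0.
Qed.

Lemma hausdorff_nullP s A : hausdorff_measure s A = 0%E <-> hausdorff_null s A.
Proof.
split=> [H delta eta d0 e0|H].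
  have : hausdorff_content s delta A = 0%E.
    apply/eqP; rewrite eq_le hausdorff_content_ge0 andbT -H.
    by apply: ereal_sup_ubound; exists delta.
  move=> c0; have : (hausdorff_content s delta A < eta%:E)%E by rewrite c0 lte_fin.
  move=> /ereal_inf_lt[_ [U [AU Ud] <-] /ltW Ue]; exists U; split => //.
apply/eqP; rewrite eq_le; apply/andP; split.
  apply: ge_ereal_sup => _ [delta d0 <-]; apply/lee_addgt0Pr => e e0; rewrite add0e.
  have [U [AU Ud Ue]] := H _ _ d0 e0; apply: le_trans Ue.
  by apply: ereal_inf_lbound; exists U; [split|].
apply: le_trans (hausdorff_content_ge0 s 1 A) _.
by apply: ereal_sup_ubound; exists 1 => //=.
Qed.

Lemma hausdorff_dim_le s A : 0 <= s -> hausdorff_null s A -> (hausdorff_dim A <= s%:E)%E.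
Proof.
by move=> s0 /hausdorff_nullP H; apply: ereal_inf_lbound; exists s.
Qed.

Lemma hausdorff_dim_lt A (x : \bar R) : (hausdorff_dim A < x)%E ->
  exists s, [/\ 0 <= s, hausdorff_null s A & (s%:E < x)%E].
Proof.
by move=> /ereal_inf_lt[_ [s [s0 /hausdorff_nullP H] <-] sx]; exists s.
Qed.

Lemma hausdorff_dim_ge0 A : (0 <= hausdorff_dim A)%E.
Proof. by apply: le_ereal_inf_tmp => _ [s [s0 _] <-]; rewrite lee_fin. Qed.

(** Transfers covers with other countable index types to [nat]: codes outside [C] receive the empty
    set, which the content leaves out of its sum. *)
Lemma countable_cover (T : countType) (C : set T) (U : T -> set V) s A delta
    (g : T -> \bar R) (c : \bar R) : 0 <= delta ->
  A `<=` \bigcup_(t in C) U t ->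
  (forall t, C t -> (diameter (U t) <= delta%:E)%E) ->
  (forall t, 0 <= g t)%E ->
  (forall t, C t -> U t !=set0 -> (diameter (U t) `^ s <= g t)%E) ->
  (\esum_(t in C) g t <= c)%E ->
  exists W : nat -> set V, [/\ A `<=` \bigcup_i W i,
    forall i, (diameter (W i) <= delta%:E)%E &
    (\sum_(i <oo | W i != set0) diameter (W i) `^ s <= c)%E].
Proof.
move=> d0 AU Ud g0 Ug gc.
pose W k := if pickle_inv k is Some t then (if `[< C t >] then U t else set0) else set0.
have Wp t : C t -> W (pickle t) = U t by move=> Ct; rewrite /W pickleK_inv asboolT.
exists W; split.
- by move=> x /AU[t Ct Utx]; exists (pickle t) => //; rewrite Wp.
- have d : (diameter (set0 : set V) <= delta%:E)%E by apply/diameter_leP.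
  move=> k; rewrite /W; case: (pickle_inv k) => // t; case: asboolP => // Ct.
  exact: Ud.
- rewrite nneseries_esum; last by move=> ? _; exact: poweR_ge0.
  pose C' := [set t | C t /\ U t !=set0].
  have bij : set_bij C' [set k | W k != set0] pickle.
    split.
    + by move=> t [Ct Ut] /=; rewrite Wp //; apply/set0P.
    + by move=> t t' _ _ /(pcan_inj pickleK).
    + move=> k /=; rewrite /W; case E : (pickle_inv k) => [t|]; last by rewrite eqxx.
      case: asboolP => [Ct Ut|]; last by rewrite eqxx.
      exists t; first by split => //; apply/set0P.
      by have := @pickle_invK T k; rewrite E.
  rewrite (@reindex_esum _ _ _ C' _ pickle _ bij); apply: le_trans gc.
  apply: (@le_trans _ _ (\esum_(t in C') g t)%E); last by apply: esum_mono => t [].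
  by apply: le_esum => t [Ct Ut]; rewrite Wp //; exact: Ug.
Qed.

Lemma hausdorff_null_bigcup s (A_ : nat -> set V) :
  (forall n, hausdorff_null s (A_ n)) -> hausdorff_null s (\bigcup_n A_ n).
Proof.
move=> HA delta eta d0 e0.
have en0 n : 0 < eta / (2 ^ n.+1)%:R by rewrite divr_gt0 // ltr0n expn_gt0.
have /choice[U UP] n := HA n delta _ d0 (en0 n).
apply: (@countable_cover (nat * nat)%type [set t | U t.1 t.2 != set0]
  (fun t => U t.1 t.2) s _ delta (fun t => diameter (U t.1 t.2) `^ s)%E).
- exact: ltW.
- move=> x [n _ /(let: And3 a _ _ := UP n in a)[i _ Ui]]; exists (n, i) => //=.
  by apply/set0P; exists x.
- by move=> [n i] _; case: (UP n).
- by move=> t; exact: poweR_ge0.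
- by [].
- have -> : [set t : nat * nat | U t.1 t.2 != set0] =
      [set: nat] `*`` (fun n => [set i | U n i != set0]).
    by apply/seteqP; split => -[n i] //= [].
  rewrite -(esum_esum (fun n i _ _ => poweR_ge0 (diameter (U n i)) s)).
  apply: le_trans (epsilon_trick0 xpredT (ltW e0)).
  rewrite nneseries_esumT; last by move=> n; rewrite lee_fin ltW.
  apply: le_esum => n _; rewrite -nneseries_esum; last by move=> ? _; exact: poweR_ge0.
  by case: (UP n).
Qed.



End HausdorffNull.

(** * Null sets under Hoelder maps, and null sets from zero dyadic content *)

Lemma esumZl_le (R : realType) (T : choiceType) (C : set T) (c : R) (a : T -> \bar R) :
  0 <= c -> (forall i, 0 <= a i)%E ->
  (\esum_(i in C) (c%:E * a i) <= c%:E * \esum_(i in C) a i)%E.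
Proof.
move=> c0 a0; apply: ge_ereal_sup => _ [F [fF FC] <-].
rewrite -ge0_mule_fsumr //; apply: lee_wpmul2l; first by rewrite lee_fin.
by apply: ereal_sup_ubound; exists F.
Qed.

Section HausdorffImages.
Context {R : realType}.

Lemma hausdorff_null_holder (V W : normedZmodType R) (A : set V) (f : V -> W)
    (s beta C delta0 : R) : 0 <= s -> 0 < beta -> 0 < C -> 0 < delta0 ->
  (forall x y, A x -> A y -> `|x - y| <= delta0 -> `|f x - f y| <= C * `|x - y| `^ beta) ->
  hausdorff_null s A -> hausdorff_null (s / beta) (f @` A).
Proof.
move=> s0 b0 C0 dl0 fH HA delta eta d0 e0.
pose d1 := Num.min delta0 ((delta / C) `^ beta^-1).
have d10 : 0 < d1 by rewrite lt_min dl0 powR_gt0 // divr_gt0.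
have Cs : 0 < C `^ (s / beta) by rewrite powR_gt0.
have [U [AU Ud Us]] := HA d1 (eta / C `^ (s / beta)) d10 (divr_gt0 e0 Cs).
have diam i x y : A x -> A y -> U i x -> U i y ->
    `|f x - f y| <= C * fine (diameter (U i)) `^ beta.
  move=> Ax Ay Ux Uy.
  have fd : diameter (U i) = (fine (diameter (U i)))%:E.
    by rewrite fineK // ge0_fin_numE ?diameter_ge0 // (le_lt_trans (Ud i)) // ltry.
  have [D0 DP] : 0 <= fine (diameter (U i)) /\ forall x y, U i x -> U i y -> `|x - y| <= fine (diameter (U i)).
    by apply/diameter_leP; rewrite -fd.
  have xy := DP _ _ Ux Uy.
  have xy0 : `|x - y| <= delta0.
    apply: le_trans xy _; have := Ud i; rewrite fd lee_fin => /le_trans; apply.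
    by rewrite ge_min lexx.
  apply: le_trans (fH _ _ Ax Ay xy0) _; rewrite ler_pM2l //.
  by apply: ge0_ler_powR; rewrite ?nnegrE // ltW.
have C1 i : 0 <= C * fine (diameter (U i)) `^ beta by rewrite mulr_ge0 ?powR_ge0 // ltW.
apply: (@countable_cover _ _ nat [set i | U i != set0] (fun i => f @` (U i `&` A)) _ _ delta
  (fun i => (C `^ (s / beta))%:E * diameter (U i) `^ s)%E).
- exact: ltW.
- move=> _ [x Ax <-]; have [i _ Ui] := AU _ Ax; exists i.
    by apply/set0P; exists x.
  by exists x.
- move=> i _; apply/diameter_leP; split; first exact: ltW.
  move=> _ _ [x [Ux Ax] <-] [y [Uy Ay] <-]; apply: le_trans (diam _ _ _ Ax Ay Ux Uy) _.
  rewrite mulrC -ler_pdivlMr //.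
  have : fine (diameter (U i)) <= (delta / C) `^ beta^-1.
    have := Ud i; rewrite -[diameter _]fineK; last first.
      by rewrite ge0_fin_numE ?diameter_ge0 // (le_lt_trans (Ud i)) // ltry.
    by rewrite lee_fin => /le_trans; apply; rewrite ge_min lexx orbT.
  move=> /(ge0_ler_powR (ltW b0)) h; apply: le_trans (h _ _) _.
  + by rewrite nnegrE fine_ge0 // diameter_ge0.
  + by rewrite nnegrE powR_ge0.
  + by rewrite -powRrM mulVf ?gt_eqF // powRr1 // divr_ge0 // ltW.
- by move=> i; rewrite mule_ge0 ?poweR_ge0 // lee_fin ltW.
- move=> i _ _.
  have fd : diameter (U i) = (fine (diameter (U i)))%:E.
    by rewrite fineK // ge0_fin_numE ?diameter_ge0 // (le_lt_trans (Ud i)) // ltry.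
  have dd : (diameter (f @` (U i `&` A)) <= (C * fine (diameter (U i)) `^ beta)%:E)%E.
    apply/diameter_leP; split => // _ _ [x [Ux Ax] <-] [y [Uy Ay] <-]; exact: diam.
  apply: (@le_trans _ _ ((C * fine (diameter (U i)) `^ beta)%:E `^ (s / beta))%E).
    apply: gt0_ler_poweR => //; rewrite ?divr_ge0 ?(ltW b0) // !in_itv /= ?diameter_ge0 ?leey //.
    by rewrite lee_fin C1.
  rewrite [in leRHS]fd !poweR_EFin -EFinM lee_fin powRM ?powR_ge0 ?(ltW C0) //.
  by rewrite -powRrM mulrCA divff ?gt_eqF // mulr1.
- apply: (le_trans (esumZl_le _ (ltW Cs) _)); first by move=> i; exact: poweR_ge0.
  rewrite -nneseries_esum; last by move=> ? _; exact: poweR_ge0.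
  apply: (le_trans (lee_wpmul2l _ Us)); first by rewrite lee_fin ltW.
  by rewrite -EFinM mulrC divfK // gt_eqF.
Qed.

(** The content does not bound lengths, but a cover of cost at most [e] contains no interval with
    [q ^+ n > e]: small cost forces small diameters. *)
Lemma dcontent_null (E : set R) (s a L : R) : 0 < s -> 0 < L ->
  E `<=` [set x | 0 <= x] ->
  dcontent (2 `^ (- s)) E = 0%E ->
  hausdorff_null s ((fun u => a + L * u) @` E).
Proof.
move=> s0 L0 E0 cE delta eta d0 e0; set q := 2 `^ (- s) in cE.
have q0 : 0 < q by rewrite powR_gt0.
pose e := Num.min ((delta / L) `^ s) (eta / L `^ s).
have ee0 : 0 < e by rewrite lt_min !divr_gt0 ?powR_gt0 // divr_gt0.
have fE : dcontent q E \is a fin_num by rewrite cE.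
have [C EC] := dcontent_cover fE ee0; rewrite cE add0e => Ce.
have qE n : q ^+ n = ((2 ^+ n)^-1) `^ s.
  rewrite -powR_mulrn ?(ltW q0) // /q -powRrM mulNr mulrC -mulNr.
  by rewrite powRrM powRN powR_mulrn.
have Iq I : C I -> q ^+ I.1 <= e.
  move=> CI; rewrite -lee_fin; apply: le_trans Ce; apply: ereal_sup_ubound.
  exists [set I]; last by rewrite fsbig_set1.
  by split; [exact: finite_set1|move=> _ ->].
have Il I : C I -> L / 2 ^+ I.1 <= delta.
  move=> CI; rewrite mulrC -ler_pdivlMr //.
  have : q ^+ I.1 <= (delta / L) `^ s by apply: le_trans (Iq _ CI) _; rewrite ge_min lexx.
  rewrite qE => h.
  have := ge0_ler_powR (_ : 0 <= s^-1) _ _ h; rewrite !nnegrE !powR_ge0 invr_ge0 (ltW s0).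
  move=> /(_ isT isT isT); rewrite -!powRrM divff ?gt_eqF // !powRr1 //.
    by rewrite divr_ge0 // ltW.
have dI I : (diameter ((fun u => a + L * u)%R @` dyadic I) <= (L / 2 ^+ I.1)%:E)%E.
  apply/diameter_leP; split; first by rewrite divr_ge0 ?exprn_ge0 // ltW.
  move=> _ _ [x /andP[x1 x2] <-] [y /andP[y1 y2] <-].
  have -> : a + L * x - (a + L * y) = L * (x - y) by ring.
  rewrite normrM gtr0_norm // ler_pM2l // -div1r ler_pdivlMr ?exprn_gt0 //.
  rewrite -[X in _ * X](@gtr0_norm _ (2 ^+ I.1)) ?exprn_gt0 // -normrM mulrBl.
  move: x2 y2; rewrite -natr1 ler_norml => x2 y2; apply/andP; split; lra.
apply: (@countable_cover _ _ (nat * nat)%type C (fun I => (fun u => a + L * u) @` dyadic I) s _ delta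
  (fun I => (L `^ s)%:E * (q ^+ I.1)%:E)%E).
- exact: ltW.
- by move=> _ [x /EC[I CI Ix] <-]; exists I => //; exists x.
- by move=> I CI; apply: le_trans (dI I) _; rewrite lee_fin; exact: Il.
- by move=> I; rewrite -EFinM lee_fin mulr_ge0 ?powR_ge0 // exprn_ge0 // ltW.
- move=> I CI _; apply: (@le_trans _ _ ((L / 2 ^+ I.1)%:E `^ s)%E).
    apply: gt0_ler_poweR => //; rewrite ?(ltW s0) // !in_itv /= ?diameter_ge0 ?leey //.
    by rewrite lee_fin divr_ge0 ?exprn_ge0 ?(ltW L0).
  by rewrite poweR_EFin -EFinM lee_fin qE powRM ?invr_ge0 ?exprn_ge0 ?(ltW L0).
- apply: (le_trans (esumZl_le _ (powR_ge0 _ _) _)).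
    by move=> I; rewrite lee_fin exprn_ge0 // ltW.
  apply: (@le_trans _ _ ((L `^ s)%:E * e%:E)%E).
    by apply: lee_wpmul2l Ce; rewrite lee_fin powR_ge0.
  rewrite -EFinM lee_fin mulrC -ler_pdivlMr ?powR_gt0 //.
  by rewrite ge_min lexx orbT.
Qed.

End HausdorffImages.

(** * Mass distribution principle with discrete energies *)

Section EnergyLowerBound.
Context {R : realType} {V : normedZmodType R}.
Implicit Types (psi : R -> V) (K : set R).

Lemma dyadic_scale (z : R) : 0 < z <= 1 -> exists m : nat, z <= (2 ^+ m)^-1 /\ (2 ^+ m)^-1 < 2 * z.
Proof.
move=> /andP[z0 z1].
have ex : exists m, (2 ^+ m)^-1 < 2 * z.
  have [n nP] : exists n : nat, z^-1 < n%:R.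
    by exists (Num.bound z^-1); apply: archi_boundP; rewrite invr_ge0 ltW.
  exists n; rewrite -[ltRHS]invrK ltf_pV2 ?posrE ?invr_gt0 ?mulr_gt0 ?exprn_gt0 //.
  rewrite invfM; apply: (@lt_trans _ _ n%:R).
    by apply: le_lt_trans nP; rewrite ler_piMl ?invr_ge0 ?(ltW z0) // invf_le1 // ler1n.
  by rewrite -natrX ltr_nat ltn_expl.
case: (ex_minnP ex) => m mz mmin; exists m; split => //.
case: m mz mmin => [|m] mz mmin; first by rewrite expr0 invr1.
rewrite leNgt; apply/negP => h.
have : (2 ^+ m)^-1 < 2 * z.
  have -> : (2 ^+ m)^-1 = 2 * (2 ^+ m.+1)^-1 :> R by rewrite exprS; field; rewrite expf_neq0.
  by rewrite ltr_pM2l.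
by move=> /mmin; rewrite ltnn.
Qed.

(** With [g = 2^gam], a dyadic version of the double sum of [w i * w i'] over the [gam]-th power of
    the distance, cut off at distances of order [2^(-J)] so that the diagonal stays finite. *)
Definition pair_energy (I : finType) (w : I -> R) (y : I -> V) (g : R) (J : nat) : R :=
  \sum_(m < J.+1) g ^+ m *
    \sum_i \sum_(i' | `|y i - y i'| * 2 ^+ m.+1 <= 1) w i * w i'.

(* Mass distribution principle: c = sum_j W_j, and by AM-GM each
   W_j <= (tau W_j^2 g^m_j + g^-m_j / tau) / 2. *)
Lemma cover_mass_bound (I : finType) (w : I -> R) (y : I -> V) (g c lam : R) (J N : nat)
    (m : nat -> nat) (O : nat -> set V) :
  0 < g -> 0 < c -> 0 < lam -> (forall i, 0 <= w i) -> \sum_i w i = c ->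
  (forall j, (j < N)%N -> (m j <= J)%N) ->
  (forall j u v, O j u -> O j v -> `|u - v| * 2 ^+ (m j).+1 <= 1) ->
  (forall i, w i != 0 -> exists2 j, (j < N)%N & O j (y i)) ->
  pair_energy w y g J <= lam ->
  c ^+ 2 <= lam * \sum_(j < N | O j != set0) (g ^+ m j)^-1.
Proof.
move=> g0 c0 l0 w0 wc mJ Om wO El.
(* Each charged point is assigned to a single piece, so that the masses [W j] add up to [c]
   exactly. *)
have /choice[idx idxP] i : exists j, w i != 0 -> (j < N)%N /\ O j (y i).
  by have [_|/wO[j jN Oj]] := eqVneq (w i) 0; [exists 0%N|exists j].
pose W j := \sum_(i | (w i != 0) && (idx i == j)) w i.
have Wc : c = \sum_(j < N) W j.
  rewrite -wc /W (exchange_big_dep xpredT) //=; apply: eq_bigr => i _.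
  have [wi|wi] := eqVneq (w i) 0; first by rewrite big_pred0.
  have [jN _] := idxP i wi.
  by rewrite (big_pred1 (Ordinal jN)) // => j /=; rewrite -val_eqE /= eq_sym.
have W0 j : O j = set0 -> W j = 0.
  move=> Oj; apply: big1 => i /andP[wi /eqP ij].
  by have [_] := idxP i wi; rewrite ij Oj.
have Wge j : 0 <= W j by apply: sumr_ge0.
have WE : \sum_(j < N) W j ^+ 2 * g ^+ m j <= lam.
  apply: le_trans El; rewrite /pair_energy.
  have -> : \sum_(m < J.+1) g ^+ m * (\sum_i \sum_(i' | `|y i - y i'| * 2 ^+ m.+1 <= 1) w i * w i')
      = \sum_i \sum_i' \sum_(m < J.+1 | `|y i - y i'| * 2 ^+ m.+1 <= 1) g ^+ m * (w i * w i').
    under eq_bigr do rewrite mulr_sumr.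
    rewrite exchange_big; apply: eq_bigr => i _.
    under eq_bigr do rewrite mulr_sumr.
    by rewrite (exchange_big_dep xpredT).
  have -> : \sum_(j < N) W j ^+ 2 * g ^+ m j =
      \sum_i \sum_i' \sum_(j < N | [&& w i != 0, idx i == j, w i' != 0 & idx i' == j]) g ^+ m j * (w i * w i').
    under eq_bigr do rewrite /W expr2 mulr_suml mulr_suml.
    rewrite (exchange_big_dep xpredT) //=; apply: eq_bigr => i _.
    under eq_bigr do rewrite mulr_sumr mulr_suml.
    rewrite (exchange_big_dep xpredT) //=; apply: eq_bigr => i' _.
    apply: eq_big => [j|j _]; first by rewrite /= -?andbA.
    by rewrite mulrC.
  apply: ler_sum => i _; apply: ler_sum => i' _.
  have term0 k : 0 <= g ^+ k * (w i * w i') by rewrite !mulr_ge0 // exprn_ge0 // ltW.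
  have [/and3P[wi wi' /eqP ii']|h] := boolP [&& w i != 0, w i' != 0 & idx i == idx i']; last first.
    rewrite big_pred0; first exact: sumr_ge0.
    move=> j; apply: contraNF h => /and4P[-> /eqP -> -> /eqP ->]; exact: eqxx.
  have [jN Oi] := idxP i wi; have [_ Oi'] := idxP i' wi'; rewrite -ii' in Oi'.
  rewrite (big_pred1 (Ordinal jN)); last first.
    by move=> j /=; rewrite wi wi' -ii' -val_eqE /= andbb eq_sym.
  have mlt : (m (idx i) < J.+1)%N by rewrite ltnS mJ.
  rewrite (bigD1 (Ordinal mlt)) /=; last exact: Om Oi Oi'.
  by rewrite lerDl; exact: sumr_ge0.
have amgm j : W j <= (c / lam * (W j ^+ 2 * g ^+ m j) + lam / c * (if O j != set0 then (g ^+ m j)^-1 else 0)) / 2.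
  case: ifPn => [Oj|/negPn/eqP Oj]; last first.
    by rewrite (W0 _ Oj) expr0n !(mul0r, mulr0) addr0 mul0r.
  have gm : 0 < g ^+ m j by rewrite exprn_gt0.
  have h : 0 <= (W j * (c * g ^+ m j) - lam) ^+ 2 by exact: sqr_ge0.
  rewrite ler_pdivlMr // -subr_ge0.
  have -> : c / lam * (W j ^+ 2 * g ^+ m j) + lam / c * (g ^+ m j)^-1 - W j * 2 =
      (W j * (c * g ^+ m j) - lam) ^+ 2 / (lam * c * g ^+ m j).
    by field; rewrite !gt_eqF.
  by rewrite divr_ge0 // !mulr_ge0 // ltW.
have : c <= (c / lam * lam + lam / c * (\sum_(j < N | O j != set0) (g ^+ m j)^-1)) / 2.
  rewrite {1}Wc; apply: (@le_trans _ _ (\sum_(j < N)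
    (c / lam * (W j ^+ 2 * g ^+ m j) + lam / c * (if O j != set0 then (g ^+ m j)^-1 else 0)) / 2)).
    by apply: ler_sum => j _; exact: amgm.
  rewrite -mulr_suml ler_pM2r ?invr_gt0 // big_split /= -!mulr_sumr -big_mkcond /=.
  by rewrite lerD2r ler_pM2l // divr_gt0.
rewrite divfK ?gt_eqF //; set S := \sum_(j < N | _) _ => h.
have : c <= lam / c * S by lra.
by rewrite mulrAC ler_pdivlMr // -expr2.
Qed.

(** A cheap cover is fattened to open sets, compactness leaves finitely many pieces, and only then
    is [J] taken beyond all their scales. Bounded energies for arbitrarily large [J] are therefore
    enough. *)
Lemma energy_lower_bound psi K (gam c lam t : R) :
  compact K -> (forall x e, 0 < e -> exists2 d, 0 < d & forall y, `|x - y| <= d -> `|psi x - psi y| <= e) ->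
  0 < gam -> 0 < c -> 0 < lam -> 0 <= t <= gam ->
  (forall N, exists J (I : finType) (w : I -> R) (x : I -> R),
    [/\ (N <= J)%N, forall i, 0 <= w i, \sum_i w i = c,
      forall i, w i != 0 -> K (x i) &
      pair_energy w (psi \o x) (2 `^ gam) J <= lam]) ->
  ~ hausdorff_null t (psi @` K).
Proof.
move=> cK psic g0 c0 l0 /andP[t0 tg] H null.
(* The aim is [lam * 16^gam * (2 * eta) = c^2 / 4 < c^2], one [eta] paying for the diameters and one
   for the fattening. *)
pose eta := c ^+ 2 / (8 * (16 `^ gam) * lam).
have p16 : 0 < 16 `^ gam :> R by rewrite powR_gt0.
have e0 : 0 < eta by rewrite divr_gt0 ?exprn_gt0 // !mulr_gt0.
have d16 : 0 < 16^-1 :> R by rewrite invr_gt0.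
have [U [KU Ud Us]] := null 16^-1 eta d16 e0.
pose d i := fine (diameter (U i)).
have fd i : diameter (U i) = (d i)%:E.
  by rewrite fineK // ge0_fin_numE ?diameter_ge0 // (le_lt_trans (Ud i)) // ltry.
have [d0 dP] : (forall i, 0 <= d i) /\ (forall i x y, U i x -> U i y -> `|x - y| <= d i).
  by split=> i; have /diameter_leP[] : (diameter (U i) <= (d i)%:E)%E by rewrite fd.
have d1 i : d i <= 16^-1 by have := Ud i; rewrite fd lee_fin.
pose ep i := Num.min 16^-1 ((eta / 2 ^+ i.+1) `^ gam^-1).
have ep0 i : 0 < ep i by rewrite lt_min d16 powR_gt0 // divr_gt0 // exprn_gt0.
have ep1 i : ep i <= 16^-1 by rewrite ge_min lexx.
have epg i : ep i `^ gam <= eta / 2 ^+ i.+1.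
  apply: (@le_trans _ _ (((eta / 2 ^+ i.+1) `^ gam^-1) `^ gam)).
    apply: ge0_ler_powR; rewrite ?nnegrE ?powR_ge0 ?(ltW g0) ?(ltW (ep0 i)) //.
    by rewrite ge_min lexx orbT.
  by rewrite -powRrM mulVf ?gt_eqF // powRr1 // divr_ge0 ?exprn_ge0 // ltW.
(* A fattened piece has diameter at most [d i + 2 * ep i <= z i / 2], and [z i <= 1] by the choice
   of [1 / 16]. Conversely [2 * z i] is at most 16 times the larger of [d i] and [ep i]. *)
pose z i := 4 * (d i + ep i).
have z0 i : 0 < z i <= 1.
  by rewrite /z; have := d0 i; have := ep0 i; have := d1 i; have := ep1 i => *; apply/andP; split; lra.
have /choice[m mP] i := dyadic_scale (z0 i).
pose O i : set V := [set v | exists2 u, U i u & `|v - u| < ep i].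
have Om j u v : O j u -> O j v -> `|u - v| * 2 ^+ (m j).+1 <= 1.
  move=> [u' Uu uu'] [v' Uv vv']; have := dP _ _ _ Uu Uv.
  have [zm _] := mP j.
  have : `|u - v| <= `|u - u'| + (`|u' - v'| + `|v - v'|).
    have -> : u - v = (u - u') + ((u' - v') + (v' - v)) by rewrite !addrA !subrK.
    by rewrite (le_trans (ler_normD _ _)) // lerD2l (le_trans (ler_normD _ _)) // (distrC v').
  move=> h1 h2; have h3 : `|u - v| <= z j / 2.
    by rewrite /z; have := d0 j; move: uu' vv'; lra.
  rewrite -ler_pdivlMr ?exprn_gt0 // div1r exprS invfM.
  by apply: le_trans h3 _; rewrite mulrC ler_pM2l ?invr_gt0.
have OU j : O j != set0 -> U j != set0.
  by move=> /set0P[v [u Uu _]]; apply/set0P; exists u.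
have opn j : open (psi @^-1` O j).
  rewrite openE => x [u Uu xu]; have e' : 0 < ep j - `|psi x - u| by rewrite subr_gt0.
  have e2 : 0 < (ep j - `|psi x - u|) / 2 by rewrite divr_gt0.
  have [r r0 rP] := psic x _ e2.
  apply/nbhs_ballP; exists r => //= y; rewrite /ball /= => /ltW/rP xy.
  exists u => //; have : `|psi y - u| <= `|psi x - psi y| + `|psi x - u|.
    have -> : psi y - u = (psi y - psi x) + (psi x - u) by rewrite addrA subrK.
    by rewrite (le_trans (ler_normD _ _)) // (distrC (psi y)).
  by move: xy e'; lra.
have := cK; rewrite compact_cover => /(_ nat setT (fun j => psi @^-1` O j)).
move=> [|x Kx|D _ Dcov].
- by move=> i _; exact: opn.
- have [i _ Ui] := KU (psi x) (imageP _ Kx); exists i => //=; exists (psi x) => //.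
  by rewrite subrr normr0.
pose N := (\max_(i <- finmap.enum_fset D) i.+1)%N.
have [J [I [w [x [NJ w0 wc wK El]]]]] := H (\max_(j < N) m j)%N.
have g2 : 0 < 2 `^ gam :> R by rewrite powR_gt0.
have : c ^+ 2 <= lam * \sum_(j < N | O j != set0) ((2 `^ gam) ^+ m j)^-1.
  apply: (cover_mass_bound g2 c0 l0 w0 wc _ Om _ El) => [j jN|i /wK Ki].
  - apply: leq_trans NJ; exact: (@leq_bigmax_cond _ xpredT (fun j : 'I_N => m j) (Ordinal jN)).
  - have [j Dj Oj] := Dcov _ Ki; exists j => //.
    exact: (@leq_bigmax_seq _ _ xpredT (fun i : nat => i.+1) j).
apply/negP; rewrite -ltNge.
have bound : \sum_(j < N | O j != set0) ((2 `^ gam) ^+ m j)^-1 <= 16 `^ gam * (2 * eta).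
  have one j : U j != set0 -> ((2 `^ gam) ^+ m j)^-1 <= 16 `^ gam * (d j `^ t + eta / 2 ^+ j.+1).
    move=> Uj; have [_ mz] := mP j.
    have -> : ((2 `^ gam) ^+ m j)^-1 = ((2 ^+ m j)^-1) `^ gam.
      rewrite -powR_mulrn ?powR_ge0 // -powRrM (mulrC gam) powRrM powR_mulrn //.
      by rewrite -[in RHS]powR_inv1 ?exprn_ge0 // -[in RHS]powRrM mulN1r powRN.
    have le8 : (2 ^+ m j)^-1 <= 16 * Num.max (d j) (ep j).
      apply: le_trans (ltW mz) _; rewrite /z.
      have : d j <= Num.max (d j) (ep j) by rewrite le_max lexx.
      have : ep j <= Num.max (d j) (ep j) by rewrite le_max lexx orbT.
      by lra.
    have mx0 : 0 <= Num.max (d j) (ep j) by rewrite le_max d0.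
    apply: (@le_trans _ _ ((16 * Num.max (d j) (ep j)) `^ gam)).
      by apply: ge0_ler_powR; rewrite ?nnegrE ?invr_ge0 ?exprn_ge0 ?mulr_ge0 ?(ltW g0).
    rewrite powRM // ler_pM2l // /Num.max; case: ifP => _.
      by apply: le_trans (epg j) _; rewrite lerDr powR_ge0.
    have [dj0|dj0] := eqVneq (d j) 0.
      rewrite [in leLHS]dj0 powR0 ?gt_eqF // addr_ge0 ?powR_ge0 // divr_ge0 ?exprn_ge0 //.
      exact: ltW.
    have dj : 0 < d j <= 1 by rewrite lt_neqAle eq_sym dj0 d0 /= (le_trans (d1 j)) // invf_le1 // ler1n.
    apply: le_trans (ger_powR dj tg) _; rewrite lerDl divr_ge0 ?exprn_ge0 //; exact: ltW.
  apply: (@le_trans _ _ (\sum_(j < N | U j != set0) 16 `^ gam * (d j `^ t + eta / 2 ^+ j.+1))).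
    rewrite [leLHS]big_mkcond [leRHS]big_mkcond /=; apply: ler_sum => j _.
    have pos : 0 <= 16 `^ gam * (d j `^ t + eta / 2 ^+ j.+1).
      by rewrite mulr_ge0 ?powR_ge0 // addr_ge0 ?powR_ge0 // divr_ge0 ?exprn_ge0 // ltW.
    case: ifPn => [/OU Uj|_]; first by rewrite Uj one.
    by case: ifP.
  rewrite -mulr_sumr ler_pM2l // big_split /= mulr_natl mulr2n; apply: lerD.
    rewrite -lee_fin -sumEFin; apply: le_trans Us.
    under eq_bigr do rewrite -poweR_EFin -fd.
    rewrite -(big_mkord (fun j => U j != set0) (fun j => (diameter (U j) `^ t)%E)).
    by apply: nneseries_lim_ge => i _ _; exact: poweR_ge0.
  apply: (@le_trans _ _ (\sum_(j < N) eta / 2 ^+ j.+1)).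
    rewrite [leLHS]big_mkcond /=; apply: ler_sum => j _; case: ifP => // _.
    by rewrite divr_ge0 ?exprn_ge0 // ltW.
  have geo n : \sum_(j < n) eta / 2 ^+ j.+1 = eta * (1 - (2 ^+ n)^-1).
    elim: n => [|n IH]; first by rewrite big_ord0 expr0 invr1 subrr mulr0.
    by rewrite big_ord_recr /= IH exprS; field; rewrite expf_neq0.
  rewrite geo.
  by rewrite ler_piMr ?(ltW e0) // lerBlDr lerDl invr_ge0 exprn_ge0.
apply: le_lt_trans (ler_wpM2l (ltW l0) bound) _.
have -> : lam * (16 `^ gam * (2 * eta)) = c ^+ 2 / 4.
  by rewrite /eta; field; rewrite !gt_eqF.
by have := exprn_gt0 2 c0; lra.
Qed.

End EnergyLowerBound.

(** * Markov and Fatou arguments for outer probability *)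

Section MarkovEvents.
Context {d : measure_display} {T : measurableType d} {R : realType}.
Variable P : probability T R.

Lemma weighted_markov (I : finType) (E : I -> set T) (a b : I -> R) (lam : R) :
  0 < lam -> (forall i, 0 <= a i) -> (forall i, prob_le P (E i) (b i)) ->
  prob_le P [set w | lam <= \sum_(i | `[< E i w >]) a i] ((\sum_i a i * b i) / lam).
Proof.
move=> l0 a0 /choice[G GP].
have mG i : measurable (G i) by case: (GP i).
pose f w : R := \sum_i a i * \1_(G i) w.
have mf : measurable_fun setT f.
  apply: measurable_sum => i; apply: measurable_funM; first exact: measurable_cst.
  exact: measurable_indic.
have f0 w : 0 <= f w by apply: sumr_ge0 => i _; rewrite mulr_ge0.
pose H := f @^-1` `[lam, +oo[%classic.
have mH : measurable H.
  by rewrite -[X in measurable X]setTI; apply: mf => //; exact: measurable_itv.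
exists H; split => //.
  move=> w /= lw; rewrite /H /= in_itv /= andbT; apply: le_trans lw _.
  rewrite /f big_mkcond /=; apply: ler_sum => i _; case: asboolP => [Ew|_].
    rewrite indicE mem_set ?mulr1 //; by case: (GP i) => _ + _; apply.
  by rewrite mulr_ge0.
have mind (A : set T) : measurable A -> measurable_fun setT (fun w => (\1_A w : R)%:E).
  by move=> mA; apply: (measurableT_comp (@EFin_measurable R setT)); exact: measurable_indic.
have ind0 (A : set T) w : setT w -> (0 <= (\1_A w : R)%:E)%E by rewrite lee_fin.
have h1 : (lam%:E * P H <= \int[P]_w (f w)%:E)%E.
  have -> : (lam%:E * P H = \int[P]_w (lam%:E * (\1_H w)%:E))%E.
    rewrite (ge0_integralZl P measurableT (mind _ mH) (ind0 _)) ?lee_fin ?(ltW l0) //.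
    by rewrite integral_indic // setIT.
  apply: ge0_le_integral => //.
  - by move=> w _; rewrite -EFinM lee_fin mulr_ge0 // ltW.
  - apply: (measurableT_comp (@EFin_measurable R setT)).
    by apply: measurable_funM; [exact: measurable_cst|exact: measurable_indic].
  - exact: (measurableT_comp (@EFin_measurable R setT)).
  - move=> w _; rewrite -EFinM lee_fin indicE.
    case: (boolP (w \in H)) => [|_]; last by rewrite mulr0.
    by rewrite inE /H /= in_itv /= andbT mulr1.
have h2 : (\int[P]_w (f w)%:E <= (\sum_i a i * b i)%:E)%E.
  have -> : (\int[P]_w (f w)%:E = \sum_i (a i)%:E * P (G i))%E.
    rewrite /f; under eq_integral do rewrite -sumEFin.
    have mai i : measurable_fun setT (fun w => (a i * \1_(G i) w)%:E).
      apply: (measurableT_comp (@EFin_measurable R setT)).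
      by apply: measurable_funM; [exact: measurable_cst|exact: measurable_indic].
    have ai0 i w : setT w -> (0 <= (a i * \1_(G i) w)%:E)%E by rewrite lee_fin mulr_ge0.
    rewrite (ge0_integral_sum P measurableT mai ai0).
    apply: eq_bigr => i _; under eq_integral do rewrite EFinM.
    rewrite (ge0_integralZl P measurableT (mind _ (mG i)) (ind0 _)) ?lee_fin //.
    by rewrite integral_indic // setIT.
  rewrite -sumEFin; apply: lee_sum => i _; rewrite EFinM.
  by apply: lee_wpmul2l; [rewrite lee_fin|case: (GP i)].
by rewrite mulrC EFinM lee_pdivlMl //; apply: le_trans h1 h2.
Qed.

(** For fixed [l], the event that [E l J] holds for all large [J] is an increasing union of sets of
    probability at most [C / l.+1]; letting [l] grow leaves a null set. Off it, some [l] has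
    infinitely many [J] outside [E l J]. *)
Lemma eventually_negligible (C : R) (E : nat -> nat -> set T) : 0 <= C ->
  (forall l J, prob_le P (E l J) (C / l.+1%:R)) ->
  P.-negligible [set w | forall l, exists N, forall J, (N <= J)%N -> E l J w].
Proof.
move=> C0 HE.
have /choice[G GP] (lJ : nat * nat) := HE lJ.1 lJ.2.
pose F l N := \bigcap_(J in [set J | (N <= J)%N]) G (l, J).
have mF l N : measurable (F l N).
  by apply: bigcap_measurableType => J _; case: (GP (l, J)).
have mU l : measurable (\bigcup_N F l N) by exact: bigcupT_measurable.
have Fle l : (P (\bigcup_N F l N) <= (C / l.+1%:R)%:E)%E.
  have cv : P \o F l @ \oo --> P (\bigcup_N F l N).
    apply: nondecreasing_cvg_mu => //.
    move=> m n mn; apply/subsetPset => w Fw J /= nJ; apply: Fw => /=.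
    exact: leq_trans nJ.
  rewrite -(cvg_lim _ cv) //; apply: lime_le; first by apply/cvg_ex; eexists; exact: cv.
  near=> N => /=; apply: (@le_trans _ _ (P (G (l, N)))).
    apply: le_measure; rewrite ?inE //; first by case: (GP (l, N)).
    by move=> w; apply => /=.
  by case: (GP (l, N)).
exists (\bigcap_l \bigcup_N F l N); split.
- by apply: bigcapT_measurable => l; exact: mU.
- apply/eqP; rewrite eq_le measure_ge0 andbT; apply/lee_addgt0Pr => e e0; rewrite add0e.
  have [M MP] : exists M : nat, C / e < M%:R.
    by exists (Num.bound (C / e)); apply: archi_boundP; rewrite divr_ge0 // ltW.
  apply: le_trans (le_trans _ (Fle M)) _.
    apply: le_measure; rewrite ?inE //.
    + by apply: bigcapT_measurable => l; exact: mU.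
    + by move=> w; apply.
  rewrite lee_fin ler_pdivrMr // -ler_pdivrMl // mulrC (le_trans (ltW MP)) //.
  by rewrite ler_nat.
- move=> w Ew l _; have [N NP] := Ew l; exists N => // J /= NJ.
  by case: (GP (l, J)) => _ + _; apply; exact: NP.
Unshelve. all: by end_near.
Qed.

End MarkovEvents.

(** * Summation of the expected energy *)

Section EnergySum.
Context {R : realType}.

Lemma geometric_sum_le (z : R) n : 0 <= z < 1 -> \sum_(k < n) z ^+ k <= (1 - z)^-1.
Proof.
move=> /andP[z0 z1]; have z1' : 0 < 1 - z by rewrite subr_gt0.
rewrite -div1r ler_pdivlMr //.
have -> : (\sum_(k < n) z ^+ k) * (1 - z) = 1 - z ^+ n.
  elim: n => [|n IH]; first by rewrite big_ord0 mul0r expr0 subrr.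
  by rewrite big_ord_recr /= mulrDl IH exprS; ring.
by rewrite lerBlDr lerDl exprn_ge0.
Qed.

(** Pairs closer than [2^(-n)] are given probability 1, pairs at scale [k] the bound [C2 g'^m r^k].
    The Frostman bound turns scale [k] into [(q r)^k] and the near-diagonal part into [q^n <= g'^m],
    so two geometric series remain. *)
Lemma energy_sum_bound (I : finType) (w : I -> R) (x : I -> R) (n J : nat)
    (q r g g' C2 c : R) :
  0 < q -> 0 <= r -> q * r < 1 -> 0 <= g -> 0 <= g' -> g * g' < 1 -> 0 <= C2 ->
  (forall m, (m <= J)%N -> q ^+ n <= g' ^+ m) ->
  (forall i, 0 <= w i) -> \sum_i w i = c ->
  (forall k i, (k <= n)%N -> \sum_(i' | `|x i - x i'| * 2 ^+ k <= 1) w i' <= 3 * q ^+ k) ->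
  \sum_(m < J.+1) g ^+ m * (\sum_i \sum_i' w i * w i' *
     ((if `|x i - x i'| * 2 ^+ n <= 1 then 1 else 0) +
      \sum_(k < n) (if `|x i - x i'| * 2 ^+ k <= 1 then C2 * g' ^+ m * r ^+ k else 0)))
  <= 3 * c * (1 + C2 / (1 - q * r)) / (1 - g * g').
Proof.
move=> q0 r0 qr g0 g'0 gg C20 qn w0 wc near.
have c0 : 0 <= c by rewrite -wc; exact: sumr_ge0.
have qr0 : 0 <= q * r by rewrite mulr_ge0 // ltW.
have K0 : 0 <= 1 + C2 / (1 - q * r) by rewrite addr_ge0 // divr_ge0 // subr_ge0 ltW.
have one (m : nat) : (m <= J)%N -> \sum_i \sum_i' w i * w i' *
     ((if `|x i - x i'| * 2 ^+ n <= 1 then 1 else 0) +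
      \sum_(k < n) (if `|x i - x i'| * 2 ^+ k <= 1 then C2 * g' ^+ m * r ^+ k else 0))
   <= 3 * c * (1 + C2 / (1 - q * r)) * g' ^+ m.
  move=> mJ; have gm0 : 0 <= g' ^+ m by rewrite exprn_ge0.
  have -> : 3 * c * (1 + C2 / (1 - q * r)) * g' ^+ m =
      \sum_i w i * (3 * (1 + C2 / (1 - q * r)) * g' ^+ m).
    by rewrite -mulr_suml wc; ring.
  apply: ler_sum => i _.
  have -> : \sum_i' w i * w i' *
     ((if `|x i - x i'| * 2 ^+ n <= 1 then 1 else 0) +
      \sum_(k < n) (if `|x i - x i'| * 2 ^+ k <= 1 then C2 * g' ^+ m * r ^+ k else 0)) =
    w i * (\sum_(i' | `|x i - x i'| * 2 ^+ n <= 1) w i' +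
      \sum_(k < n) (C2 * g' ^+ m * r ^+ k) * \sum_(i' | `|x i - x i'| * 2 ^+ k <= 1) w i').
    under [X in _ = _ * (_ + X)]eq_bigr => k _ do rewrite mulr_sumr big_mkcond /=.
    rewrite [X in _ = _ * (_ + X)]exchange_big /= [X in _ = _ * (X + _)]big_mkcond /=.
    rewrite -big_split /= mulr_sumr.
    apply: eq_bigr => i' _; rewrite -mulrA; congr (_ * _); rewrite mulrDr; congr (_ + _).
      by case: ifP; rewrite ?mulr1 ?mulr0.
    rewrite mulr_sumr; apply: eq_bigr => k _; case: ifP => _; last by rewrite mulr0.
    by rewrite mulrC.
  rewrite ler_wpM2l //.
  have h1 := near n i (leqnn n).
  have h2 : \sum_(k < n) (C2 * g' ^+ m * r ^+ k) * (\sum_(i' | `|x i - x i'| * 2 ^+ k <= 1) w i') <=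
     3 * C2 * g' ^+ m * \sum_(k < n) (q * r) ^+ k.
    rewrite mulr_sumr; apply: ler_sum => k _.
    apply: (@le_trans _ _ (C2 * g' ^+ m * r ^+ k * (3 * q ^+ k))).
      apply: ler_wpM2l; first by rewrite !mulr_ge0 // exprn_ge0.
      exact: near (ltnW (ltn_ord k)).
    by rewrite exprMn le_eqVlt; apply/orP; left; apply/eqP; ring.
  have h3 : \sum_(k < n) (q * r) ^+ k <= (1 - q * r)^-1 by apply: geometric_sum_le; rewrite qr0.
  have h4 := qn m mJ.
  apply: (@le_trans _ _ (3 * g' ^+ m + 3 * C2 * g' ^+ m * (1 - q * r)^-1)).
    apply: lerD; first by apply: le_trans h1 _; rewrite ler_pM2l.
    by apply: le_trans h2 _; rewrite ler_wpM2l // !mulr_ge0.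
  by rewrite le_eqVlt; apply/orP; left; apply/eqP; ring.
apply: (@le_trans _ _ (\sum_(m < J.+1) (3 * c * (1 + C2 / (1 - q * r))) * (g * g') ^+ m)).
  apply: ler_sum => m _; apply: (@le_trans _ _ (g ^+ m * (3 * c * (1 + C2 / (1 - q * r)) * g' ^+ m))).
    by apply: ler_wpM2l; [rewrite exprn_ge0|exact: one (ltn_ord m)].
  by rewrite exprMn le_eqVlt; apply/orP; left; apply/eqP; ring.
rewrite -mulr_sumr; apply: ler_wpM2l; first by rewrite !mulr_ge0.
by apply: geometric_sum_le; rewrite gg mulr_ge0.
Qed.

End EnergySum.

(** * Real powers *)

Section RealPowers.
Context {R : realType}.

Lemma powR_exprn (x p : R) n : 0 <= x -> (x ^+ n) `^ p = (x `^ p) ^+ n.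
Proof. by move=> x0; rewrite -powR_mulrn // powRAC powR_mulrn ?powR_ge0. Qed.

Lemma powR_inv (x p : R) : 0 <= x -> x^-1 `^ p = x `^ (- p).
Proof. by move=> x0; rewrite -powR_inv1 // -powRrM mulN1r. Qed.

Lemma powR2_lt1 (p : R) : p < 0 -> 2 `^ p < 1.
Proof.
move=> p0; rewrite -(opprK p) powRN invf_lt1 ?powR_gt0 //.
have p1 : 0 < - p by rewrite oppr_gt0.
by have := @gt0_ltr_powR R (- p) p1 1 2; rewrite powR1; apply; rewrite ?nnegrE // ltr1n.
Qed.

Lemma energyM (x y : R) : 0 <= x -> energy (x * y) = energy x * energy y.
Proof. by move=> x0; rewrite /energy sqrtrM // mulrACA. Qed.

Lemma energyE (h : R) : 0 < h -> energy h = h `^ (3 / 2).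
Proof.
move=> h0; have -> : 3 / 2 = 1 + 2^-1 :> R by field.
by rewrite powRD ?gt_eqF ?implybT // powRr1 ?ltW // powR12_sqrt // ltW.
Qed.

Lemma sum_curry (A B : finType) (F : A * B -> R) : \sum_p F p = \sum_a \sum_b F (a, b).
Proof. by rewrite pair_bigA; apply: eq_bigr => -[]. Qed.

Lemma unit_dist_le1 (x y : R) : 0 <= x <= 1 -> 0 <= y <= 1 -> `|x - y| <= 1.
Proof. by move=> /andP[? ?] /andP[? ?]; rewrite ler_norml; apply/andP; split; lra. Qed.

End RealPowers.

(** * Almost sure lower bound for the image of a compact set *)

Section LowerBound.
Context {R : realType} {d : measure_display} {T : measurableType d}.
Variables (P : probability T R) (theta : int -> {RV P >-> R}).
Hypothesis theta_indep : mutually_independent theta.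
Hypothesis theta_unif : forall n : int, uniform01 (theta n).

Let phi w t := riemann_phi (fun n => theta n w) t.

(** A probability that is below 1 and below [z] is below [z^th]. The small-ball bound
    [4^(-m) 2^(3 k / 2)] may grow too fast in [k] to be summed against the masses; [th] trades decay
    in [m] for slower growth in [k]. *)
Lemma small_ball_scaled (th L : R) : 0 < th <= 1 -> 0 < L <= 64^-1 ->
  exists2 C2 : R, 0 <= C2 & forall a x y (m k : nat), `|x - y| <= 1 -> 1 < `|x - y| * 2 ^+ k.+1 ->
  prob_le P [set w | `|phi w (a + L * x) - phi w (a + L * y)| * 2 ^+ m.+1 <= 1]
    (C2 * (4 `^ (- th)) ^+ m * (2 `^ (3 / 2 * th)) ^+ k).
Proof.
move=> /andP[t0 t1] /andP[L0 L1]; pose SB : R := small_ball_constant / energy (L / 2).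
have L2 : 0 < L / 2 by rewrite divr_gt0.
have SB0 : 0 < SB by rewrite divr_gt0 ?small_ball_constant_gt0 // energy_gt0.
exists (SB `^ th); first exact: powR_ge0.
move=> a x y m k xy1 xyk.
have xy0 : 0 < `|x - y|.
  by rewrite lt_neqAle normr_ge0 andbT eq_sym; apply: contraTneq xyk => ->; rewrite mul0r ltr10.
pose h := L * `|x - y|.
have h0 : 0 < h by rewrite mulr_gt0.
have h1 : h <= 64^-1 by apply: le_trans L1; rewrite ler_piMr // ltW.
have hd : `|a + L * x - (a + L * y)| = h.
  have -> : a + L * x - (a + L * y) = L * (x - y) by ring.
  by rewrite normrM gtr0_norm.
pose z := SB * (4 ^+ m)^-1 * (2 ^+ k) `^ (3 / 2).
have p4 : 0 < 4 ^+ m :> R by rewrite exprn_gt0.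
have p2 : 0 < 2 ^+ k :> R by rewrite exprn_gt0.
have pp : 0 < (2 ^+ k) `^ (3 / 2) :> R by rewrite powR_gt0.
have z0 : 0 < z by rewrite /z; apply: mulr_gt0 pp; apply: mulr_gt0 SB0 _; rewrite invr_gt0.
have key (S : R) : 0 < S -> S `^ th * (4 `^ (- th)) ^+ m * (2 `^ (3 / 2 * th)) ^+ k =
    (S / 4 ^+ m * (2 ^+ k) `^ (3 / 2)) `^ th.
  move=> S0; have i4 : 0 <= (4 ^+ m)^-1 :> R by rewrite invr_ge0 ltW.
  rewrite (@powRM _ (S / 4 ^+ m)) ?(ltW pp) //; last by rewrite mulr_ge0 // ltW.
  rewrite (@powRM _ S) ?(ltW S0) // powR_inv ?(ltW p4) // (@powR_exprn R 4) //.
  by congr (_ * _); rewrite -(powR_exprn (x := 2)) // powRrM.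
rewrite key // -/z.
have hz : prob_le P [set w | `|phi w (a + L * x) - phi w (a + L * y)| * 2 ^+ m.+1 <= 1] z.
  have Q0 : (0 < 2 ^ m)%N by rewrite expn_gt0.
  have h01 : 0 < h <= 64^-1 by rewrite h0.
  apply: prob_leS (small_ball theta_indep theta_unif h01 hd Q0).
    by move=> w /=; rewrite natrX exprS.
  rewrite natrX -exprM mulnC exprM (_ : 2 ^+ 2 = 4 :> R); last by ring.
  rewrite /z /SB.
  have hk : (2 ^+ k)^-1 <= 2 * `|x - y|.
    rewrite -div1r ler_pdivrMr //; apply: ltW; apply: lt_le_trans xyk _.
    by rewrite exprS le_eqVlt; apply/orP; left; apply/eqP; ring.
  have Eh : energy (L / 2) * ((2 ^+ k) `^ (3 / 2))^-1 <= energy h.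
    have -> : h = L / 2 * (2 * `|x - y|) by rewrite /h; field.
    rewrite (energyM _ (ltW L2)) ler_pM2l ?energy_gt0 // energyE ?mulr_gt0 //.
    rewrite -powRN -powR_inv ?(ltW p2) //; apply: ge0_ler_powR => //.
    - by rewrite nnegrE invr_ge0 ltW.
    - by rewrite nnegrE mulr_ge0.
  have e1 := energy_gt0 L2; have e2 := energy_gt0 h0.
  rewrite ler_pdivrMr; last exact: mulr_gt0 p4 e2.
  apply: (@le_trans _ _ (small_ball_constant / energy (L / 2) / 4 ^+ m * (2 ^+ k) `^ (3 / 2) *
      (4 ^+ m * (energy (L / 2) * ((2 ^+ k) `^ (3 / 2))^-1)))).
    by rewrite le_eqVlt; apply/orP; left; apply/eqP; field; rewrite !gt_eqF.
  apply: ler_wpM2l; first by rewrite !mulr_ge0 ?invr_ge0 ?(ltW small_ball_constant_gt0) ?(ltW e1) ?(ltW p4) ?(ltW pp).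
  by rewrite ler_pM2l.
have [zl|zg] := leP z 1.
  apply: prob_leS hz => //; apply: ger1_powR => //; by rewrite z0.
exists setT; split => //; rewrite probability_setT lee_fin.
by rewrite -[leLHS](powRr0 z); exact: (ler_powR (ltW zg) (ltW t0)).
Qed.

(** The exponent [t] is quantified inside the event, so a single null set serves all of
    [[0, gam]]. *)
Lemma lower_bound_compact (s gam L a c : R) (K : set R) :
  0 < s -> 0 < gam < 2 -> gam < 4 / 3 * s -> 0 < L <= 64^-1 ->
  compact K -> K `<=` `[0, 2^-1]%classic -> 0 < c ->
  (c%:E <= dcontent (2 `^ (- s)) K)%E ->
  P.-negligible [set w | exists2 t, 0 <= t <= gam &
    hausdorff_null t ((fun u => phi w (a + L * u)) @` K)].
Proof.
move=> s0 /andP[g0 g2] gs L01 cK K01 c0 cE; have [L0 L1] := andP L01.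
(* Strictly between [gam / 2] and [2 s / 3]: the lower bound gives [g * g' < 1], the upper one
   [q * r < 1]. The cap at 1 is compatible with the lower bound because [gam < 2]. *)
pose th := Num.min ((gam / 2 + 2 / 3 * s) / 2) 1.
have th1 : th <= 1 by rewrite ge_min lexx orbT.
have thg : gam / 2 < th by rewrite lt_min; apply/andP; split; lra.
have ths : th < 2 / 3 * s by rewrite gt_min; apply/orP; left; lra.
have th0 : 0 < th by lra.
have th01 : 0 < th <= 1 by rewrite th0.
have [C2 C20 SBall] := small_ball_scaled th01 L01.
set q := 2 `^ (- s) in cE; pose g : R := 2 `^ gam; pose g' : R := 4 `^ (- th).
pose r : R := 2 `^ (3 / 2 * th).
have q0 : 0 < q by rewrite powR_gt0.
have g'E : g' = 2 `^ (- (2 * th)).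
  by rewrite /g' (_ : 4 = 2 ^+ 2); [rewrite powR_exprn // -powR_mulrn ?powR_ge0 // -powRrM; congr powR; ring|ring].
have two0 : 2 != 0 :> R by [].
have qr : q * r < 1.
  rewrite /q /r -powRD ?two0 ?implybT //; apply: powR2_lt1; lra.
have gg : g * g' < 1.
  rewrite g'E /g -powRD ?two0 ?implybT //; apply: powR2_lt1; lra.
(* Since [th <= s], the mass bound for very close pairs in a tree of depth [2 * J] is below
   [g' ^+ m] at all scales [m <= J]; hence this depth. *)
have qg (J m : nat) : (m <= J)%N -> q ^+ (2 * J) <= g' ^+ m.
  move=> mJ; have q2 : q ^+ 2 <= g'.
    rewrite g'E -powR_mulrn ?powR_ge0 // -powRrM; apply: ler_powR; first by rewrite ler1n.
    lra.
  have g'1 : g' <= 1.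
    by rewrite g'E; apply: ltW; apply: powR2_lt1; lra.
  rewrite exprM; apply: (@le_trans _ _ (g' ^+ J)).
    by apply: lerXn2r; rewrite ?nnegrE ?exprn_ge0 ?powR_ge0.
  by apply: ler_wiXn2l => //; exact: powR_ge0.
have K1 : K `<=` [set x | 0 <= x < 1].
  move=> x /K01 /=; rewrite in_itv /= => /andP[-> h] /=; apply: le_lt_trans h _.
  by rewrite invf_lt1 // ltr1n.
pose data (J : nat) (p : ('I_(2 ^ (2 * J)) -> R) * ('I_(2 ^ (2 * J)) -> R)) :=
  [/\ forall i, 0 <= p.1 i, forall i, 0 <= p.2 i <= 1 /\ (p.1 i != 0 -> K (p.2 i)),
      \sum_i p.1 i = c &
      forall k i, (k <= 2 * J)%N ->
        \sum_(i' | `|p.2 i - p.2 i'| * 2 ^+ k <= 1) p.1 i' <= 3 * q ^+ k].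
have ex J : exists p, @data J p.
  by have [w [x H]] := discrete_frostman q0 (2 * J) (ltW c0) K1 cE; exists (w, x).
pose p J := sval (cid (ex J)).
have pP J : @data J (p J) by rewrite /p; case: cid.
pose B : R := 3 * c * (1 + C2 / (1 - q * r)) / (1 - g * g').
have B0 : 0 <= B.
  by rewrite divr_ge0 ?subr_ge0 ?(ltW gg) // !mulr_ge0 ?(ltW c0) // addr_ge0 // divr_ge0 // subr_ge0 ltW.
pose psi w u := phi w (a + L * u).
pose E (l J : nat) : set T := [set w | l.+1%:R <= pair_energy (p J).1 (psi w \o (p J).2) g J].
have HE l J : prob_le P (E l J) (B / l.+1%:R).
  have [w0 x01 wc near] := pP J; set w := (p J).1 in w0 x01 wc near; set x := (p J).2 in x01 near.
  pose I : finType := ('I_J.+1 * ('I_(2 ^ (2 * J)) * 'I_(2 ^ (2 * J))))%type.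
  pose Ev (t : I) : set T := [set om | `|psi om (x t.2.1) - psi om (x t.2.2)| * 2 ^+ t.1.+1 <= 1].
  (* For a pair at distance above [2^(-2 J)] the relevant [k] is the last one with distance at most
     [2^(-k)]; keeping all earlier ones leaves [b] an upper bound and spares sorting the pairs. *)
  pose b (t : I) := (if `|x t.2.1 - x t.2.2| * 2 ^+ (2 * J) <= 1 then 1 else 0) +
      \sum_(k < 2 * J) (if `|x t.2.1 - x t.2.2| * 2 ^+ k <= 1 then C2 * g' ^+ t.1 * r ^+ k else 0).
  pose al (t : I) := g ^+ t.1 * (w t.2.1 * w t.2.2).
  have term0 (t : I) (k : 'I_(2 * J)) :
      0 <= (if `|x t.2.1 - x t.2.2| * 2 ^+ k <= 1 then C2 * g' ^+ t.1 * r ^+ k else 0).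
    by case: ifP => // _; rewrite !mulr_ge0 ?exprn_ge0 ?powR_ge0.
  have Evb t : prob_le P (Ev t) (b t).
    have [far|far] := leP (`|x t.2.1 - x t.2.2| * 2 ^+ (2 * J)) 1.
      exists setT; split => //; rewrite probability_setT lee_fin /b far lerDl.
      by apply: sumr_ge0 => k _.
    have xy1 : `|x t.2.1 - x t.2.2| <= 1.
      exact: unit_dist_le1 (proj1 (x01 _)) (proj1 (x01 _)).
    have exk : exists k, 1 < `|x t.2.1 - x t.2.2| * 2 ^+ k by exists (2 * J)%N.
    case: (ex_minnP exk) => k kgt kmin.
    have kJ : (k <= 2 * J)%N by exact: kmin.
    case: k kgt kmin kJ => [|k] kgt kmin kJ.
      by move: kgt; rewrite expr0 mulr1 ltNge xy1.
    have kle : `|x t.2.1 - x t.2.2| * 2 ^+ k <= 1.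
      by rewrite leNgt; apply/negP => /kmin; rewrite ltnn.
    apply: prob_leS (SBall a _ _ t.1 k xy1 kgt) => //.
    rewrite /b (bigD1 (Ordinal kJ)) //= kle addrCA lerDl addr_ge0 //; first by case: ifP.
    by apply: sumr_ge0 => k' _.
  have al0 t : 0 <= al t by rewrite !mulr_ge0 ?exprn_ge0 ?powR_ge0.
  have l1 : 0 < l.+1%:R :> R by rewrite ltr0n.
  apply: prob_leS (weighted_markov l1 al0 Evb).
    move=> om; rewrite /E /=; congr (_ <= _).
    rewrite /pair_energy [RHS]big_mkcond /= [RHS]sum_curry; apply: eq_bigr => m _.
    rewrite [RHS]sum_curry mulr_sumr; apply: eq_bigr => i _; rewrite mulr_sumr [LHS]big_mkcond /=.
    by apply: eq_bigr => i' _; rewrite /Ev /= asboolb.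
  rewrite ler_pM2r ?invr_gt0 //.
  have := @energy_sum_bound R _ w x (2 * J) J q r g g' C2 c q0 (powR_ge0 _ _) qr (powR_ge0 _ _)
     (powR_ge0 _ _) gg C20 (qg J) w0 wc near.
  move=> /(le_trans _); apply; rewrite le_eqVlt; apply/orP; left; apply/eqP.
  rewrite sum_curry; apply: eq_bigr => m _.
  rewrite sum_curry mulr_sumr; apply: eq_bigr => i _; rewrite mulr_sumr; apply: eq_bigr => i' _.
  by rewrite /al /b /= -[LHS]mulrA.
apply: negligibleS (eventually_negligible B0 HE) => w [t tg null] l.
apply: contrapT => /forallNP H.
apply: (energy_lower_bound (c := c) (lam := l.+1%:R) cK _ g0 c0 _ tg _ null) => //.
- move=> x e e0; have [dl dl0 dlP] := riemann_phi_continuous (fun n => theta n w) (a + L * x) e0.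
  exists dl => // y xy; apply: dlP.
  have -> : a + L * x - (a + L * y) = L * (x - y) by ring.
  rewrite normrM gtr0_norm //; apply: le_trans xy; rewrite ler_piMl // (le_trans L1) //.
  by rewrite invf_le1 // ler1n.
- move=> N; have /existsNP[J /not_implyP[NJ nE]] := H N.
  have [w0 x01 wc near] := pP J.
  exists J, 'I_(2 ^ (2 * J)), (p J).1, (p J).2; split => //.
  + by move=> i; exact: (x01 i).2.
  + by rewrite leNgt; apply/negP => /ltW.
Qed.

End LowerBound.

(** * Reduction to bounded pieces of the line *)

Section Charts.
Context {R : realType}.

Lemma hausdorff_nullS (V : normedZmodType R) (s : R) (A B : set V) :
  A `<=` B -> hausdorff_null s B -> hausdorff_null s A.
Proof.
move=> AB H dl e d0 e0; have [U [BU Ud Us]] := H dl e d0 e0.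
by exists U; split => //; exact: subset_trans BU.
Qed.

(** [2 ^ n] intervals of level [n] cost [(2 q)^n], which tends to 0 because [s > 1]. *)
Lemma dcontent_eq0 (s : R) (E : set R) : 1 < s -> E `<=` `[0, 2^-1]%classic ->
  dcontent (2 `^ (- s)) E = 0%E.
Proof.
move=> s1 E1; set q : R := 2 `^ (- s).
have q0 : 0 < q by rewrite powR_gt0.
have z0 : 0 <= 2 * q by rewrite mulr_ge0 // ltW.
have z1 : 2 * q < 1.
  have two0 : 2 != 0 :> R by [].
  rewrite /q -[X in X * _]powRr1 // -powRD ?two0 ?implybT //.
  by apply: powR2_lt1; rewrite subr_lt0.
apply/eqP; rewrite eq_le dcontent_ge0 // andbT; apply/lee_addgt0Pr => e e0; rewrite add0e.
have [n ze] : exists n, (2 * q) ^+ n <= e.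
  have /cvgrPdist_le/(_ e e0)[n _ H] : ((2 * q) ^+ n @[n --> \oo] --> 0).
    by apply: cvg_expr; rewrite ger0_norm.
  by exists n; have := H n (leqnn n); rewrite /= sub0r normrN ger0_norm // exprn_ge0.
pose C := [set I : nat * nat | I.1 = n /\ (I.2 < 2 ^ n)%N].
apply: le_trans (dcontent_le_cost (C := C) q _) _.
  move=> x /E1 /=; rewrite in_itv /= => /andP[x0 x2].
  have [j nj] := dyadic_floor n x0; exists (n, j) => //; split => //=.
  have /andP[h _] := nj; move: h => /=; rewrite -(ltr_nat R) natrX => h; apply: le_lt_trans h _.
  by rewrite gtr_pMl ?exprn_gt0 //; apply: le_lt_trans x2 _; rewrite invf_lt1 // ltr1n.
have bij : set_bij `I_(2 ^ n) C (fun j => (n, j)).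
  split; [by move=> j /= jn|by move=> j k _ _ []|].
  by move=> [m k] [/= mn kn]; exists k => //; rewrite mn.
rewrite /dcost (reindex_esum _ _ _ _ bij) /=.
rewrite esum_fset; [|exact: finite_II|by move=> i _; rewrite lee_fin exprn_ge0 // ltW].
rewrite -fsbig_ord /= sumEFin sumr_const card_ord lee_fin.
by rewrite -mulr_natl natrX -exprMn.
Qed.

(** An enumeration of the multiples of [L / 2], so that the images of [[0, 1/2]] under
    [u -> chart_base L n + L * u] cover the line; numbers that code no integer repeat the chart at
    0. *)
Definition chart_base (L : R) (n : nat) : R := (odflt 0 (unpickle n : option int))%:~R * (L / 2).

Lemma chart_cover (L x : R) : 0 < L ->
  exists n u, 0 <= u <= 2^-1 /\ chart_base L n + L * u = x.
Proof.
move=> L0; pose z := Num.floor (x / (L / 2)).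
exists (pickle z), (x / L - z%:~R / 2); rewrite /chart_base pickleK /=.
have := floor_itv (x / (L / 2)); rewrite -/z intrD => /andP[z1 z2].
have E : x / (L / 2) = 2 * (x / L) by field; rewrite gt_eqF.
rewrite E in z1 z2; split; last by field; rewrite gt_eqF.
by apply/andP; split; lra.
Qed.

Definition chart (L : R) (n : nat) (A : set R) : set R :=
  `[0, 2^-1]%classic `&` [set u | A (chart_base L n + L * u)].

Lemma chart_union (L : R) (A : set R) : 0 < L ->
  A `<=` \bigcup_n ((fun u => chart_base L n + L * u) @` chart L n A).
Proof.
move=> L0 x Ax; have [n [u [u01 ux]]] := chart_cover x L0.
exists n => //; exists u => //; split; first by rewrite /= in_itv.
by rewrite /= ux.
Qed.

Lemma measurable_chart (L : R) n (A : set R) : measurable A -> measurable (chart L n A).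
Proof.
move=> mA; apply: measurableI; first exact: measurable_itv.
rewrite -[X in measurable X]setTI.
suff mf : measurable_fun setT (fun u : R => chart_base L n + L * u) by exact: mf.
apply: measurable_funD; first exact: measurable_cst.
by apply: measurable_funM; [exact: measurable_cst|exact: measurable_id].
Qed.

(** Otherwise all charts have content 0, and [A], a countable union of [s]-null sets, has dimension
    at most [s]. *)
Lemma chart_content (L s : R) (A : set R) : 0 < L -> 0 < s -> (s%:E < hausdorff_dim A)%E ->
  exists n, (0 < dcontent (2 `^ (- s)) (chart L n A))%E.
Proof.
move=> L0 s0 sA; apply: contrapT => /forallNP H.
have : (hausdorff_dim A <= s%:E)%E; last by rewrite leNgt sA.
apply: hausdorff_dim_le; first exact: ltW.
have cov : A `<=` _ := @chart_union L A L0; apply: (hausdorff_nullS cov); apply: hausdorff_null_bigcup => n.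
apply: dcontent_null => //; first by move=> x [/=]; rewrite in_itv /= => /andP[].
by apply/eqP; rewrite eq_le dcontent_ge0 ?powR_gt0 // andbT leNgt; apply/negP; exact: H.
Qed.

Lemma hausdorff_dim_real (A : set R) : (hausdorff_dim A <= 1)%E.
Proof.
rewrite leNgt; apply/negP => A1.
have : exists2 s : R, 1 < s & (s%:E < hausdorff_dim A)%E.
  case: (hausdorff_dim A) A1 => [D| |] //; rewrite ?lte_fin => D1; last by exists 2; rewrite ?ltr1n ?ltry.
  by exists ((1 + D) / 2); rewrite ?lte_fin; lra.
move=> [s s1 sA]; have s0 : 0 < s by apply: lt_trans s1.
have [n] := chart_content ltr01 s0 sA.
by rewrite dcontent_eq0 ?ltxx // => x [].
Qed.

End Charts.

(** * Almost sure lower bound for Borel sets *)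

Section AlmostSureLowerBound.
Context {R : realType} {d : measure_display} {T : measurableType d}.
Variables (P : probability T R) (theta : int -> {RV P >-> R}).
Hypothesis theta_indep : mutually_independent theta.
Hypothesis theta_unif : forall n : int, uniform01 (theta n).

Let phi w t := riemann_phi (fun n => theta n w) t.

Lemma lower_bound_scale (A : set R) (s gam : R) : measurable A ->
  0 < s -> (s%:E < hausdorff_dim A)%E -> 0 < gam < 2 -> gam < 4 / 3 * s ->
  P.-negligible [set w | (hausdorff_dim (phi w @` A) < gam%:E)%E].
Proof.
(* Small-ball bounds are available for increments of length up to [1 / 64], hence this scale. *)
move=> mA s0 sA g02 gs; pose L : R := 64^-1.
have L0 : 0 < L by rewrite invr_gt0.
have L01 : 0 < L <= 64^-1 by rewrite L0 /=.
have q0 : 0 < 2 `^ (- s) :> R by rewrite powR_gt0.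
have [n cE] := chart_content L0 s0 sA.
have [c c0 cE'] : exists2 c : R, 0 < c & (c%:E < dcontent (2 `^ (- s)) (chart L n A))%E.
  case: (dcontent _ _) cE => [D| |] //; rewrite ?lte_fin => D0; last by exists 1; rewrite ?ltry.
  by exists (D / 2); rewrite ?lte_fin; lra.
have E01 : chart L n A `<=` `[0, 2^-1]%classic by move=> x [].
have [K [Kc KE cK]] :=
  suslin_capacitable q0 (measurable_suslin (measurable_chart L n mA)) E01 cE'.
have K01 := subset_trans KE E01.
have Kcpt : compact K := subclosed_compact Kc (@segment_compact R 0 2^-1) K01.
have c3 : 0 < c / 3 by rewrite divr_gt0.
have cK3 : ((c / 3)%:E <= dcontent (2 `^ (- s)) K)%E.
  move: cK; case: (dcontent _ _) => [D| |] //; rewrite ?leey // -?EFinM ?lee_fin.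
    by move=> ?; lra.
  by rewrite mulrNy gtr0_sg // mul1e.
apply: negligibleS (lower_bound_compact theta_indep theta_unif (chart_base L n) s0 g02 gs L01 Kcpt K01 c3 cK3).
move=> w /= /hausdorff_dim_lt[t [t0 nt tg]]; exists t; first by rewrite t0 -lee_fin ltW.
apply: hausdorff_nullS nt => _ [u Ku <-]; exists (chart_base L n + L * u) => //.
by have [] := KE _ Ku.
Qed.

Lemma lower_bound (A : set R) : measurable A ->
  P.-negligible [set w | (hausdorff_dim (phi w @` A) < (4 / 3)%:E * hausdorff_dim A)%E].
Proof.
move=> mA; have := hausdorff_dim_real A; have := hausdorff_dim_ge0 A.
case DE : (hausdorff_dim A) => [D| |] //; rewrite !lee_fin -EFinM => D0 D1.
have [D00|D00] := eqVneq D 0.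
  rewrite D00 mulr0; apply: negligibleS (negligible_set0 P) => w /=.
  by rewrite ltNge hausdorff_dim_ge0.
have Dp : 0 < D by rewrite lt_neqAle eq_sym D00.
apply: (@negligibleS _ _ _ _ (\bigcup_k
    [set w | (hausdorff_dim (phi w @` A) < (4 / 3 * D * (1 - k.+2%:R^-1))%:E)%E])); last first.
  apply: negligible_bigcup => k.
  have k2 : 0 < k.+2%:R^-1 :> R by rewrite invr_gt0.
  have k21 : k.+2%:R^-1 < 1 :> R by rewrite invf_lt1 // ltr1n.
  have k3 : 0 < k.+3%:R^-1 :> R by rewrite invr_gt0.
  have k32 : k.+3%:R^-1 < k.+2%:R^-1 :> R by rewrite ltf_pV2 ?posrE // ltr_nat.
  (* [k.+3] against the [k.+2] in the image exponent makes [gam < 4 / 3 * s] strict while [s < D];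
     [gam < 2] comes from [D <= 1]. *)
  apply: (@lower_bound_scale _ (D * (1 - k.+3%:R^-1))) => //.
  - by rewrite mulr_gt0 // subr_gt0 (lt_trans k32).
  - by rewrite DE lte_fin gtr_pMr // gtrBl.
  - apply/andP; split; first by rewrite !mulr_gt0 // subr_gt0.
    apply: (@le_lt_trans _ _ (4 / 3 * D)); last by lra.
    by rewrite ler_piMr ?mulr_ge0 // lerBlDr lerDl ltW.
  - by rewrite -mulrA ltr_pM2l // ltr_pM2l // ltrD2l ltrN2.
move=> w /=; have := hausdorff_dim_ge0 (phi w @` A).
case xE : (hausdorff_dim _) => [x| |] //; rewrite lee_fin lte_fin => x0 xD.
have e0 : 0 < 4 / 3 * D - x by rewrite subr_gt0.
have [k kP] : exists k : nat, 4 / 3 * D / (4 / 3 * D - x) < k%:R.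
  by exists (Num.bound (4 / 3 * D / (4 / 3 * D - x))); apply: archi_boundP; rewrite divr_ge0 ?mulr_ge0 // ltW.
exists k => //=; rewrite xE lte_fin mulrBr mulr1 ltrBrDl -ltrBrDr ltr_pdivrMr //.
move: kP; rewrite ltr_pdivrMr // => kP; apply: lt_le_trans kP _.
by rewrite mulrC ler_pM2l // ler_nat -[k.+2]addn2 leq_addr.
Qed.

End AlmostSureLowerBound.

(** * Chaining over dyadic points *)

Section DyadicChaining.
Context {R : realType} {V : normedZmodType R}.
Variables (g : R -> V) (r : R) (n0 : nat).
Hypothesis r01 : 0 < r < 1.
Hypothesis g_continuous : forall x e : R, 0 < e -> exists2 d, 0 < d &
  forall y, `|x - y| <= d -> `|g x - g y| <= e.
Hypothesis g_increment : forall n j, (n0 <= n)%N -> (j <= 2 ^ n)%N ->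
  `|g (j%:R / 2 ^+ n) - g (j.+1%:R / 2 ^+ n)| <= r ^+ n.

Let p2 n : 0 < 2 ^+ n :> R. Proof. by rewrite exprn_gt0. Qed.

(** Equality occurs for [x = 1], which lies in the interval [j = 2 ^ n]; this is why [g_increment]
    reaches one step beyond the unit interval. *)
Lemma dyadic_index_le (x : R) n j : x <= 1 -> dyadic (n, j) x -> (j <= 2 ^ n)%N.
Proof.
move=> x1 /andP[/= h _]; rewrite -(ler_nat R) natrX; apply: le_trans h _.
by rewrite ler_piMl // ltW.
Qed.

(** Each refinement moves the left endpoint by at most one step of the finer grid. The factor
    [1 - r] keeps the geometric sums free of division. *)
Lemma dyadic_chain_finite (x : R) n j k i : 0 <= x <= 1 -> (n0 <= n)%N ->
  dyadic (n, j) x -> dyadic ((n + k)%N, i) x ->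
  (1 - r) * `|g (i%:R / 2 ^+ (n + k)) - g (j%:R / 2 ^+ n)| <= r ^+ n * (1 - r ^+ k).
Proof.
have [r0 r1] := andP r01; move=> /andP[x0 x1] nn nj; elim: k i => [|k IH] i.
  by rewrite addn0 => /(dyadic_inj nj) ->; rewrite subrr normr0 mulr0 expr0 subrr mulr0.
rewrite addnS => ki; set N := (n + k)%N in IH ki *.
have kj := dyadic_coarsen (leqnSn N) ki.
rewrite subSnn expn1 in kj; set m := (i %/ 2)%N in kj.
have mN := dyadic_index_le x1 kj.
have r1' : 0 < 1 - r by rewrite subr_gt0.
have step : `|g (i%:R / 2 ^+ N.+1) - g (m%:R / 2 ^+ N)| <= r ^+ N.+1.
  have -> : m%:R / 2 ^+ N = m.*2%:R / 2 ^+ N.+1 :> R.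
    by rewrite -muln2 natrM exprS; field; rewrite gt_eqF.
  have := divn_eq i 2; rewrite -/m muln2 modn2 => ->.
  case: (odd i); rewrite ?addn0 ?subrr ?normr0 ?exprn_ge0 ?(ltW r0) // addn1 distrC.
  apply: g_increment; first by rewrite (leq_trans nn) // leqW // leq_addr.
  by rewrite expnS mul2n leq_double.
apply: (@le_trans _ _ ((1 - r) * (r ^+ N.+1 + `|g (m%:R / 2 ^+ N) - g (j%:R / 2 ^+ n)|))).
  rewrite ler_pM2l //; apply: le_trans (ler_distD (g (m%:R / 2 ^+ N)) _ _) _.
  by rewrite lerD2r.
rewrite mulrDr; apply: le_trans (lerD (lexx _) (IH m kj)) _.
rewrite /N -addnS exprD exprS -subr_ge0.
rewrite (_ : _ - _ = r ^+ n * r ^+ k * (1 - r) ^+ 2); last by ring.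
by rewrite !mulr_ge0 ?exprn_ge0 // ltW.
Qed.

Lemma dyadic_chain (x : R) n j : 0 <= x <= 1 -> (n0 <= n)%N -> dyadic (n, j) x ->
  `|g x - g (j%:R / 2 ^+ n)| <= r ^+ n / (1 - r).
Proof.
have [r0 r1] := andP r01; move=> x01 nn nj; have [x0 x1] := andP x01.
have r1' : 0 < 1 - r by rewrite subr_gt0.
apply/ler_addgt0Pr => e e0; have [dl dl0 dlP] := g_continuous x e0.
have [k kP] : exists k : nat, dl^-1 < k%:R.
  by exists (Num.bound dl^-1); apply: archi_boundP; rewrite invr_ge0 ltW.
have [i ki] := dyadic_floor (n + k) x0.
apply: le_trans (ler_distD (g (i%:R / 2 ^+ (n + k))) _ _) _; rewrite addrC lerD //.
  rewrite ler_pdivlMr // mulrC; apply: le_trans (dyadic_chain_finite x01 nn nj ki) _.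
  by rewrite ler_piMr ?exprn_ge0 ?(ltW r0) // lerBlDr lerDl exprn_ge0 // ltW.
apply: dlP; have /andP[/= h1 h2] := ki.
have q0 := p2 (n + k).
have -> : x - i%:R / 2 ^+ (n + k) = (x * 2 ^+ (n + k) - i%:R) / 2 ^+ (n + k).
  by field; rewrite gt_eqF.
rewrite normrM ger0_norm ?subr_ge0 // gtr0_norm ?invr_gt0 //.
rewrite ler_pdivrMr //; apply: (@le_trans _ _ 1).
  by rewrite lerBlDr ltW // addrC natr1.
rewrite -ler_pdivrMl // mulr1; apply: le_trans (ltW kP) _.
rewrite -natrX ler_nat; apply: leq_trans (leq_pexp2l _ (leq_addl n k)) => //.
exact/ltnW/ltn_expl.
Qed.

(** Points at distance at most [2^(-n)] lie in the same or in adjacent intervals of level [n]: two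
    chains and one step join them. *)
Lemma dyadic_modulus (x y : R) n : 0 <= x <= 1 -> 0 <= y <= 1 -> (n0 <= n)%N ->
  `|x - y| * 2 ^+ n <= 1 -> `|g x - g y| <= (1 + 2 / (1 - r)) * r ^+ n.
Proof.
wlog xy : x y / x <= y.
  move=> H; have [/H|/ltW yx x01 y01 nn h] := leP x y; first exact.
  by rewrite distrC; apply: H => //; rewrite distrC.
have [r0 r1] := andP r01; move=> x01 y01 nn.
rewrite distrC ger0_norm ?subr_ge0 // mulrBl => h.
have [x0 x1] := andP x01; have [y0 y1] := andP y01.
have [j xj] := dyadic_floor n x0; have [k yk] := dyadic_floor n y0.
have xyn : x * 2 ^+ n <= y * 2 ^+ n by rewrite ler_pM2r.
have /andP[/= j1 j2] := xj; have /andP[/= k1 k2] := yk.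
have jk : (j <= k)%N by rewrite -ltnS -(ltr_nat R); apply: le_lt_trans k2; apply: le_trans xyn.
have kj : (k <= j.+1)%N.
  rewrite -ltnS -(ltr_nat R); apply: le_lt_trans k1 _; rewrite -[j.+2%:R]natr1.
  apply: (@le_lt_trans _ _ (x * 2 ^+ n + 1)); last by rewrite ltrD2r.
  by rewrite -lerBlDl.
have mid : `|g (j%:R / 2 ^+ n) - g (k%:R / 2 ^+ n)| <= r ^+ n.
  move: jk; rewrite leq_eqVlt => /predU1P[->|jk].
    by rewrite subrr normr0 exprn_ge0 // ltW.
  have -> : k = j.+1 by apply/eqP; rewrite eqn_leq kj.
  by apply: g_increment => //; exact: dyadic_index_le xj.
have hx := dyadic_chain x01 nn xj; have hy := dyadic_chain y01 nn yk.
rewrite (_ : _ * r ^+ n = r ^+ n / (1 - r) + (r ^+ n + r ^+ n / (1 - r))); last by ring.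
apply: le_trans (ler_distD (g (j%:R / 2 ^+ n)) _ _) _; apply: lerD hx _.
by apply: le_trans (ler_distD (g (k%:R / 2 ^+ n)) _ _) _; apply: lerD mid _; rewrite distrC.
Qed.

End DyadicChaining.

(** * Hoelder continuity from dyadic increments *)

Section HolderFromDyadic.
Context {R : realType} {V : normedZmodType R}.

Lemma dyadic_holder (g : R -> V) (beta : R) n0 : 0 < beta ->
  (forall x e : R, 0 < e -> exists2 d, 0 < d & forall y, `|x - y| <= d -> `|g x - g y| <= e) ->
  (forall n j, (n0 <= n)%N -> (j <= 2 ^ n)%N ->
     `|g (j%:R / 2 ^+ n) - g (j.+1%:R / 2 ^+ n)| <= (2 `^ (- beta)) ^+ n) ->
  exists2 C : R, 0 < C & forall x y, 0 <= x <= 1 -> 0 <= y <= 1 ->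
    `|x - y| <= (2 ^+ n0)^-1 -> `|g x - g y| <= C * `|x - y| `^ beta.
Proof.
move=> b0 gc gi; set r := 2 `^ (- beta) in gi.
have r0 : 0 < r by rewrite powR_gt0.
have r1 : r < 1 by apply: powR2_lt1; rewrite oppr_lt0.
have r01 : 0 < r < 1 by rewrite r0.
have r1' : 0 < 1 - r by rewrite subr_gt0.
have K0 : 0 < 1 + 2 / (1 - r) by rewrite addr_gt0 // divr_gt0.
exists ((1 + 2 / (1 - r)) * 2 `^ beta); first by rewrite mulr_gt0 // powR_gt0.
move=> x y x01 y01 xy.
have [->|nxy] := eqVneq x y.
  by rewrite !subrr !normr0 mulr_ge0 ?powR_ge0 // mulr_ge0 ?powR_ge0 // ltW.
have z0 : 0 < `|x - y| by rewrite normr_gt0 subr_eq0.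
have z1 : `|x - y| <= 1 by exact: unit_dist_le1.
have z01 : 0 < `|x - y| <= 1 by rewrite z0.
have [m [m1 m2]] := dyadic_scale z01.
have nm : (n0 <= m)%N.
  have : (2 ^+ m)^-1 < 2 * (2 ^+ n0)^-1 :> R.
    by apply: lt_le_trans m2 _; rewrite ler_pM2l.
  rewrite -ltr_pdivrMr ?invr_gt0 ?exprn_gt0 // invrK mulrC ltr_pdivrMr ?exprn_gt0 //.
  by rewrite -exprS -!natrX ltr_nat ltn_exp2l.
apply: le_trans (dyadic_modulus r01 gc gi x01 y01 nm _) _.
  by rewrite -ler_pdivlMr ?exprn_gt0 // div1r.
rewrite -mulrA ler_pM2l // -powRM ?(ltW z0) //.
have -> : r ^+ m = (2 ^+ m)^-1 `^ beta by rewrite powR_inv ?exprn_ge0 // powR_exprn.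
by apply: ge0_ler_powR; rewrite ?nnegrE ?invr_ge0 ?exprn_ge0 ?mulr_ge0 ?(ltW b0) ?(ltW m2).
Qed.

Lemma expR_poly_decay (y : R) m : 0 < y -> (0 < m)%N -> expR (- y) <= (m%:R / y) ^+ m.
Proof.
move=> y0 m0; have m0' : 0 < m%:R :> R by rewrite ltr0n.
have h : (y / m%:R) ^+ m <= expR y.
  have {2}-> : y = m%:R * (y / m%:R) by field; rewrite gt_eqF.
  rewrite expRM_natl; apply: lerXn2r; rewrite ?nnegrE ?expR_ge0 // ?divr_ge0 ?(ltW y0) ?(ltW m0') //.
  by apply: le_trans (expR_ge1Dx (y / m%:R)); rewrite lerDr.
rewrite expRN -[m%:R / y]invrK invf_div exprVn lef_pV2 ?posrE ?expR_gt0 //.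
by rewrite exprn_gt0 // divr_gt0.
Qed.

End HolderFromDyadic.

(** * Borel-Cantelli for outer probability *)

Section BorelCantelli.
Context {d : measure_display} {T : measurableType d} {R : realType}.
Variable P : probability T R.

Lemma borel_cantelli_geometric (F : nat -> set T) (C : R) : 0 <= C ->
  (forall n, prob_le P (F n) (C / (2 ^ n.+1)%:R)) ->
  P.-negligible [set w | forall N, exists2 n, (N <= n)%N & F n w].
Proof.
move=> C0 /choice[G GP].
have mG n : measurable (G n) by case: (GP n).
exists (lim_sup_set G); split.
- by apply: bigcap_measurable => // k _; exact: bigcup_measurable.
- apply: lim_sup_set_cvg0 => //; apply: (@le_lt_trans _ _ C%:E); last exact: ltry.
  apply: le_trans (epsilon_trick0 xpredT C0); apply: lee_nneseries => // n _.
  by case: (GP n).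
- move=> w H N _; have [n Nn Fn] := H N; exists n => //.
  by case: (GP n) => _ + _; apply.
Qed.

End BorelCantelli.

(** * Almost sure upper bound *)

Section AlmostSureUpperBound.
Context {R : realType} {d : measure_display} {T : measurableType d}.
Variables (P : probability T R) (theta : int -> {RV P >-> R}).
Hypothesis theta_indep : mutually_independent theta.
Hypothesis theta_unif : forall n : int, uniform01 (theta n).

Let phi w t := riemann_phi (fun n => theta n w) t.

Lemma sqrt_energy_dyadic n : Num.sqrt (energy (2 ^+ n)^-1) = (2 `^ (- (3 / 4))) ^+ n :> R.
Proof.
rewrite energyE ?invr_gt0 ?exprn_gt0 // powR_inv ?exprn_ge0 // powR_exprn //.
have -> : 2 `^ (- (3 / 2)) = (2 `^ (- (3 / 4))) ^+ 2 :> R.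
  by rewrite -powR_mulrn ?powR_ge0 // -powRrM; congr powR; field.
by rewrite -exprM mulnC exprM sqrtr_sqr ger0_norm // exprn_ge0 // powR_ge0.
Qed.

(** Up to constants the tail at level [n] is [exp (- v^n / 4)] with [v > 1]. It is compared with
    [v^(- n m)] where [v^m >= 4]; the resulting [4^(-n)] survives the union over [2 ^ n + 1] grid
    points. *)
Lemma dyadic_increments_tail (beta b : R) : 0 < beta < 3 / 4 ->
  exists2 C, 0 <= C & forall n, prob_le P
    [set w | exists2 j : 'I_(2 ^ n).+1, true &
      (2 `^ (- beta)) ^+ n < `|phi w (b + j%:R / 2 ^+ n) - phi w (b + j.+1%:R / 2 ^+ n)|]
    (C / (2 ^ n.+1)%:R).
Proof.
move=> /andP[b0 b1]; pose v : R := 2 `^ (3 / 4 - beta).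
have v1 : 1 < v.
  have : 2 `^ (beta - 3 / 4) < 1 :> R by apply: powR2_lt1; lra.
  by rewrite /v -(opprB beta) powRN invf_gt1 // powR_gt0.
have v0 : 0 < v by apply: lt_trans v1.
have [m m0 m4] : exists2 m : nat, (0 < m)%N & 4 <= v ^+ m.
  have : (v^-1 ^+ n @[n --> \oo] --> 0).
    by apply: cvg_expr; rewrite ger0_norm ?invr_ge0 ?(ltW v0) // invf_lt1.
  have q0 : 0 < 4^-1 :> R by rewrite invr_gt0.
  move=> /cvgrPdist_le/(_ _ q0)[n _ H]; exists n.+1 => //.
  have := H n.+1 (leqnSn n); rewrite /= sub0r normrN ger0_norm ?exprn_ge0 ?invr_ge0 ?(ltW v0) //.
  by rewrite exprVn lef_pV2 // posrE // exprn_gt0.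
pose D : R := 4 * (expR 19 * (4 * m%:R) ^+ m).
have D0 : 0 <= D by rewrite !mulr_ge0 ?expR_ge0 ?exprn_ge0 // mulr_ge0.
exists (4 * D) => [|n]; first by rewrite mulr_ge0.
have p2 : 0 < 2 ^+ n :> R by rewrite exprn_gt0.
have one (j : 'I_(2 ^ n).+1) : prob_le P
    [set w | (2 `^ (- beta)) ^+ n < `|phi w (b + j%:R / 2 ^+ n) - phi w (b + j.+1%:R / 2 ^+ n)|]
    (D / (2 ^+ n) ^+ 2).
  have h01 : 0 < (2 ^+ n : R)^-1 <= 1.
    by rewrite invr_gt0 p2 invf_le1 // exprn_ege1 // ler1n.
  have hd : `|b + j%:R / 2 ^+ n - (b + j.+1%:R / 2 ^+ n)| = (2 ^+ n)^-1 :> R.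
    rewrite -natr1 (_ : _ - _ = - (2 ^+ n)^-1); last by ring.
    by rewrite normrN gtr0_norm // invr_gt0.
  have u0 : 0 < (2 `^ (- beta)) ^+ n :> R by rewrite exprn_gt0 // powR_gt0.
  apply: prob_leS (increment_tail theta_indep theta_unif h01 hd u0) => //.
  rewrite sqrt_energy_dyadic; set s : R := 2 `^ (- (3 / 4)).
  have s0 : 0 < s by rewrite powR_gt0.
  have -> : (2 `^ (- beta)) ^+ n / (4 * s ^+ n) = v ^+ n / 4.
    have -> : 2 `^ (- beta) = v * s.
      have two0 : 2 != 0 :> R by [].
      by rewrite /v /s -powRD ?two0 ?implybT //; congr powR; ring.
    by rewrite exprMn; field; rewrite gt_eqF // exprn_gt0.
  have y0 : 0 < v ^+ n / 4 by rewrite divr_gt0 // exprn_gt0.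
  rewrite expRD /D -mulrA ler_pM2l // -mulrA ler_pM2l ?expR_gt0 //.
  apply: le_trans (expR_poly_decay y0 m0) _.
  have -> : m%:R / (v ^+ n / 4) = 4 * m%:R / v ^+ n by field; rewrite gt_eqF // exprn_gt0.
  rewrite expr_div_n ler_wpM2l ?exprn_ge0 ?mulr_ge0 //.
  rewrite lef_pV2 ?posrE ?exprn_gt0 // -!exprM mulnC [X in _ <= _ ^+ X]mulnC !exprM.
  by apply: lerXn2r; rewrite ?nnegrE ?exprn_ge0 ?(ltW v0) // (le_trans _ m4) // expr2 -natrM.
apply: prob_leS (prob_le_bigcup (D := xpredT) (fun j _ => one j)) => //.
rewrite sumr_const card_ord -[_ *+ (2 ^ n).+1]mulr_natl natrX.
have -> : 4 * D / 2 ^+ n.+1 = (2 * 2 ^+ n) * (D / (2 ^+ n) ^+ 2).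
  by rewrite exprS; field; rewrite gt_eqF.
apply: ler_wpM2r; first by rewrite divr_ge0 // exprn_ge0 // ltW.
have : 1 <= 2 ^+ n :> R by rewrite exprn_ege1 // ler1n.
by rewrite -[(2 ^ n).+1%:R]natr1 natrX => ?; lra.
Qed.

Lemma riemann_holder_ae (beta b : R) : 0 < beta < 3 / 4 ->
  P.-negligible [set w | ~ exists C d0, [/\ 0 < C, 0 < d0 &
    forall x y, 0 <= x - b <= 1 -> 0 <= y - b <= 1 -> `|x - y| <= d0 ->
      `|phi w x - phi w y| <= C * `|x - y| `^ beta]].
Proof.
move=> b01; have [b0 _] := andP b01; have [C C0 HC] := dyadic_increments_tail b b01.
apply: negligibleS (borel_cantelli_geometric C0 HC) => w /= nh N.
apply: contrapT => H; apply: nh.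
have [||C' C'0 hold] := @dyadic_holder R _ (fun u => phi w (b + u)) beta N b0.
- move=> x e e0; have [dl dl0 dlP] := riemann_phi_continuous (fun n => theta n w) (b + x) e0.
  by exists dl => // y xy; apply: dlP; rewrite opprD addrACA subrr add0r.
- move=> n j Nn jn; rewrite leNgt; apply/negP => lt; apply: H; exists n => //.
  by exists (Ordinal (jn : (j < (2 ^ n).+1)%N)).
exists C', (2 ^+ N)^-1; split => //.
move=> x y xb yb xy; have := hold _ _ xb yb.
have bK z : b + (z - b) = z by ring.
have -> : x - b - (y - b) = x - y by ring.
by rewrite !bK; apply.
Qed.

(** The Hoelder events of countably many unit intervals, based at the integers since [chart_base 2]
    enumerates these, yield one null set for all [s] at once. *)
Lemma image_dimension_scale (A : set R) (beta : R) : 0 < beta < 3 / 4 ->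
  P.-negligible [set w | exists s, [/\ 0 <= s, hausdorff_null s A &
    ~ hausdorff_null (s / beta) (phi w @` A)]].
Proof.
move=> b01; have [b0 _] := andP b01.
apply: negligibleS (negligible_bigcup (fun n => riemann_holder_ae (chart_base 2 n) b01)).
move=> w [s [s0 sA nphi]]; apply: contrapT => H; apply: nphi.
pose A_ n := A `&` [set x | 0 <= x - chart_base 2 n <= 1].
have cov : phi w @` A `<=` \bigcup_n (phi w @` A_ n).
  move=> _ [x Ax <-]; have [n [u [/andP[u0 u1] ux]]] := chart_cover x (ltr0n R 2).
  exists n => //; exists x => //; split => //=; rewrite -ux addrAC subrr add0r.
  by apply/andP; split; lra.
apply: hausdorff_nullS cov _; apply: hausdorff_null_bigcup => n.
have : exists C d0, [/\ 0 < C, 0 < d0 &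
    forall x y, 0 <= x - chart_base 2 n <= 1 -> 0 <= y - chart_base 2 n <= 1 -> `|x - y| <= d0 ->
      `|phi w x - phi w y| <= C * `|x - y| `^ beta].
  by apply: contrapT => nh; apply: H; exists n.
move=> [C [d0 [C0 dl0 hold]]]; apply: (hausdorff_null_holder s0 b0 C0 dl0).
  by move=> x y [_ xb] [_ yb]; exact: hold.
by apply: hausdorff_nullS sA => x [].
Qed.

Lemma upper_bound (A : set R) :
  P.-negligible [set w | ((4 / 3)%:E * hausdorff_dim A < hausdorff_dim (phi w @` A))%E].
Proof.
(* Exponents increasing to [3 / 4]: as soon as [s < 3 / 4 * M], one of them satisfies
   [s / beta k <= M]. *)
pose beta k : R := 3 / 4 * (1 - k.+2%:R^-1).
have beta01 k : 0 < beta k < 3 / 4.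
  have k2 : 0 < k.+2%:R^-1 :> R by rewrite invr_gt0.
  have k21 : k.+2%:R^-1 < 1 :> R by rewrite invf_lt1 // ltr1n.
  by rewrite /beta; move: (k.+2%:R^-1) k2 k21 => u ? ?; apply/andP; split; lra.
apply: negligibleS (negligible_bigcup (fun k => image_dimension_scale A (beta01 k))).
move=> w /=; have := hausdorff_dim_real A; have := hausdorff_dim_ge0 A.
case DE : (hausdorff_dim A) => [D| |] //; rewrite !lee_fin -EFinM => D0 _ Dphi.
(* A real threshold, available even if the dimension of the image were infinite. *)
have [M DM Mphi] : exists2 M : R, 4 / 3 * D < M & (M%:E < hausdorff_dim (phi w @` A))%E.
  case: (hausdorff_dim _) Dphi => [E| |] //; rewrite ?lte_fin => DE'.
    by exists ((4 / 3 * D + E) / 2); rewrite ?lte_fin; lra.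
  by exists (4 / 3 * D + 1); rewrite ?ltry // ltrDl.
have [s [s0 sA]] : exists s, [/\ 0 <= s, hausdorff_null s A & (s%:E < (3 / 4 * M)%:E)%E].
  by apply: hausdorff_dim_lt; rewrite DE lte_fin; lra.
rewrite lte_fin => sM; have e0 : 0 < 3 / 4 * M - s by rewrite subr_gt0.
have M0 : 0 < 3 / 4 * M by apply: le_lt_trans sM.
have [k kP] : exists k : nat, 3 / 4 * M / (3 / 4 * M - s) < k%:R.
  by exists (Num.bound (3 / 4 * M / (3 / 4 * M - s))); apply: archi_boundP; rewrite divr_ge0 // ltW.
exists k => //; exists s; split => // null.
have [b0 b1] := andP (beta01 k).
have : (hausdorff_dim (phi w @` A) <= (s / beta k)%:E)%E.
  by apply: hausdorff_dim_le null; rewrite divr_ge0 // ltW.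
apply/negP; rewrite -ltNge; apply: le_lt_trans Mphi; rewrite lee_fin ler_pdivrMr //.
have -> : M * beta k = 3 / 4 * M - 3 / 4 * M / k.+2%:R by rewrite /beta; ring.
rewrite lerBrDl -lerBrDr ler_pdivrMr // [leRHS]mulrC -ler_pdivrMr //.
by apply: le_trans (ltW kP) _; rewrite ler_nat -[k.+2]addn2 leq_addr.
Qed.

End AlmostSureUpperBound.

Theorem corollary5p4 (R : realType) (d : measure_display)
    (T : measurableType d) (P : probability T R)
    (theta : int -> {RV P >-> R})
    (theta_indep : mutually_independent theta)
    (theta_unif : forall n : int, uniform01 (theta n))
    (A : set R) (mA : measurable A) :
  {ae P, forall w : T,
    hausdorff_dim (riemann_phi (fun n => theta n w) @` A) =
    ((4 / 3)%:E * hausdorff_dim A)%E}.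
Proof.
apply: negligibleS (negligibleU (lower_bound theta_indep theta_unif mA)
  (upper_bound theta_indep theta_unif A)).
move=> w /= neq; have [lt|lt|//] := ltgtP (hausdorff_dim (riemann_phi (fun n => theta n w) @` A))
  ((4 / 3)%:E * hausdorff_dim A)%E; by [left|right].
Qed.
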